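(* Fix $1\le q<\infty$ and constants $\alpha,\varepsilon>0$, and let $\frac{\alpha}{n}\le p=p(n)\le 1-\varepsilon$. Then the total variation distance satisfies $\mathrm{TV}\big(\mathrm{RGG}_q(n,d,p),G(n,p)\big)=o(1)$ as $n\to\infty$ whenever $d=d(n)=\omega\big(\max\{n\log n,\ p^2n^3\log^6 n\}\big)$.
   Context: For $x,y\in[-1/2,1/2]$ let $|x-y|_C=\min\{|x-y|,1-|x-y|\}$. For $\mathbf x_u,\mathbf x_v\in[-1/2,1/2]^d$ (the torus) let $\|\mathbf x_u-\mathbf x_v\|_q=\big(\sum_{i=1}^d|\mathbf x_u(i)-\mathbf x_v(i)|_C^q\big)^{1/q}$. $\mathrm{RGG}_q(n,d,p)$ is the law of the random graph on $[n]$ in which each vertex $v$ has an independent uniform position $\mathbf x_v\in[-1/2,1/2]^d$, and $\{u,v\}$ is an edge iff $\|\mathbf x_u-\mathbf x_v\|_q\le\tau$, where $\tau$ is the threshold for which each pair is an edge with probability exactly $p$. $G(n,p)$ is the law of the Erdős–Rényi graph. *)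

(* Defs.v *)
From HB Require Import structures.
From mathcomp Require Import all_boot all_order all_algebra.
From mathcomp Require Import all_classical all_reals all_analysis.
Set Implicit Arguments.
Unset Strict Implicit.
Unset Printing Implicit Defensive.
Import Order.TTheory GRing.Theory Num.Theory.
Import numFieldNormedType.Exports.
Local Open Scope classical_set_scope.
Local Open Scope ring_scope.

Definition cons_pair (T : Type) (n : nat) (z : T * n.-tuple T) : n.+1.-tuple T :=
  [the n.+1.-tuple T of z.1 :: z.2].

Lemma measurable_cons_pair (d : measure_display) (T : measurableType d)
    (n : nat) : measurable_fun [set: T * n.-tuple T] (@cons_pair T n).
Proof. by apply: measurable_cons. Qed.

HB.instance Definition _ (d : measure_display) (T : measurableType d)
    (n : nat) :=
  isMeasurableFun.Build _ _ _ _ (@cons_pair T n) (@measurable_cons_pair d T n).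

(* The n-fold product measure P^n on n-tuples, i.e. the joint law of n
   independent variables of law P: P^0 is the unit mass at the empty tuple and
   P^(n+1) is the image of P \x P^n under (x, t) |-> x :: t. *)
Fixpoint iid (d : measure_display) (T : measurableType d) (R : realType)
    (P : probability T R) (n : nat) : probability (n.-tuple T) R :=
  match n with
  | 0 => \d_[tuple]
  | m.+1 => distribution (P \x iid P m)%E (@cons_pair T m)
  end.

Lemma ltNhalf_half (R : realType) : - (2^-1) < 2^-1 :> R.
Proof. by rewrite gtrN. Qed.

Local Notation point R dim := (dim.-tuple (measurableTypeR R)).

(* The torus is the cube [-1/2, 1/2]^dim inside R^dim; its uniform law is that
   of dim independent coordinates, each uniform on [-1/2, 1/2]. *)
Definition torus_uniform (R : realType) (dim : nat) :
    probability (point R dim) R :=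
  iid (uniform_prob (ltNhalf_half R)) dim.

Definition circ_dist (R : realType) (x y : R) : R :=
  Num.min `|x - y| (1 - `|x - y|).

Definition torus_dist (R : realType) (q : R) (dim : nat)
    (x y : point R dim) : R :=
  (\sum_(i < dim) circ_dist (tnth x i) (tnth y i) `^ q) `^ q^-1.

Definition edge_prob (R : realType) (q : R) (dim : nat) (tau : R) : \bar R :=
  (torus_uniform R dim \x torus_uniform R dim)%E
    [set z | torus_dist q z.1 z.2 <= tau].

(* [get] picks an element of the set, or a default value if there is none. *)
Definition threshold (R : realType) (q : R) (dim : nat) (p : R) : R :=
  get [set tau : R | edge_prob q dim tau = p%:E].

(* Simple graphs on the vertex set 'I_n, represented by their edge sets. *)
Definition all_pairs (n : nat) : {set {set 'I_n}} :=
  [set e : {set 'I_n} | #|e| == 2%N]%SET.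

Definition sgraph (n : nat) := {E : {set {set 'I_n}} | E \subset all_pairs n}.

Definition geom_edges (R : realType) (q : R) (n dim : nat) (tau : R)
    (x : n.-tuple (point R dim)) : {set {set 'I_n}} :=
  [set e : {set 'I_n} | [exists u, exists v,
     [&& u != v, e == [set u; v]%SET
       & torus_dist q (tnth x u) (tnth x v) <= tau]]]%SET.

Lemma geom_edges_sub (R : realType) (q : R) (n dim : nat) (tau : R)
    (x : n.-tuple (point R dim)) :
  geom_edges q tau x \subset all_pairs n.
Proof.
apply/fintype.subsetP => e.
rewrite !inE => /existsP[u /existsP[v /and3P[uv /eqP-> _]]].
by rewrite cards2 uv.
Qed.

Definition geom_graph (R : realType) (q : R) (n dim : nat) (tau : R)
    (x : n.-tuple (point R dim)) : sgraph n :=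
  exist _ (geom_edges q tau x) (geom_edges_sub q tau x).

(* The laws RGG_q(n, dim, p) and G(n, p), as mass functions on graphs. *)
Definition RGG (R : realType) (q : R) (n dim : nat) (p : R) (G : sgraph n) : R :=
  fine (iid (torus_uniform R dim) n
    [set x | geom_graph q (threshold q dim p) x = G]).

Definition Gnp (R : realType) (n : nat) (p : R) (G : sgraph n) : R :=
  \prod_(e in all_pairs n) (if e \in val G then p else 1 - p).

Definition TV (R : realType) (T : finType) (mu nu : T -> R) : R :=
  2^-1 * \sum_(x : T) `|mu x - nu x|.

(* Main.v *)
From HB Require Import structures.
From mathcomp Require Import all_boot all_order all_algebra all_fingroup.
From mathcomp Require Import all_classical all_reals all_analysis.
From mathcomp Require Import measurable_realfun.
From mathcomp Require Import ring lra zify.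
Require Import Defs.
Set Implicit Arguments.
Unset Strict Implicit.
Unset Printing Implicit Defensive.
Import Order.TTheory GRing.Theory Num.Theory.
Import numFieldNormedType.Exports.
Local Open Scope classical_set_scope.
Local Open Scope ring_scope.

(** Let A_y be the set of torus points at distance at most the threshold from
y, so that every A_y has probability p and u, v are adjacent when x_u lies in
A_(x_v). What distinguishes this graph from an Erdos-Renyi graph is that the
codegree P(A_y /\ A_z) differs from p^2; its mean over z is exactly p^2. The
theorem holds because in high dimension the codegree is so concentrated that n
vertices cannot detect the difference.

Entropy. The total variation distance is at most c KL + 1/c for every c > 0
([tv_le_relent]). Vertices are revealed one at a time. Given the positions of k
vertices, the neighbourhood of a new vertex is compared with k independent coins
of parameter p; KL is at most chi-square, and the second moment of the
likelihood ratio is an average over two independent copies y, z of the new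
vertex, in which the k old vertices contribute equal factors. This gives ([tv_graph_law])
  KL <= sum over k < n of ( E (1 + (codeg y z - p^2) / (p (1 - p)))^k - 1 ).
As the codegree is centred at p^2, the k-th summand is of order
k^2 Var(codeg) / (p (1 - p))^2 plus 2^n times the probability that the codegree
exceeds p^2 by p (1 - p) / (2 n) ([power_mean]).

Concentration. If one coordinate of z is changed, then after a translation of
the same coordinate of t the event t in A_z only changes when t is close to the
boundary of both A_y and A_z: a corner ([codeg_coord]). The heart of the proof
is that corners have probability at most C (ln d)^2 / d times the codegree, up
to a negligible error ([corner_le], [corner_le_ratio]). Thus the codegree varies
by a factor 1 + O((ln d)^2 / d) per coordinate, and a moment estimate over d
independent coordinates ([moment_iid]) gives relative fluctuations of variance
v = O((ln d)^4 / d) with Gaussian tails ([codeg_var], [codeg_tail]).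

Corners. Flipping a coordinate of t to its antipode preserves the uniform law.
On a positive fraction of the coordinates a flip moves the q-distances to y and
z both by amounts between a constant and 1, in the same direction; on another
positive fraction in opposite directions. Averaging over random maximal chains
of flips of both kinds turns the cube of flips into a grid with binomial
weights, on which one distance increases in both variables and the other
increases in the first and decreases in the second. Boundedly many grid points
are corners, whereas each of them has M^2 grid points nearby, of comparable
weight, that lie in both balls, with M of order sqrt d / ln d ([grid_bound],
[flip_bound]). This needs z to be in general position with respect to y, which
fails with exponentially small probability; cutting the coordinates of z in two
halves lets the general position of one half serve the increments in the other.

Conclusion. Summing over k, the variance term is of order
n^3 p^2 (ln d)^4 / d, which tends to 0 because d exceeds p^2 n^3 (ln n)^6 by
a diverging factor, and the tail term is 2^n times a tail that is smaller than exp (- 3 n) ([sum_chi2_small]). *)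

(** * Bounded measurable functions and their expectations *)

Section Expectation.
Context (R : realType).

(** Boundedness makes every integral below finite, so that expectations are real
numbers and linearity and Fubini hold without integrability side conditions. *)
Definition bm d (T : measurableType d) (F : T -> R) :=
  measurable_fun [set: T] F /\ exists M, forall x, `|F x| <= M.

Definition Ex d (T : measurableType d) (P : probability T R) (F : T -> R) : R :=
  fine (\int[P]_x (F x)%:E)%E.

Section one.
Context d (T : measurableType d) (P : probability T R).
Implicit Types F G : T -> R.

Lemma bm_cst (c : R) : bm (fun _ : T => c).
Proof. by split; [exact: measurable_cst|exists `|c|]. Qed.

Lemma bmD F G : bm F -> bm G -> bm (fun x => F x + G x).
Proof.
move=> [mF [a ha]] [mG [b hb]]; split; first exact: measurable_funD.
by exists (a + b) => x; rewrite (le_trans (ler_normD _ _))// lerD.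
Qed.

Lemma bmN F : bm F -> bm (fun x => - F x).
Proof.
move=> [mF [a ha]]; split; first exact: measurableT_comp.
by exists a => x; rewrite normrN.
Qed.

Lemma bmB F G : bm F -> bm G -> bm (fun x => F x - G x).
Proof. by move=> hF hG; apply: bmD => //; exact: bmN. Qed.

Lemma bmM F G : bm F -> bm G -> bm (fun x => F x * G x).
Proof.
move=> [mF [a ha]] [mG [b hb]]; split; first exact: measurable_funM.
exists (a * b) => x; rewrite normrM ler_pM//.
Qed.

Lemma bmZ (c : R) F : bm F -> bm (fun x => c * F x).
Proof. by move=> hF; apply: bmM => //; exact: bm_cst. Qed.

Lemma bmX F n : bm F -> bm (fun x => F x ^+ n).
Proof.
move=> hF; elim: n => [|n IH]; first exact: bm_cst.
under eq_fun do rewrite exprS; exact: bmM.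
Qed.

Lemma bm_sum (I : Type) (s : seq I) (F : I -> T -> R) :
  (forall i, bm (F i)) -> bm (fun x => \sum_(i <- s) F i x).
Proof.
move=> hF; elim: s => [|i s IH].
  under eq_fun do rewrite big_nil; exact: bm_cst.
under eq_fun do rewrite big_cons; exact: bmD.
Qed.

Lemma bm_prod (I : Type) (s : seq I) (F : I -> T -> R) :
  (forall i, bm (F i)) -> bm (fun x => \prod_(i <- s) F i x).
Proof.
move=> hF; elim: s => [|i s IH].
  under eq_fun do rewrite big_nil; exact: bm_cst.
under eq_fun do rewrite big_cons; exact: bmM.
Qed.

Lemma bm_bool (b : T -> bool) :
  measurable_fun [set: T] b -> bm (fun x => (b x)%:R).
Proof.
move=> mb; split.
  rewrite (_ : (fun x => _) = (fun x => if b x then 1 else 0 : R)); last first.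
    by apply/funext => x; case: (b x).
  exact: measurable_fun_ifT.
by exists 1 => x; case: (b x); rewrite ?normr1 ?normr0.
Qed.

Lemma bm_expR F : bm F -> bm (fun x => expR (F x)).
Proof.
move=> [mF [a ha]]; split; first exact: measurableT_comp.
exists (expR a) => x; rewrite ger0_norm ?expR_ge0// ler_expR.
by rewrite (le_trans (ler_norm _)).
Qed.

Lemma bm_comp d' (T' : measurableType d') (G : T' -> R) (f : T -> T') :
  measurable_fun setT f -> bm G -> bm (fun x => G (f x)).
Proof.
move=> mf [mG [a ha]]; split; last by exists a.
exact: (measurableT_comp mG).
Qed.

Lemma bm_integrable F : bm F -> P.-integrable setT (EFin \o F).
Proof.
move=> [mF [a ha]].
have P1 : (P setT < +oo)%E.
  by rewrite [X in (X < _)%E](_ : _ = 1%E) ?ltry//; exact: probability_setT.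
apply: (@measurable_bounded_integrable _ _ _ P F setT measurableT P1 mF).
exists a; split; first exact: num_real.
by move=> x ax y _; exact: le_trans (ha y) (ltW ax).
Qed.

Lemma ExE F : bm F -> (\int[P]_x (F x)%:E)%E = (Ex P F)%:E.
Proof.
move=> hF; rewrite /Ex fineK//; exact: integrable_fin_num (bm_integrable hF).
Qed.

Lemma ExD F G : bm F -> bm G -> Ex P (fun x => F x + G x) = Ex P F + Ex P G.
Proof.
move=> hF hG; apply: RintegralD => //; exact: bm_integrable.
Qed.

Lemma ExZ (c : R) F : bm F -> Ex P (fun x => c * F x) = c * Ex P F.
Proof. move=> hF; apply: RintegralZl => //; exact: bm_integrable. Qed.

Lemma ExZr (c : R) F : bm F -> Ex P (fun x => F x * c) = Ex P F * c.
Proof. by move=> hF; rewrite mulrC -ExZ//; under eq_fun do rewrite mulrC. Qed.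

Lemma ExB F G : bm F -> bm G -> Ex P (fun x => F x - G x) = Ex P F - Ex P G.
Proof.
move=> hF hG; apply: RintegralB => //; exact: bm_integrable.
Qed.

Lemma Ex_cst (c : R) : Ex P (fun=> c) = c.
Proof.
rewrite /Ex integral_cst//.
by rewrite [X in (_ * X)%E](_ : _ = 1%E) ?mule1//; exact: probability_setT.
Qed.

Lemma le_Ex F G : bm F -> bm G -> (forall x, F x <= G x) -> Ex P F <= Ex P G.
Proof.
by move=> hF hG FG; apply: le_Rintegral => //; exact: bm_integrable.
Qed.

Lemma Ex_ge0 F : (forall x, 0 <= F x) -> 0 <= Ex P F.
Proof. by move=> F0; apply: Rintegral_ge0. Qed.

Lemma Ex_le_cst F (c : R) : bm F -> (forall x, F x <= c) -> Ex P F <= c.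
Proof.
by move=> hF FG; rewrite -[leRHS]Ex_cst; apply: le_Ex => //; exact: bm_cst.
Qed.

Lemma Ex_ge_cst F (c : R) : bm F -> (forall x, c <= F x) -> c <= Ex P F.
Proof.
by move=> hF FG; rewrite -[leLHS]Ex_cst; apply: le_Ex => //; exact: bm_cst.
Qed.

Lemma Ex_sum (I : Type) (s : seq I) (F : I -> T -> R) :
  (forall i, bm (F i)) ->
  Ex P (fun x => \sum_(i <- s) F i x) = \sum_(i <- s) Ex P (F i).
Proof.
move=> hF; elim: s => [|i s IH].
  by under eq_fun do rewrite big_nil; rewrite Ex_cst big_nil.
under eq_fun do rewrite big_cons.
by rewrite big_cons ExD ?IH//; exact: bm_sum.
Qed.

Lemma measurable_bool_set (b : T -> bool) :
  measurable_fun [set: T] b -> measurable [set x | b x].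
Proof. by move=> mb; have := mb measurableT [set true] I; rewrite setTI. Qed.

Lemma Ex_bool (b : T -> bool) : measurable_fun [set: T] b ->
  Ex P (fun x => (b x)%:R) = fine (P [set x | b x]).
Proof.
move=> mb; rewrite /Ex -[in RHS](setIT [set x | b x]) -integral_indic//.
  congr fine; apply: eq_integral => x _; congr EFin.
  by rewrite indicE/= mem_setE.
exact: measurable_bool_set.
Qed.

End one.

Section two.
Context d1 d2 (T1 : measurableType d1) (T2 : measurableType d2).
Context (P1 : probability T1 R) (P2 : probability T2 R).

Lemma bm_Ex (F : T1 * T2 -> R) : bm F -> bm (fun x => Ex P2 (fun y => F (x, y))).
Proof.
move=> hF; have hFx x : bm (fun y => F (x, y)).
  by apply: (bm_comp _ hF); exact: pair1_measurable.
split; last first.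
  case: (hF) => mF [M hM]; exists M => x; rewrite ler_norml.
  have h y : - M <= F (x, y) <= M by rewrite -ler_norml.
  apply/andP; split; [apply: Ex_ge_cst => // y|apply: Ex_le_cst => // y];
    by case/andP: (h y).
have := measurable_fubini_F (m1 := P1) (bm_integrable (P1 \x P2)%E hF).
by move=> mm; apply: (measurableT_comp _ mm); exact: fine_measurable.
Qed.

Lemma Ex_prod (F : T1 * T2 -> R) : bm F ->
  Ex (P1 \x P2)%E F = Ex P1 (fun x => Ex P2 (fun y => F (x, y))).
Proof.
move=> hF; have hFx x : bm (fun y => F (x, y)).
  by apply: (bm_comp _ hF); exact: pair1_measurable.
rewrite [in LHS]/Ex.
rewrite -(integral12_prod_meas1 (bm_integrable (P1 \x P2)%E hF)).
rewrite [in RHS]/Ex; congr fine; apply: eq_integral => x _.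
by rewrite /fubini_F/= ExE.
Qed.

Lemma Ex_prod2 (F : T1 * T2 -> R) : bm F ->
  Ex (P1 \x P2)%E F = Ex P2 (fun y => Ex P1 (fun x => F (x, y))).
Proof.
move=> hF; have hFy y : bm (fun x => F (x, y)).
  by apply: (bm_comp _ hF); exact: pair2_measurable.
rewrite [in LHS]/Ex.
rewrite -(integral21_prod_meas1 (bm_integrable (P1 \x P2)%E hF)).
rewrite [in RHS]/Ex; congr fine; apply: eq_integral => x _.
by rewrite /fubini_G/= ExE.
Qed.

Lemma Ex_swap (F : T1 -> T2 -> R) : bm (fun z : T1 * T2 => F z.1 z.2) ->
  Ex P1 (fun x => Ex P2 (F x)) = Ex P2 (fun y => Ex P1 (fun x => F x y)).
Proof. by move=> hF; rewrite -(Ex_prod hF) (Ex_prod2 hF). Qed.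

Lemma Ex_distribution (X : {mfun T1 >-> T2}) (F : T2 -> R) : bm F ->
  Ex (distribution P1 X) F = Ex P1 (fun x => F (X x)).
Proof.
move=> hF; rewrite /Ex integral_distribution//.
  by apply/measurable_EFinP; case: hF.
by apply: (@bm_integrable _ _ P1 (F \o X)); exact: bm_comp.
Qed.

End two.
End Expectation.

(** * Product measures: independence, coordinatewise maps, concentration *)

Section Iid.
Context (R : realType) d (T : measurableType d) (P : probability T R).

Lemma bm_cons_pair n (F : n.+1.-tuple T -> R) :
  bm F -> bm (fun z : T * n.-tuple T => F (cons_pair z)).
Proof. by move=> hF; apply: (bm_comp _ hF); exact: measurable_cons_pair. Qed.

Lemma bm_cons_pairr n (F : n.+1.-tuple T -> R) x :
  bm F -> bm (fun t : n.-tuple T => F (cons_pair (x, t))).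
Proof.
by move=> /bm_cons_pair hF; apply: (bm_comp _ hF); exact: pair1_measurable.
Qed.

Lemma bm_cons_pairEx n (F : n.+1.-tuple T -> R) :
  bm F -> bm (fun x => Ex (iid P n) (fun t => F (cons_pair (x, t)))).
Proof.
by move=> /bm_cons_pair hF; apply: (bm_Ex P (iid P n) hF).
Qed.

Lemma Ex_iid0 (F : 0.-tuple T -> R) : bm F -> Ex (iid P 0) F = F [tuple].
Proof.
move=> hF; rewrite /Ex/= integral_dirac//; first by rewrite diracE in_setT mul1e.
by apply/measurable_EFinP; case: hF.
Qed.

Lemma Ex_iidS n (F : n.+1.-tuple T -> R) : bm F ->
  Ex (iid P n.+1) F = Ex P (fun x => Ex (iid P n) (fun t => F (cons_pair (x, t)))).
Proof.
by move=> hF; rewrite /= Ex_distribution// Ex_prod//; exact: bm_cons_pair.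
Qed.

Lemma tnth_cons0 n (x : T) (t : n.-tuple T) : tnth (cons_pair (x, t)) ord0 = x.
Proof. by []. Qed.

Lemma tnth_consS n (x : T) (t : n.-tuple T) i :
  tnth (cons_pair (x, t)) (lift ord0 i) = tnth t i.
Proof. by rewrite [LHS]tnthS. Qed.

Lemma bm_tnth n (i : 'I_n) (g : T -> R) :
  bm g -> bm (fun t : n.-tuple T => g (tnth t i)).
Proof. by move=> hg; apply: (bm_comp _ hg); exact: measurable_tnth. Qed.

(** Independence of the coordinates, by peeling off the first one. *)
Lemma Ex_iid_prod n (g : 'I_n -> T -> R) : (forall i, bm (g i)) ->
  Ex (iid P n) (fun t => \prod_i g i (tnth t i)) = \prod_i Ex P (g i).
Proof.
elim: n g => [|n IH] g hg.
  rewrite Ex_iid0; first by rewrite !big_ord0.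
  by apply: bm_prod => i; exact: bm_tnth.
rewrite Ex_iidS; last by apply: bm_prod => i; exact: bm_tnth.
rewrite big_ord_recl -IH// -ExZr//; congr Ex; apply/funext => x.
rewrite -ExZ; last by apply: bm_prod => i; exact: bm_tnth.
congr Ex; apply/funext => t.
rewrite big_ord_recl; congr (_ * _).
by apply: eq_bigr => i _; rewrite tnth_consS.
Qed.

Definition coordmap n (phi : 'I_n -> T -> T) (t : n.-tuple T) : n.-tuple T :=
  [tuple phi i (tnth t i) | i < n].

Lemma measurable_coordmap n (phi : 'I_n -> T -> T) :
  (forall i, measurable_fun setT (phi i)) -> measurable_fun setT (coordmap phi).
Proof.
move=> mphi; apply/measurable_fun_tnthP => i.
rewrite (_ : _ \o _ = fun t => phi i (tnth t i)).
  by apply: measurableT_comp => //; exact: measurable_tnth.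
by apply/funext => t /=; rewrite tnth_mktuple.
Qed.

(** Applying to each coordinate a map that preserves its law preserves the law of
the whole tuple. *)
Lemma Ex_iid_coordmap n (phi : 'I_n -> T -> T) (F : n.-tuple T -> R) :
  (forall i, measurable_fun setT (phi i)) ->
  (forall i G, bm G -> Ex P (fun x => G (phi i x)) = Ex P G) ->
  bm F -> Ex (iid P n) (fun t => F (coordmap phi t)) = Ex (iid P n) F.
Proof.
move=> mphi ephi hF.
have hFp m (psi : 'I_m -> T -> T) (G : m.-tuple T -> R) :
    (forall i, measurable_fun setT (psi i)) -> bm G ->
    bm (fun t => G (coordmap psi t)).
  by move=> mpsi hG; apply: (bm_comp _ hG); exact: measurable_coordmap.
elim: n phi F mphi ephi hF => [|n IH] phi F mphi ephi hF.
  by rewrite !Ex_iid0//; [congr F; exact: tuple0|exact: hFp].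
rewrite !Ex_iidS//; last exact: hFp.
rewrite -[RHS](ephi ord0); last exact: bm_cons_pairEx.
congr Ex; apply/funext => x.
rewrite -[RHS](IH (fun i => phi (lift ord0 i)));
  [|by move=> i; exact: mphi|by move=> i; exact: ephi|exact: bm_cons_pairr].
congr Ex; apply/funext => t; congr F.
apply/eq_from_tnth => i; rewrite tnth_mktuple.
case: (unliftP ord0 i) => [j|] ->; last by rewrite !tnth_cons0.
by rewrite !tnth_consS tnth_mktuple.
Qed.

Lemma measurable_cat_tuple m n :
  measurable_fun setT (fun z : m.-tuple T * n.-tuple T => cat_tuple z.1 z.2).
Proof.
apply/measurable_fun_tnthP => i.
case: (split_ordP i) => j ->.
- rewrite (_ : _ \o _ = fun z => tnth z.1 j).
    by apply: (measurableT_comp (measurable_tnth j)); exact: measurable_fst.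
  by apply/funext => -[x y] /=; rewrite tnth_lshift.
- rewrite (_ : _ \o _ = fun z => tnth z.2 j).
    by apply: (measurableT_comp (measurable_tnth j)); exact: measurable_snd.
  by apply/funext => -[x y] /=; rewrite tnth_rshift.
Qed.

Lemma bm_cat m n (F : (m + n).-tuple T -> R) :
  bm F -> bm (fun z : m.-tuple T * n.-tuple T => F (cat_tuple z.1 z.2)).
Proof. by move=> hF; apply: (bm_comp _ hF); exact: measurable_cat_tuple. Qed.

Lemma bm_catr m n (F : (m + n).-tuple T -> R) x :
  bm F -> bm (fun y : n.-tuple T => F (cat_tuple x y)).
Proof.
by move=> /bm_cat hF; apply: (bm_comp (f := pair x) _ hF); exact: pair1_measurable.
Qed.

(** A tuple of m + n independent points is a pair of independent tuples, which
allows one to freeze half of the coordinates. *)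
Lemma Ex_iid_cat m n (F : (m + n).-tuple T -> R) : bm F ->
  Ex (iid P (m + n)) F =
  Ex (iid P m) (fun x => Ex (iid P n) (fun y => F (cat_tuple x y))).
Proof.
elim: m F => [|m IH] F hF.
  rewrite Ex_iid0; last exact: (bm_Ex (iid P 0) (iid P n) (bm_cat hF)).
  by congr Ex; apply/funext => y; congr F; exact: val_inj.
rewrite Ex_iidS; last exact: (bm_Ex (iid P m.+1) (iid P n) (bm_cat hF)).
rewrite [LHS](@Ex_iidS (m + n)%N)//.
congr Ex; apply/funext => x.
rewrite (IH (fun t => F (cons_pair (x, t)))); last first.
  exact: (@bm_cons_pairr (m + n)%N).
congr Ex; apply/funext => t; congr Ex; apply/funext => y; congr F.
exact: val_inj.
Qed.

End Iid.

Section Concentration.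
Context (R : realType) d (T : measurableType d) (P : probability T R).

Lemma expR_le_quad (y : R) : y <= 2^-1 -> expR y <= 1 + y + 2 * y ^+ 2.
Proof.
move=> y12.
have h2 : 1 - y <= expR (- y) by exact: expR_ge1Dx.
have h3 : expR y * expR (- y) = 1 by rewrite -expRD subrr expR0.
have h4 : 0 < expR y by exact: expR_gt0.
have h5 : expR y * (1 - y) <= 1 by rewrite -[leRHS]h3 ler_wpM2l// ltW.
have h6 : 1 <= (1 + y + 2 * y ^+ 2) * (1 - y).
  have : 0 <= y ^+ 2 * (1 - 2 * y) by apply: mulr_ge0; [exact: sqr_ge0|lra].
  by rewrite expr2; lra.
have h7 : 0 < 1 - y by lra.
by rewrite -(ler_pM2r h7); exact: le_trans h5 h6.
Qed.

(** For centred y this turns a first-order exponential bound into a second-order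
one: the linear term has mean 0. *)
Lemma expR_le_addsqr (y : R) : expR y <= y + expR (2 * y ^+ 2).
Proof.
have [y12|y12] := leP y 2^-1; last first.
  have : expR y <= expR (2 * y ^+ 2).
    have : 0 <= y * (y - 2^-1) by apply: mulr_ge0; lra.
    by rewrite ler_expR expr2; lra.
  lra.
have h1 : 1 + 2 * y ^+ 2 <= expR (2 * y ^+ 2) by exact: expR_ge1Dx.
by have := expR_le_quad y12; lra.
Qed.

(** If V varies by a factor at most 1 + l, then V / E V - 1 is centred and bounded
by l in absolute value, so the first-order term of the r-th power vanishes on
average. *)
Lemma moment_one_coord (V : T -> R) (c l : R) (r : nat) :
  bm V -> 0 < c -> 0 <= l -> (forall x, c <= V x) ->
  (forall x x', V x' <= (1 + l) * V x) ->
  Ex P (fun x => V x ^+ r) <= Ex P V ^+ r * expR (2 * r%:R ^+ 2 * l ^+ 2).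
Proof.
move=> hV c0 l0 cV hl; set m := Ex P V.
have m0 : 0 < m by apply: lt_le_trans c0 _; exact: Ex_ge_cst.
pose u x := V x / m - 1.
have hu : bm u by apply: bmB; [apply: bmM => //; exact: bm_cst|exact: bm_cst].
have Eu : Ex P u = 0.
  rewrite ExB ?Ex_cst//; [|by apply: bmM => //; exact: bm_cst|exact: bm_cst].
  by rewrite ExZr// divff ?subrr// gt_eqF.
have Vu x : V x = m * (1 + u x) by rewrite /u addrC subrK mulrCA divff ?mulr1// gt_eqF.
have Vl x : V x <= (1 + l) * m.
  by rewrite -ExZ//; apply: Ex_ge_cst => //; exact: bmZ.
have lV x : m <= (1 + l) * V x by exact: Ex_le_cst.
have ul x : `|u x| <= l.
  have V0 : 0 < V x := lt_le_trans c0 (cV x).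
  rewrite ler_norml; apply/andP; split; last first.
    have : m * (1 + u x) <= m * (1 + l) by rewrite -Vu mulrC.
    by rewrite ler_pM2l// lerD2l.
  have := lV x; rewrite {1}Vu mulrCA -{1}[m]mulr1 ler_pM2l// => h1.
  have u1 : 0 < 1 + u x by rewrite -(pmulr_rgt0 _ m0) -Vu.
  nra.
have hVr x : V x ^+ r <= m ^+ r * (r%:R * u x + expR (2 * r%:R ^+ 2 * l ^+ 2)).
  rewrite Vu exprMn; apply: ler_wpM2l; first by rewrite exprn_ge0// ltW.
  have u1 : 0 <= 1 + u x.
    by rewrite -(pmulr_rge0 _ m0) -Vu ltW// (lt_le_trans c0).
  apply: (@le_trans _ _ (expR (r%:R * u x))).
    by rewrite mulrC expRM_natr; apply: lerXn2r => //; rewrite ?nnegrE ?expR_ge0// expR_ge1Dx.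
  apply: le_trans (expR_le_addsqr _) _; rewrite lerD2l ler_expR -mulrA ler_wpM2l//.
  by rewrite exprMn ler_wpM2l ?sqr_ge0// -[leLHS]real_normK ?num_real// lerXn2r ?nnegrE.
apply: (@le_trans _ _ (Ex P (fun x => m ^+ r * (r%:R * u x + expR (2 * r%:R ^+ 2 * l ^+ 2))))).
  apply: le_Ex => //; first exact: bmX.
  by apply/bmZ/bmD; [exact: bmZ|exact: bm_cst].
rewrite ExZ; last by apply: bmD; [exact: bmZ|exact: bm_cst].
by rewrite ExD ?ExZ ?Eu ?mulr0 ?add0r ?Ex_cst//; [exact: bmZ|exact: bm_cst].
Qed.

(** The bound for one coordinate tensorises: averaging over all but the first
coordinate preserves the factor 1 + l, so induction on the dimension applies. The
lower bound c keeps the partial averages positive, so that one can divide by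
them. *)
Lemma moment_iid n (N : n.-tuple T -> R) (c l : R) (r : nat) :
  bm N -> 0 < c -> 0 <= l -> (forall t, c <= N t) ->
  (forall i t t', (forall j, j != i -> tnth t j = tnth t' j) ->
     N t' <= (1 + l) * N t) ->
  Ex (iid P n) (fun t => N t ^+ r) <=
  Ex (iid P n) N ^+ r * expR (2 * r%:R ^+ 2 * l ^+ 2 * n%:R).
Proof.
move=> + c0 l0; elim: n N => [|n IH] N hN cN hl.
  by rewrite !Ex_iid0//; [rewrite mulr0 expR0 mulr1|exact: bmX].
rewrite !Ex_iidS//; last exact: bmX.
pose V x := Ex (iid P n) (fun t => N (cons_pair (x, t))).
have hV : bm V by exact: bm_cons_pairEx.
apply: (@le_trans _ _ (Ex P (fun x => V x ^+ r * expR (2 * r%:R ^+ 2 * l ^+ 2 * n%:R)))).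
  apply: le_Ex.
  - exact: (bm_cons_pairEx P (bmX r hN)).
  - by apply: bmM; [exact: bmX|exact: bm_cst].
  move=> x; apply: IH => //; first exact: bm_cons_pairr.
  move=> i t t' tt'; apply: (hl (lift ord0 i)) => j.
  case: (unliftP ord0 j) => [k|] -> ji; last by rewrite !tnth_cons0.
  rewrite !tnth_consS; apply: tt'; apply: contra_neq ji => ->//.
rewrite ExZr; last exact: bmX.
rewrite -[n.+1%:R]natr1 mulrDr mulr1 expRD mulrC [leRHS]mulrCA ler_pM2l ?expR_gt0//.
apply: moment_one_coord c0 l0 _ _ => //.
  by move=> x; apply: Ex_ge_cst => //; exact: bm_cons_pairr.
move=> x x'; rewrite -ExZ; last exact: bm_cons_pairr.
apply: le_Ex; [exact: bm_cons_pairr|by apply: bmZ; exact: bm_cons_pairr|].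
move=> t; apply: (hl ord0) => j.
by case: (unliftP ord0 j) => [k|] ->; rewrite ?eqxx// !tnth_consS.
Qed.

(** Chernoff's bound: the Laplace transform of an indicator at -1 is at most
exp (- mean / 2). *)
Lemma count_tail n (b : 'I_n -> T -> bool) (L : R) :
  (forall i, measurable_fun setT (b i)) ->
  L <= \sum_i Ex P (fun x => (b i x)%:R) ->
  Ex (iid P n) (fun t => (\sum_i (b i (tnth t i))%:R <= L / 4 :> R)%R%:R)
  <= expR (- (L / 4)).
Proof.
move=> mb hL.
have hb i : bm (fun x => (b i x)%:R : R) by exact: bm_bool.
pose g (i : 'I_n) x : R := expR (- (b i x)%:R).
have hg i : bm (g i) by apply/bm_expR/bmN.
have mS : measurable_fun setT (fun t : n.-tuple T => \sum_i (b i (tnth t i))%:R : R).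
  have : bm (fun t : n.-tuple T => \sum_i (b i (tnth t i))%:R : R).
    by apply: bm_sum => i; exact: (bm_tnth i (hb i)).
  by case.
apply: (@le_trans _ _ (Ex (iid P n) (fun t => expR (L / 4) * \prod_i g i (tnth t i)))).
  apply: le_Ex.
  - apply: bm_bool; apply: measurable_fun_ler => //; exact: measurable_cst.
  - by apply: bmZ; apply: bm_prod => i; exact: bm_tnth.
  move=> t; have [h|h] := leP (\sum_i (b i (tnth t i))%:R) (L / 4); last first.
    by apply: mulr_ge0; [exact: expR_ge0|apply: prodr_ge0 => i _; exact: expR_ge0].
  rewrite /g -expR_sum -expRD sumrN (_ : true%:R = expR 0); last by rewrite expR0.
  by rewrite ler_expR subr_ge0.
rewrite ExZ; last by apply: bm_prod => i; exact: bm_tnth.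
rewrite Ex_iid_prod//.
have hE i : Ex P (g i) <= expR (- (2^-1 * Ex P (fun x => (b i x)%:R))).
  apply: le_trans (expR_ge1Dx _).
  rewrite -ExZ// -[X in X + _](Ex_cst P) -mulN1r -ExZ; last exact: bmZ.
  rewrite -ExD; [|exact: bm_cst|by do 2 apply: bmZ].
  apply: le_Ex => //; first by apply: bmD; [exact: bm_cst|do 2 apply: bmZ].
  move=> x; rewrite /g; case: (b i x); last by rewrite oppr0 expR0 !mulr0 addr0.
  rewrite mulr1 mulN1r expRN; have := expR_ge1Dx (1 : R).
  by move=> h; rewrite (_ : 1 - 2^-1 = 2^-1); [rewrite lef_pV2 ?posrE ?expR_gt0//|lra].
apply: (@le_trans _ _ (expR (L / 4) * expR (- (L / 2)))).
  rewrite ler_wpM2l ?expR_ge0//.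
  apply: (@le_trans _ _ (\prod_i expR (- (2^-1 * Ex P (fun x => (b i x)%:R))))).
    by apply: ler_prod => i _; rewrite hE andbT; apply: Ex_ge0 => x; exact: expR_ge0.
  rewrite -expR_sum ler_expR sumrN lerN2 -mulr_sumr mulrC ler_wpM2l//.
by rewrite -expRD ler_expR; lra.
Qed.
End Concentration.

(** * Relative entropy and the coding of graphs by triangular arrays *)

Section Pinsker.
Context (R : realType).

(** This is ln x <= x - 1 at x = sqrt (b / a), and it makes the relative entropy
dominate the squared Hellinger distance. *)
Lemma relent_ge (a b : R) : 0 <= a -> 0 < b ->
  (Num.sqrt a - Num.sqrt b) ^+ 2 + a - b <= a * ln (a / b).
Proof.
move=> a0 b0; have [->|a1] := eqVneq a 0.
  rewrite sqrtr0 sub0r sqrrN sqr_sqrtr; last exact: ltW.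
  by rewrite addr0 subrr mul0r lexx.
have {a1}a0 : 0 < a by rewrite lt_neqAle eq_sym a1.
pose u := Num.sqrt a; pose v := Num.sqrt b.
have u0 : 0 < u by rewrite sqrtr_gt0.
have v0 : 0 < v by rewrite sqrtr_gt0.
have au : a = u ^+ 2 by rewrite sqr_sqrtr// ltW.
have bv : b = v ^+ 2 by rewrite sqr_sqrtr// ltW.
rewrite -/u -/v au bv -expr_div_n lnXn ?divr_gt0//.
have h : 1 - v / u <= ln (u / v).
  have : ln (v / u) <= v / u - 1.
    have := @le_ln1Dx _ (v / u - 1).
    rewrite (_ : 1 + (v / u - 1) = v / u); last by ring.
    apply.
    by have := divr_gt0 v0 u0; lra.
  by rewrite -[u / v]invf_div lnV ?posrE ?divr_gt0//; lra.
have : u ^+ 2 * (1 - v / u) <= u ^+ 2 * ln (u / v).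
  by rewrite ler_pM2l// exprn_gt0.
have -> : u ^+ 2 * (1 - v / u) = u ^+ 2 - u * v by field; rewrite gt_eqF.
by rewrite -mulr_natr; lra.
Qed.

(** A weak form of Pinsker's inequality. The difference of two masses is the
product of the difference and the sum of their square roots; the arithmetic and
geometric means with weight c separate the two, and the squared differences are
controlled by the relative entropy. *)
Lemma tv_le_relent (I : finType) (mu nu : I -> R) (c : R) :
  (forall i, 0 <= mu i) -> (forall i, 0 < nu i) ->
  \sum_i mu i = 1 -> \sum_i nu i = 1 -> 0 < c ->
  TV mu nu <= c * \sum_i mu i * ln (mu i / nu i) + c^-1.
Proof.
move=> mu0 nu0 mu1 nu1 c0.
rewrite (_ : c^-1 = (4 * c)^-1 * 4); last by field; rewrite gt_eqF.
(* 2^-1 |s^2 - t^2| <= c (s - t)^2 + (s + t)^2 / (4 c),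
   and (s + t)^2 <= 2 s^2 + 2 t^2 *)
pose s i := Num.sqrt (mu i); pose t i := Num.sqrt (nu i).
have s2 i : s i ^+ 2 = mu i by rewrite sqr_sqrtr.
have t2 i : t i ^+ 2 = nu i by rewrite sqr_sqrtr// ltW.
have s0 i : 0 <= s i by exact: sqrtr_ge0.
have t0 i : 0 <= t i by exact: sqrtr_ge0.
have key i : 2^-1 * `|mu i - nu i| <=
    c * (s i - t i) ^+ 2 + (4 * c)^-1 * (2 * mu i + 2 * nu i).
  rewrite -s2 -t2 subr_sqr normrM [X in _ * (_ * X) <= _]ger0_norm ?addr_ge0//.
  set x := `|s i - t i|; set y := s i + t i.
  have hx : (s i - t i) ^+ 2 = x ^+ 2 by rewrite real_normK ?num_real.
  have hy : y ^+ 2 <= 2 * s i ^+ 2 + 2 * t i ^+ 2.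
    by have := sqr_ge0 (s i - t i); rewrite /y; nra.
  rewrite hx; apply: (@le_trans _ _ (c * x ^+ 2 + (4 * c)^-1 * y ^+ 2)).
    have : 0 <= c * (x - y / (2 * c)) ^+ 2 by rewrite mulr_ge0 ?sqr_ge0// ltW.
    have c1 : c != 0 by rewrite gt_eqF.
    have -> : c * (x - y / (2 * c)) ^+ 2 = c * x ^+ 2 + (4 * c)^-1 * y ^+ 2 - x * y.
      by field.
    have : 0 <= x * y by apply: mulr_ge0; [exact: normr_ge0|exact: addr_ge0].
    by lra.
  by rewrite lerD2l ler_wpM2l// invr_ge0 mulr_ge0// ltW.
rewrite /TV [leLHS]mulr_sumr.
apply: (@le_trans _ _ (\sum_i (c * (s i - t i) ^+ 2 +
    (4 * c)^-1 * (2 * mu i + 2 * nu i)))); first by apply: ler_sum => i _.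
rewrite big_split/= -!mulr_sumr big_split/= -!mulr_sumr mu1 nu1 !mulr1.
have -> : 2 + 2 = 4 :> R by rewrite -natrD.
rewrite lerD2r ler_wpM2l ?(ltW c0)//.
rewrite -subr_ge0 -sumrB.
have : 0 <= \sum_i (mu i * ln (mu i / nu i) - (s i - t i) ^+ 2 - mu i + nu i).
  apply: sumr_ge0 => i _; have := relent_ge (mu0 i) (nu0 i).
  by rewrite -/(s i) -/(t i); lra.
by rewrite big_split/= sumrB mu1 nu1 subrK.
Qed.
End Pinsker.

(** A graph on n vertices as a triangular array: the adjacencies of the first
vertex to the later ones, then the graph on the later ones. This shape makes
revealing a vertex a pairing. *)
Fixpoint tri (n : nat) : finType :=
  if n is m.+1 then ({ffun 'I_m -> bool} * tri m)%type else unit.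

Fixpoint enc (n : nat) : ('I_n -> 'I_n -> bool) -> tri n :=
  if n is m.+1 then fun r =>
    ([ffun j => r ord0 (lift ord0 j)],
     enc (fun i j => r (lift ord0 i) (lift ord0 j)))
  else fun=> tt.

Lemma enc_inj n (r r' : 'I_n -> 'I_n -> bool) :
  enc r = enc r' -> forall i j : 'I_n, (i < j)%N -> r i j = r' i j.
Proof.
elim: n r r' => [|n IH] r r'; first by move=> _ [].
move=> [/ffunP h1 h2] i j.
case: (unliftP ord0 i) => [i'|] ->; case: (unliftP ord0 j) => [j'|] ->//.
- by rewrite /= /bump/= !add1n ltnS => ij; exact: IH h2 i' j' ij.
- by move=> _; have := h1 j'; rewrite !ffunE.
Qed.

Lemma enc_ext n (r r' : 'I_n -> 'I_n -> bool) :
  (forall i j : 'I_n, (i < j)%N -> r i j = r' i j) -> enc r = enc r'.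
Proof.
elim: n r r' => [//|n IH] r r' h /=; congr pair.
  by apply/ffunP => j; rewrite !ffunE h.
by apply: IH => i j ij; apply: h; rewrite /= /bump/= !add1n ltnS.
Qed.

Section Base.
Context (R : realType) (p : R).

Definition bern (b : bool) : R := if b then p else 1 - p.

Fixpoint er_law (n : nat) : tri n -> R :=
  if n is m.+1 then fun g => (\prod_j bern (g.1 j)) * er_law g.2 else fun=> 1.

Lemma er_law_enc n (r : 'I_n -> 'I_n -> bool) :
  er_law (enc r) = \prod_(z : 'I_n * 'I_n | (z.1 < z.2)%N) bern (r z.1 z.2).
Proof.
rewrite -(pair_big_dep xpredT (fun i j : 'I_n => (i < j)%N)
   (fun i j => bern (r i j))) /=.
elim: n r => [|n IH] r; first by rewrite /= big_ord0.
rewrite [LHS]/= IH big_ord_recl; congr (_ * _).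
  rewrite [RHS]big_mkcond/= big_ord_recl/= mul1r.
  by apply: eq_bigr => j _; rewrite ffunE.
apply: eq_bigr => i _; rewrite [RHS]big_mkcond/= big_ord_recl/= mul1r.
by rewrite big_mkcond; apply: eq_bigr => j _; rewrite /bump/= !add1n ltnS.
Qed.

Hypothesis p01 : 0 < p < 1.

Lemma bern_gt0 b : 0 < bern b.
Proof. by case/andP: p01 => p0 p1; case: b; rewrite /bern; lra. Qed.

Lemma er_law_gt0 n (g : tri n) : 0 < er_law g.
Proof.
elim: n g => [//|n IH] g /=; apply: mulr_gt0; last exact: IH.
by apply: prodr_gt0 => j _; exact: bern_gt0.
Qed.

Lemma bern_sum : \sum_b bern b = 1.
Proof. by rewrite big_bool/= addrC subrK. Qed.

Lemma er_law_sum n : \sum_(g : tri n) er_law g = 1.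
Proof.
elim: n => [|n IH]; first by rewrite /= big_const card_unit /= addr0.
rewrite /= -(pair_bigA _ (fun (r : {ffun 'I_n -> bool}) (g : tri n) =>
  (\prod_j bern (r j)) * er_law g)) /=.
under eq_bigr do rewrite -mulr_sumr IH mulr1.
by rewrite -(bigA_distr_bigA (fun (j : 'I_n) b => bern b)) big1// => j _; exact: bern_sum.
Qed.
End Base.

(** * Entropy of a graph defined by independent hidden positions *)

Section Chain.
Context (R : realType) d (T : measurableType d) (P : probability T R).
Variables (adj : T -> T -> bool) (p : R).
Hypothesis madj : measurable_fun setT (fun z : T * T => adj z.1 z.2).
Hypothesis p01 : 0 < p < 1.
Hypothesis adjp : forall x, Ex P (fun t => (adj x t)%:R) = p.

Let codeg (x x' : T) : R := Ex P (fun t => (adj x t && adj x' t)%:R).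

(** The chi-square divergence between the neighbourhood of a new vertex among k
random points and k independent coins of parameter p, see [sum_nu2]. *)
Definition chi2 (k : nat) : R :=
  Ex P (fun x => Ex P (fun x' =>
    (1 + (codeg x x' - p ^+ 2) / (p * (1 - p))) ^+ k)) - 1.

Let graph n (x : n.-tuple T) : tri n := enc (fun i j => adj (tnth x i) (tnth x j)).

Let q n (g : tri n) : R := Ex (iid P n) (fun x => (graph x == g)%:R).

Let hit (x : T) n (t : n.-tuple T) (r : {ffun 'I_n -> bool}) : R :=
  \prod_j (adj x (tnth t j) == r j)%:R.

Let nu n (t : n.-tuple T) (r : {ffun 'I_n -> bool}) : R :=
  Ex P (fun x => hit x t r).

Let bm_eqadj (b : bool) : bm (fun z : T * T => (adj z.1 z.2 == b)%:R : R).
Proof.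
apply: bm_bool; apply: (measurable_fun_bool true); rewrite setTI.
rewrite (_ : _ @^-1` _ = (fun z : T * T => adj z.1 z.2) @^-1` [set b]).
  by rewrite -[X in measurable X]setTI; exact: madj.
by apply/seteqP; split => z /= /eqP.
Qed.

Let bm_hit n r : bm (fun z : T * n.-tuple T => hit z.1 z.2 r).
Proof.
apply: bm_prod => j.
apply: (bm_comp (f := fun z : T * n.-tuple T => (z.1, tnth z.2 j)) _ (bm_eqadj (r j))).
apply: measurable_fun_pair; first exact: measurable_fst.
by apply: (measurableT_comp (measurable_tnth j)); exact: measurable_snd.
Qed.

Let hit_ge0 x n (t : n.-tuple T) r : 0 <= hit x t r.
Proof. exact: prodr_ge0. Qed.

Let hitE x n (t : n.-tuple T) r :
  hit x t r = ([ffun j => adj x (tnth t j)] == r)%:R.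
Proof.
rewrite /hit; have [<-|] := eqVneq.
  by rewrite big1// => j _; rewrite ffunE eqxx.
move=> /eqP ne; have [j /eqP/negbTE h] : exists j, adj x (tnth t j) <> r j.
  apply: contrapT => /forallNP h; apply: ne; apply/ffunP => j; rewrite ffunE.
  exact: contrapT (h j).
by rewrite (bigD1 j)//= h mul0r.
Qed.

Let bm_nu n r : bm (fun t : n.-tuple T => nu t r).
Proof.
apply: (@bm_Ex _ _ _ _ _ (iid P n) P (fun z => hit z.2 z.1 r)).
apply: (bm_comp (f := fun z : n.-tuple T * T => (z.2, z.1)) _ (bm_hit r)).
by apply: measurable_fun_pair; [exact: measurable_snd|exact: measurable_fst].
Qed.

Let graphS n (x : T) (t : n.-tuple T) (r : {ffun 'I_n -> bool}) (g : tri n) :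
  (graph (cons_pair (x, t)) == (r, g) :> tri n.+1)%:R =
  hit x t r * (graph t == g)%:R :> R.
Proof.
rewrite hitE -natrM mulnb; congr (_%:R); congr (nat_of_bool (_ && _)).
by congr (_ == _); apply/ffunP => j; rewrite !ffunE tnth_cons0 tnth_consS.
by congr (_ == _); apply: enc_ext => i j _; rewrite !tnth_consS.
Qed.

Lemma bm_graph n (g : tri n) : bm (fun x : n.-tuple T => (graph x == g)%:R : R).
Proof.
elim: n g => [|n IH] g.
  rewrite (_ : (fun x => _) = (fun=> (tt == g)%:R)); first exact: bm_cst.
  by apply/funext => x; congr (_%:R); case: g.
have h : bm (fun z : T * n.-tuple T => hit z.1 z.2 g.1 * (graph z.2 == g.2)%:R).
  apply: bmM; first exact: bm_hit.
  by apply: (bm_comp _ (IH g.2)); exact: measurable_snd.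
pose f (x : n.+1.-tuple T) := (thead x, [tuple of behead x]).
have mf : measurable_fun setT f.
  apply: measurable_fun_pair; first exact: measurable_tnth.
  apply/measurable_fun_tnthP => i.
  rewrite (_ : _ \o _ = fun x => tnth x (lift ord0 i)); first exact: measurable_tnth.
  apply/funext => x /=; rewrite tnth_behead; congr tnth; apply: val_inj.
  by rewrite /= inordK// /bump/= ltnS.
rewrite (_ : (fun x => _) = fun x => hit (f x).1 (f x).2 g.1 * (graph (f x).2 == g.2)%:R).
  exact: (bm_comp mf h).
apply/funext => x; rewrite -graphS; congr ((graph _ == _)%:R); last by case: (g).
by apply: val_inj => /=; case/tupleP: x => x t.
Qed.

Lemma q_ge0 n g : 0 <= @q n g.
Proof. exact: Ex_ge0. Qed.

Lemma q_sum n : \sum_g @q n g = 1.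
Proof.
rewrite -Ex_sum//; last by move=> g; exact: bm_graph.
rewrite -[RHS](Ex_cst (iid P n)); congr Ex; apply/funext => x.
rewrite (bigD1 (graph x))//= eqxx big1 ?addr0// => g /negbTE.
by rewrite eq_sym => ->.
Qed.

Lemma qS n (r : {ffun 'I_n -> bool}) (g : tri n) :
  q ((r, g) : tri n.+1) = Ex (iid P n) (fun t => (graph t == g)%:R * nu t r).
Proof.
rewrite /q Ex_iidS; last exact: bm_graph.
under eq_fun do under eq_fun do rewrite graphS.
rewrite Ex_swap; last first.
  apply: bmM; first exact: bm_hit.
  by apply: (bm_comp _ (bm_graph g)); exact: measurable_snd.
congr Ex; apply/funext => t; rewrite ExZr 1?mulrC//.
by apply: (bm_comp (f := fun x => (x, t)) _ (bm_hit r)); exact: pair2_measurable.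
Qed.

Lemma sum_hit n x (t : n.-tuple T) : \sum_r hit x t r = 1.
Proof.
rewrite (bigD1 [ffun j => adj x (tnth t j)])//= hitE eqxx big1 ?addr0// => r.
by rewrite hitE eq_sym => /negbTE ->.
Qed.

Let bm_hitx n (t : n.-tuple T) r : bm (fun x => hit x t r).
Proof.
by apply: (bm_comp (f := fun x => (x, t)) _ (bm_hit r)); exact: pair2_measurable.
Qed.

Lemma nu_ge0 n (t : n.-tuple T) r : 0 <= nu t r.
Proof. exact: Ex_ge0. Qed.

Lemma sum_nu n (t : n.-tuple T) : \sum_r nu t r = 1.
Proof. by rewrite -Ex_sum//; under eq_fun do rewrite sum_hit; rewrite Ex_cst. Qed.

Lemma q_marg n (g : tri n) : \sum_r q ((r, g) : tri n.+1) = q g.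
Proof.
under eq_bigr do rewrite qS.
rewrite -Ex_sum; last by move=> r; apply: bmM; [exact: bm_graph|exact: bm_nu].
by congr Ex; apply/funext => t; rewrite -mulr_sumr sum_nu mulr1.
Qed.

(** Cauchy-Schwarz for the conditional law given the graph g. It is what allows the
hidden positions, which are not determined by the graph, to be treated as known. *)
Lemma q_cauchy n (r : {ffun 'I_n -> bool}) (g : tri n) :
  q ((r, g) : tri n.+1) ^+ 2 <=
  q g * Ex (iid P n) (fun t => (graph t == g)%:R * nu t r ^+ 2).
Proof.
rewrite qS; set b := Ex _ _; set a := q g.
have bm1 : bm (fun t : n.-tuple T => (graph t == g)%:R * nu t r).
  by apply: bmM; [exact: bm_graph|exact: bm_nu].
have bm2 : bm (fun t : n.-tuple T => (graph t == g)%:R * nu t r ^+ 2).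
  by apply: bmM; [exact: bm_graph|apply: bmX; exact: bm_nu].
have h c : 0 <= Ex (iid P n) (fun t => (graph t == g)%:R * nu t r ^+ 2)
    - 2 * c * b + c ^+ 2 * a.
  rewrite /b -ExZ// -ExB//; last exact: bmZ.
  rewrite /a /q -ExZ; last exact: bm_graph.
  rewrite -ExD; [|by apply: bmB => //; exact: bmZ|by apply: bmZ; exact: bm_graph].
  apply: Ex_ge0 => t.
  rewrite (_ : _ + _ = (graph t == g)%:R * (nu t r - c) ^+ 2); last by ring.
  by rewrite mulr_ge0// sqr_ge0.
have b0 : 0 <= b by apply: Ex_ge0 => t; rewrite mulr_ge0// nu_ge0.
have [a0|a0] := eqVneq a 0.
  have := h ((Ex (iid P n) (fun t => (graph t == g)%:R * nu t r ^+ 2) + 1) / b).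
  have [->|bn] := eqVneq b 0; first by rewrite a0 expr0n mul0r.
  rewrite a0 mulr0 addr0 -mulrA divfK//.
  have : 0 <= Ex (iid P n) (fun t => (graph t == g)%:R * nu t r ^+ 2).
    by apply: Ex_ge0 => t; rewrite mulr_ge0// sqr_ge0.
  lra.
have {}a0 : 0 < a by rewrite lt_neqAle eq_sym a0/= q_ge0.
have := h (b / a).
have -> : 2 * (b / a) * b = 2 * (b ^+ 2 / a) by ring.
have -> : (b / a) ^+ 2 * a = b ^+ 2 / a by field; rewrite gt_eqF.
move=> h'; rewrite mulrC -ler_pdivrMr//; lra.
Qed.

Let pairw (b b' : bool) : R := (b && b')%:R / p + (~~ b && ~~ b')%:R / (1 - p).

Lemma sum_hit2 n x x' (t : n.-tuple T) :
  \sum_(r : {ffun 'I_n -> bool}) hit x t r * hit x' t r / \prod_j bern p (r j) =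
  \prod_j pairw (adj x (tnth t j)) (adj x' (tnth t j)).
Proof.
have e (r : {ffun 'I_n -> bool}) :
    hit x t r * hit x' t r / \prod_j bern p (r j) =
    \prod_j ((adj x (tnth t j) == r j)%:R * (adj x' (tnth t j) == r j)%:R
      / bern p (r j)) by rewrite prodf_div big_split.
rewrite (eq_bigr _ (fun r _ => e r)).
rewrite -(bigA_distr_bigA (fun j b => (adj x (tnth t j) == b)%:R *
  (adj x' (tnth t j) == b)%:R / bern p b)).
apply: eq_bigr => j _; rewrite big_bool/= /pairw.
by case: (adj x _); case: (adj x' _); rewrite /= ?mulr1 ?mul1r ?mul0r.
Qed.

Let bm_adjx x : bm (fun t => (adj x t)%:R : R).
Proof.
by apply: bm_bool; exact: (measurableT_comp madj (pair1_measurable x)).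
Qed.

(** The average of a product of two normalised likelihoods over one old vertex
depends on the two copies of the new vertex only through their codegree. *)
Lemma Ex_pairw x x' : Ex P (fun t => pairw (adj x t) (adj x' t)) =
  1 + (codeg x x' - p ^+ 2) / (p * (1 - p)).
Proof.
have h b b' : pairw b b' = (1 - p)^-1 * (1 - b%:R - b'%:R) +
    (p^-1 + (1 - p)^-1) * (b%:R * b'%:R).
  rewrite /pairw; case: b; case: b' => /=; ring.
under eq_fun do rewrite h.
have bmA : bm (fun t => 1 - (adj x t)%:R - (adj x' t)%:R : R).
  by apply: bmB => //; apply: bmB => //; exact: bm_cst.
have bmAA : bm (fun t => (adj x t)%:R * (adj x' t)%:R : R) by exact: bmM.
rewrite ExD; [|exact: bmZ|exact: bmZ].
rewrite !ExZ// ExB//; last by apply: bmB => //; exact: bm_cst.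
rewrite ExB//; last exact: bm_cst.
rewrite Ex_cst !adjp.
have -> : Ex P (fun t => (adj x t)%:R * (adj x' t)%:R) = codeg x x'.
  by congr Ex; apply/funext => t; rewrite -natrM mulnb.
have [p0 p1] := andP p01; field; lra.
Qed.

(** Writing the square of an average as an average over two independent copies of
the new vertex decouples the old vertices, each of which then contributes the
same factor. *)
Lemma sum_nu2 n : Ex (iid P n) (fun t => \sum_r nu t r ^+ 2 / \prod_j bern p (r j)) =
  1 + chi2 n.
Proof.
have bmh (t : n.-tuple T) r : bm (fun z : T * T => hit z.1 t r * hit z.2 t r).
  apply: bmM; [apply: (bm_comp _ (bm_hitx t r)); exact: measurable_fst|].
  by apply: (bm_comp _ (bm_hitx t r)); exact: measurable_snd.
have e (t : n.-tuple T) : \sum_r nu t r ^+ 2 / \prod_j bern p (r j) =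
    Ex (P \x P)%E (fun z => \prod_j pairw (adj z.1 (tnth t j)) (adj z.2 (tnth t j))).
  rewrite (_ : (fun z => _) = (fun z : T * T => \sum_(r : {ffun 'I_n -> bool})
      hit z.1 t r * hit z.2 t r / \prod_j bern p (r j))); last first.
    by apply/funext => z; rewrite sum_hit2.
  rewrite Ex_sum; last by move=> r; apply: bmM => //; exact: bm_cst.
  apply: eq_bigr => r _; rewrite ExZr//; congr (_ * _).
  rewrite Ex_prod// expr2 /nu -ExZr//; congr Ex; apply/funext => x.
  by rewrite -ExZ.
under eq_fun do rewrite e.
have bmp2 : bm (fun z : (T * T) * T => pairw (adj z.1.1 z.2) (adj z.1.2 z.2)).
  have bmt (pr : T * T -> T) (b : bool) : measurable_fun setT pr ->
      bm (fun z : (T * T) * T => (adj (pr z.1) z.2 == b)%:R : R).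
    move=> mpr; apply: (bm_comp (f := fun z : (T * T) * T => (pr z.1, z.2)) _ (bm_eqadj b)).
    apply: measurable_fun_pair; last exact: measurable_snd.
    by apply: (measurableT_comp mpr); exact: measurable_fst.
  rewrite (_ : (fun z => _) = (fun z : (T * T) * T =>
    (adj (fst z.1) z.2 == true)%:R * (adj (snd z.1) z.2 == true)%:R / p +
    (adj (fst z.1) z.2 == false)%:R * (adj (snd z.1) z.2 == false)%:R / (1 - p) : R)).
    have f b := bmt fst b measurable_fst; have g b := bmt snd b measurable_snd.
    exact: (bmD (bmM (bmM (f true) (g true)) (bm_cst _ _))
      (bmM (bmM (f false) (g false)) (bm_cst _ _))).
  apply/funext => z; rewrite /pairw !eqb_id !eqbF_neg.
  by rewrite -!natrM !mulnb.
rewrite -(@Ex_swap _ _ _ _ _ (P \x P)%E (iid P n) (fun z t =>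
  \prod_j pairw (adj z.1 (tnth t j)) (adj z.2 (tnth t j)))); last first.
  apply: bm_prod => j.
  apply: (bm_comp (f := fun z : (T * T) * n.-tuple T => (z.1, tnth z.2 j)) _ bmp2).
  apply: measurable_fun_pair; first exact: measurable_fst.
  by apply: (measurableT_comp (measurable_tnth j)); exact: measurable_snd.
have bmp z : bm (fun t => pairw (adj z.1 t) (adj z.2 t)).
  by apply: (bm_comp (f := pair z) _ bmp2); exact: pair1_measurable.
rewrite (_ : (fun z => _) = (fun z =>
    Ex P (fun t => pairw (adj z.1 t) (adj z.2 t)) ^+ n)); last first.
  apply/funext => z; rewrite (Ex_iid_prod _ (fun _ => bmp z)).
  by rewrite prodr_const card_ord.
rewrite Ex_prod; last by apply: bmX; exact: (bm_Ex (P \x P)%E P bmp2).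
rewrite /chi2 addrC subrK; congr Ex; apply/funext => x; congr Ex; apply/funext => x'.
by rewrite Ex_pairw.
Qed.

Let D n := \sum_(g : tri n) q g * ln (q g / er_law p g).

(** The chain rule for relative entropy, with the conditional entropy of the new
neighbourhood bounded through ln y <= y - 1 by its chi-square divergence. *)
Lemma relent_step n : D n.+1 <= D n + chi2 n.
Proof.
have key (r : {ffun 'I_n -> bool}) (g : tri n) :
  q ((r, g) : tri n.+1) * ln (q ((r, g) : tri n.+1) / er_law p ((r, g) : tri n.+1)) <=
  q ((r, g) : tri n.+1) * ln (q g / er_law p g) +
  (Ex (iid P n) (fun t => (graph t == g)%:R * nu t r ^+ 2) / \prod_j bern p (r j)
   - q ((r, g) : tri n.+1)).
  set a := q _; set b := Ex _ _.
  have pi0 : 0 < \prod_j bern p (r j) by apply: prodr_gt0 => j _; exact: bern_gt0.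
  have g0 := er_law_gt0 p01 g.
  have b0 : 0 <= b by apply: Ex_ge0 => t; rewrite mulr_ge0// sqr_ge0.
  have [a0|a0] := eqVneq a 0; first by rewrite a0 !mul0r add0r subr0 divr_ge0// ltW.
  have {}a0 : 0 < a by rewrite lt_neqAle eq_sym a0 q_ge0.
  have qg0 : 0 < q g.
    rewrite lt_neqAle q_ge0 andbT; apply/eqP => q0.
    have := q_cauchy r g; rewrite -q0 mul0r; apply/negP; rewrite -ltNge.
    by rewrite exprn_gt0.
  rewrite /= -/(tri n).
  set y := a / (q g * \prod_j bern p (r j)).
  have y0 : 0 < y by rewrite divr_gt0// mulr_gt0.
  have -> : a / (\prod_j bern p (r j) * er_law p g) = (q g / er_law p g) * y.
    by rewrite /y; field; rewrite !gt_eqF.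
  rewrite lnM ?posrE// ?divr_gt0// mulrDr lerD2l.
  have : ln y <= y - 1.
    have := @le_ln1Dx _ (y - 1).
    by rewrite (_ : 1 + (y - 1) = y); [apply; lra|ring].
  move=> /(ler_wpM2l (ltW a0)) /le_trans; apply.
  rewrite mulrBr mulr1 lerD2r /y mulrA -expr2 ler_pdivrMr ?mulr_gt0//.
  have := q_cauchy r g; rewrite -/a -/b => /le_trans; apply.
  by rewrite [leRHS](_ : _ = q g * b)//; field; rewrite gt_eqF.
rewrite /D/= -(pair_bigA _ (fun (r : {ffun 'I_n -> bool}) (g : tri n) =>
  q ((r, g) : tri n.+1) * ln (q ((r, g) : tri n.+1) / er_law p ((r, g) : tri n.+1)))) /=.
apply: (@le_trans _ _ (\sum_(r : {ffun 'I_n -> bool}) \sum_(g : tri n)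
  (q ((r, g) : tri n.+1) * ln (q g / er_law p g) +
  (Ex (iid P n) (fun t => (graph t == g)%:R * nu t r ^+ 2) / \prod_j bern p (r j)
   - q ((r, g) : tri n.+1))))).
  by apply: ler_sum => r _; apply: ler_sum => g _; exact: key.
under [leLHS]eq_bigr do rewrite big_split/=.
rewrite big_split/= lerD//.
  rewrite exchange_big/=; apply: ler_sum => g _.
  by rewrite -mulr_suml q_marg.
under eq_bigr do rewrite sumrB.
rewrite sumrB [X in _ - X]exchange_big/=.
under [X in _ - X]eq_bigr do rewrite q_marg.
rewrite q_sum lerBlDl -sum_nu2.
rewrite Ex_sum; last first.
  by move=> r; apply: bmM; [apply: bmX; exact: bm_nu|exact: bm_cst].
apply: ler_sum => r _; rewrite -mulr_suml ExZr; last by apply: bmX; exact: bm_nu.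
rewrite ler_wpM2r//.
  by rewrite invr_ge0 ltW//; apply: prodr_gt0 => j _; exact: bern_gt0.
rewrite -Ex_sum; last first.
  by move=> g; apply: bmM; [exact: bm_graph|apply: bmX; exact: bm_nu].
rewrite le_eqVlt; apply/orP; left; apply/eqP; congr Ex; apply/funext => t.
rewrite -mulr_suml (bigD1 (graph t))//= eqxx big1 ?addr0 ?mul1r// => g.
by rewrite eq_sym => /negbTE ->.
Qed.

(** Induction over the vertices accumulates the chi-square divergences. *)
Lemma tv_graph_law n (c : R) : 0 < c ->
  TV (@q n) (@er_law R p n) <= c * (\sum_(k < n) chi2 k) + c^-1.
Proof.
move=> c0.
have := tv_le_relent (@q_ge0 n) (@er_law_gt0 _ _ p01 n) (q_sum n) (er_law_sum p n) c0.
move=> /le_trans; apply.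
rewrite lerD2r ler_wpM2l//; first exact: ltW.
suff : D n <= \sum_(k < n) chi2 k by [].
elim: n => [|n IH]; last first.
  by rewrite big_ord_recr; apply: le_trans (relent_step n) _; rewrite lerD2r.
rewrite big_ord0 /D big1// => -[] _ /=.
have -> : q (tt : tri 0) = 1; last by rewrite divr1 ln1 mulr0.
rewrite -[RHS](Ex_cst (iid P 0)); congr Ex; exact/funext.
Qed.

End Chain.

(** * Binomial weights on a monotone grid *)

Section Binomial.
Context (R : realType).
Local Notation bw m k := ('C(m, k)%:R : R).

Lemma sum_binom m : \sum_(k < m.+1) bw m k = 2 ^+ m.
Proof.
rewrite -[2]/(1 + 1) exprDn; apply: eq_bigr => k _.
by rewrite !expr1n mulr1.
Qed.

Lemma binom_mgf m (t : R) :
  \sum_(k < m.+1) bw m k * expR (t * (2 * k%:R - m%:R)) <=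
  2 ^+ m * expR (2 * t ^+ 2 * m%:R).
Proof.
rewrite (_ : \sum_(k < _) _ = (expR (- t) + expR t) ^+ m); last first.
  rewrite exprDn; apply: eq_bigr => k _; rewrite -[RHS]mulr_natr mulrC; congr (_ * _).
  rewrite -!expRM_natr -expRD natrB; last by rewrite -ltnS.
  by congr expR; ring.
rewrite expRM_natr -exprMn; apply: lerXn2r.
- by rewrite nnegrE addr_ge0 ?expR_ge0.
- by rewrite nnegrE mulr_ge0 ?expR_ge0.
have := expR_le_addsqr t; have := expR_le_addsqr (- t).
by rewrite sqrrN; lra.
Qed.

(** Hoeffding's bound for a sum of m fair signs. *)
Lemma binom_tail m (x : R) : (0 < m)%N -> 0 <= x ->
  \sum_(k < m.+1) bw m k * (x < `|2 * k%:R - m%:R|)%R%:R <=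
  2 ^+ m * (2 * expR (- (x ^+ 2 / (8 * m%:R)))).
Proof.
move=> m0 x0; have m1 : 0 < m%:R :> R by rewrite ltr0n.
(* the exponent of the Laplace transform that is optimal for deviation x *)
have [t tE] : exists t, t = x / (4 * m%:R) by eexists.
have t0 : 0 <= t by rewrite tE divr_ge0// mulr_ge0// ltW.
apply: (@le_trans _ _ (\sum_(k < m.+1)
   (bw m k * expR (t * (2 * k%:R - m%:R)) * expR (- (t * x)) +
    bw m k * expR (- t * (2 * k%:R - m%:R)) * expR (- (t * x))))).
  apply: ler_sum => k _; rewrite -!mulrA -mulrDr ler_wpM2l// -!expRD.
  have [h|h] := ltP; last by rewrite addr_ge0// expR_ge0.
  have [h0|h0] := leP 0 (2 * k%:R - m%:R : R).
  - apply: ler_wpDr; first exact: expR_ge0.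
    rewrite (_ : true%:R = expR 0) ?ler_expR; last by rewrite expR0.
    by move: h; rewrite ger0_norm// => h; rewrite -mulrN -mulrDr mulr_ge0//; lra.
  - apply: ler_wpDl; first exact: expR_ge0.
    rewrite (_ : true%:R = expR 0) ?ler_expR; last by rewrite expR0.
    move: h; rewrite ltr0_norm// => h.
    by rewrite mulNr -mulrN -[- (t * x)]mulrN -mulrDr mulr_ge0//; lra.
rewrite big_split/= -!mulr_suml -mulrDl.
have h1 := binom_mgf m t; have h2 := binom_mgf m (- t).
rewrite sqrrN in h2.
have e : expR (2 * t ^+ 2 * m%:R) * expR (- (t * x)) = expR (- (x ^+ 2 / (8 * m%:R))).
  by rewrite -expRD; congr expR; rewrite tE; field; rewrite gt_eqF.
apply: (@le_trans _ _ ((2 ^+ m * expR (2 * t ^+ 2 * m%:R) +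
  2 ^+ m * expR (2 * t ^+ 2 * m%:R)) * expR (- (t * x)))).
  by rewrite ler_wpM2r ?expR_ge0// lerD.
by rewrite -mulrDr -[leLHS]mulrA mulrDl e; lra.
Qed.

(** Near the centre the ratio of consecutive binomial coefficients is
1 + O(x / m), so j steps change the weight by a bounded factor when x j is of
order m. *)
Lemma binom_down m k j (x c : R) :
  m%:R - x <= 2 * k%:R -> x + 2 * j%:R <= m%:R / 2 -> (0 < m)%N -> 0 <= c ->
  4 * (x + 2 * j%:R + 1) <= c * m%:R ->
  (j <= k)%N -> (k <= m)%N -> 
  bw m k <= bw m (k - j)%N * expR (c * j%:R).
Proof.
move=> hk hx m0 c0 hc.
have {}m0 : 0 < m%:R :> R by rewrite ltr0n.
have step i : (i <= j)%N -> (i <= k)%N -> (k <= m)%N ->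
    bw m k <= bw m (k - i)%N * expR (c * i%:R).
  elim: i => [|i IH] ij ik km; first by rewrite subn0 mulr0 expR0 mulr1.
  have ij1 : i.+1%:R <= j%:R :> R by rewrite ler_nat.
  apply: le_trans (IH (ltnW ij) (ltnW ik) km) _.
  rewrite -[i.+1%:R]natr1 mulrDr mulr1 expRD mulrA [leRHS]mulrAC.
  rewrite ler_wpM2r ?expR_ge0//.
  set k' := (k - i)%N; have k'E : (k - i.+1)%N = k'.-1 by rewrite /k'; lia.
  have k'0 : (0 < k')%N by rewrite /k'; lia.
  have k'm : (k' <= m)%N by rewrite /k'; lia.
  rewrite k'E.
  have kr : k'%:R = k%:R - i%:R :> R by rewrite natrB// ltnW.
  have hb : k'%:R * bw m k' = (m%:R - k'%:R + 1) * bw m k'.-1.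
    have := mul_bin_left m k'.-1; rewrite prednK// => /(congr1 (fun n => n%:R : R)).
    rewrite !natrM => ->; congr (_ * _).
    by rewrite -natrB// natr1; congr (_%:R); lia.
  have k'4 : m%:R / 4 <= k'%:R :> R.
    rewrite kr; rewrite -natr1 in ij1; lra.
  have k'p : 0 < k'%:R :> R by lra.
  have hexp : m%:R - k'%:R + 1 <= k'%:R * expR c.
    apply: (@le_trans _ _ (k'%:R * (1 + c))); last by rewrite ler_wpM2l ?expR_ge1Dx// ltW.
    have : c * (m%:R / 4) <= c * k'%:R by rewrite ler_wpM2l.
    rewrite kr; rewrite -natr1 in ij1; lra.
  rewrite -(ler_pM2l k'p) hb mulrCA mulrC; apply: ler_wpM2l => //.
by move=> jk km; exact: step.
Qed.

Lemma sum_window n lo w : (\sum_(i < n) (lo <= i < lo + w)%N <= w)%N.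
Proof.
have -> : (\sum_(i < n) (lo <= i < lo + w)%N = minn n (lo + w) - lo)%N.
  elim: n => [|n IH]; first by rewrite big_ord0; lia.
  by rewrite big_ord_recr IH/=; case: leqP; case: leqP => /=; lia.
lia.
Qed.

Lemma sum_shift_le (G : nat -> R) n c M : (forall i, 0 <= G i) -> (c + M <= n)%N ->
  \sum_(a < M) G (c + a)%N <= \sum_(i < n) G i.
Proof.
move=> G0 h.
rewrite -(subnKC h) !big_split_ord/= -addrA ler_wpDl//.
  by apply: sumr_ge0 => a _; exact: G0.
by rewrite ler_wpDr//; apply: sumr_ge0 => a _; exact: G0.
Qed.

(** With x = l sqrt m, shifts up to sqrt m / l keep the product x j of order m. *)
Lemma shift_range m j (l : R) : 1 <= l -> 6 * l <= Num.sqrt m%:R ->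
  j%:R * l <= Num.sqrt m%:R ->
  let x := l * Num.sqrt m%:R in
  [/\ (0 < m)%N, x + 2 * j%:R <= m%:R / 2 &
      4 * (x + 2 * j%:R + 1) * j%:R <= 16 * m%:R].
Proof.
move=> l1 h6 hj; set r := Num.sqrt _ in h6 hj *; move=> x.
have mr : m%:R = r * r by rewrite -expr2 sqr_sqrtr.
have jr : j%:R <= r.
  by apply: le_trans hj; rewrite ler_peMr.
have j0 : 0 <= j%:R :> R by [].
have jj : j%:R * j%:R <= r * r by apply: ler_pM.
have jjj : j%:R <= j%:R * j%:R :> R by rewrite -natrM ler_nat; case: j {hj jr j0 jj} => // j; rewrite leq_pmulr.
split.
- by rewrite lt0n; apply/eqP => m0; move: mr; rewrite m0 => mr; nra.
- have : 6 * l * r <= r * r by rewrite ler_wpM2r//; lra.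
  have : r <= l * r by rewrite ler_peMl//; lra.
  by rewrite mr /x; nra.
- have : l * r * j%:R <= r * r.
    by rewrite mulrAC [l * _]mulrC ler_wpM2r//; lra.
  by rewrite mr /x; nra.
Qed.

Lemma binom_down16 m k j (l : R) : 1 <= l -> 6 * l <= Num.sqrt m%:R ->
  j%:R * l <= Num.sqrt m%:R -> m%:R - l * Num.sqrt m%:R <= 2 * k%:R ->
  (k <= m)%N -> (j <= k)%N /\ bw m k <= bw m (k - j)%N * expR 16.
Proof.
move=> l1 h6 hj hk km; have [m0 h1 h2] := shift_range l1 h6 hj.
have m0' : 0 < m%:R :> R by rewrite ltr0n.
set x := l * Num.sqrt _ in hk h1 h2.
have x0 : 0 <= x by rewrite mulr_ge0//; lra.
have jk : (j <= k)%N by rewrite -(ler_nat R); lra.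
split=> //.
pose c := 4 * (x + 2 * j%:R + 1) / m%:R.
have j0 : 0 <= j%:R :> R by [].
have c0 : 0 <= c by rewrite divr_ge0//; lra.
apply: le_trans (binom_down hk h1 m0 c0 _ jk km) _.
  by rewrite /c divfK// gt_eqF.
by rewrite ler_wpM2l// ler_expR /c mulrAC ler_pdivrMr.
Qed.

Lemma binom_up16 m k j (l : R) : 1 <= l -> 6 * l <= Num.sqrt m%:R ->
  j%:R * l <= Num.sqrt m%:R -> 2 * k%:R <= m%:R + l * Num.sqrt m%:R ->
  (k <= m)%N -> (k + j <= m)%N /\ bw m k <= bw m (k + j)%N * expR 16.
Proof.
move=> l1 h6 hj hk km.
have hk' : m%:R - l * Num.sqrt m%:R <= 2 * (m - k)%N%:R by rewrite natrB//; lra.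
have [h1 h2] := binom_down16 l1 h6 hj hk' (leq_subr k m).
have kjm : (k + j <= m)%N by lia.
split=> //; rewrite -bin_sub// -[X in _ <= X%:R * _]bin_sub//.
by rewrite (_ : (m - (k + j) = m - k - j)%N)//; lia.
Qed.

Lemma subn_shift k Q M a : (Q.+1 * M <= k)%N -> (a < M)%N ->
  (k - Q.+1 * M + a = k - (Q.+1 * M - a))%N.
Proof. by rewrite mulSn; lia. Qed.

Lemma leq_shift k Q M a : (Q.+1 * M <= k)%N -> (a < M)%N ->
  (k - Q.+1 * M + a <= k)%N /\ (Q * M <= k - (k - Q.+1 * M + a))%N.
Proof. by rewrite mulSn; lia. Qed.

Lemma leq_window k0 k A : (k0 - k <= A)%N -> (k - k0 <= A)%N ->
  (k0 - A <= k < k0 - A + (2 * A).+1)%N.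
Proof. lia. Qed.

Section Grid.
Variables (m1 m2 : nat) (u v : nat -> nat -> R) (del s l : R) (M Q : nat).
Hypothesis del0 : 0 < del.
Hypothesis hu : forall k k' j j', (k <= k' <= m1)%N -> (j <= j' <= m2)%N ->
  del * (k' - k)%N%:R + del * (j' - j)%N%:R <= u k' j' - u k j.
Hypothesis hu1 : forall k j j', (k <= m1)%N -> (j <= j' <= m2)%N ->
  u k j' - u k j <= (j' - j)%N%:R.
Hypothesis hv : forall k k' j j', (k <= k' <= m1)%N -> (j <= j' <= m2)%N ->
  del * (k' - k)%N%:R + del * (j' - j)%N%:R <= v k' j - v k j'.
Hypothesis l1 : 1 <= l.
Hypotheses (lm1 : 6 * l <= Num.sqrt m1%:R) (lm2 : 6 * l <= Num.sqrt m2%:R).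
Hypothesis M0 : (0 < M)%N.
Hypotheses (Mm1 : ((Q.+1 * M)%N%:R : R) * l <= Num.sqrt m1%:R)
  (Mm2 : ((Q.+1 * M)%N%:R : R) * l <= Num.sqrt m2%:R).
Hypothesis delQ : 1 <= del * Q%:R.

Let wedge k j : bool := (u k j <= s) && (v k j <= s).
Let corner k j : bool :=
  [&& s - 1 < u k j, u k j <= s + 1, s - 1 < v k j & v k j <= s + 1].
Let W := \sum_(k < m1.+1) \sum_(j < m2.+1) bw m1 k * bw m2 j * (wedge k j)%:R.

Let bulk m (k : nat) : bool := ~~ (l * Num.sqrt m%:R < `|2 * k%:R - m%:R| :> R).

(** From a corner (k, j), decreasing k by about (Q + 1) M lowers both u and v by
at least M, after which j can be increased by less than M while u stays below s
and v only decreases. This produces M^2 points of the wedge of comparable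
weight. *)
Lemma corner_weight k j : (k <= m1)%N -> (j <= m2)%N ->
  corner k j -> bulk m1 k -> bulk m2 j ->
  bw m1 k * bw m2 j * M%:R ^+ 2 <= expR 32 * W.
Proof.
move=> km jm /and4P[_ us _ vs].
rewrite /bulk -!leNgt !ler_norml => /andP[k1 _] /andP[_ j2].
have hk : m1%:R - l * Num.sqrt m1%:R <= 2 * k%:R by lra.
have hj : 2 * j%:R <= m2%:R + l * Num.sqrt m2%:R by lra.
have l0 : 0 <= l by exact: le_trans ler01 l1.
have [Jk _] := binom_down16 l1 lm1 Mm1 hk km.
have shj e : (e < M)%N -> (j + e <= m2)%N /\ bw m2 j <= bw m2 (j + e)%N * expR 16.
  move=> eM; apply: (binom_up16 l1 lm2 _ hj jm).
  have eQ : e%:R <= (Q.+1 * M)%N%:R :> R.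
    by rewrite ler_nat mulSn (leq_trans (ltnW eM) (leq_addr _ _)).
  exact: le_trans (ler_wpM2r l0 eQ) Mm2.
(* wedge points have first coordinate c0 + a and second coordinate j + e, with a, e < M *)
pose c0 := (k - Q.+1 * M)%N.
have shk a : (a < M)%N -> bw m1 k <= bw m1 (c0 + a)%N * expR 16.
  move=> aM; rewrite /c0 subn_shift//; apply: (binom_down16 l1 lm1 _ hk km).2.
  have aQ : (Q.+1 * M - a)%N%:R <= (Q.+1 * M)%N%:R :> R.
    by rewrite ler_nat leq_subr.
  exact: le_trans (ler_wpM2r l0 aQ) Mm1.
have wdg a e : (a < M)%N -> (e < M)%N -> wedge (c0 + a)%N (j + e)%N.
  move=> aM eM; have [je _] := shj e eM.
  have [c0k c0d] := leq_shift Jk aM; rewrite -/c0 in c0k c0d.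
  have dd : M%:R <= del * (k - (c0 + a))%N%:R.
    apply: (@le_trans _ _ (del * (Q * M)%N%:R)); last by rewrite ler_wpM2l ?ler_nat// ltW.
    by rewrite natrM mulrA ler_peMl.
  have eM1 : e%:R + 1 <= M%:R :> R by rewrite natr1 ler_nat.
  have e0 : 0 <= e%:R :> R by [].
  have hkk : (c0 + a <= k <= m1)%N by rewrite c0k km.
  have hjj : (j <= j <= m2)%N by rewrite leqnn jm.
  have hje : (j <= j + e <= m2)%N by rewrite leq_addr je.
  have g1 := hu hkk hjj; have g2 := hu1 (leq_trans c0k km) hje.
  have g3 := hv hkk hje.
  rewrite subnn mulr0 addr0 in g1; rewrite addKn in g2 g3.
  have : 0 <= del * e%:R by rewrite mulr_ge0// ltW.
  by move=> de; apply/andP; split; lra.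
have e32 : expR 32 = expR 16 * expR 16 :> R.
  by rewrite -expRD; congr expR; rewrite -natrD.
have -> : bw m1 k * bw m2 j * M%:R ^+ 2 = \sum_(a < M) \sum_(e < M) bw m1 k * bw m2 j.
  by rewrite !sumr_const !card_ord -mulr_natr -mulr_natr; ring.
apply: (@le_trans _ _ (expR 32 * \sum_(a < M) \sum_(e < M)
    bw m1 (c0 + a)%N * bw m2 (j + e)%N * (wedge (c0 + a)%N (j + e)%N)%:R)).
  rewrite mulr_sumr; apply: ler_sum => a _; rewrite mulr_sumr; apply: ler_sum => e _.
  rewrite wdg// mulr1 e32.
  have := ler_pM (ler0n _ _) (ler0n _ _) (shk a (ltn_ord a)) (shj e (ltn_ord e)).2.
  by move=> /le_trans; apply; rewrite le_eqVlt; apply/orP; left; apply/eqP; ring.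
rewrite ler_wpM2l ?expR_ge0//.
have G0 k' j' : 0 <= bw m1 k' * bw m2 j' * (wedge k' j')%:R by rewrite !mulr_ge0.
apply: (@le_trans _ _ (\sum_(a < M) \sum_(j' < m2.+1)
   bw m1 (c0 + a)%N * bw m2 j' * (wedge (c0 + a)%N j')%:R)).
  apply: ler_sum => a _.
  apply: (@sum_shift_le (fun j' => bw m1 (c0 + a)%N * bw m2 j' * (wedge (c0 + a)%N j')%:R)).
    by move=> i; exact: G0.
  have := (shj M.-1); rewrite prednK// => /(_ (leqnn _))[+ _].
  by rewrite -ltnS -addnS prednK.
apply: (@sum_shift_le (fun k' => \sum_(j' < m2.+1) bw m1 k' * bw m2 j' * (wedge k' j')%:R)).
  by move=> i; apply: sumr_ge0 => j' _; exact: G0.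
have M1 : (M.-1 < M)%N by rewrite prednK.
have [h _] := leq_shift Jk M1; rewrite -/c0 in h.
by rewrite -(prednK M0) addnS ltnS (leq_trans h).
Qed.

Variable A : nat.
Hypothesis hA : 2 <= del * A%:R.

(** Two corners have values of u and of v within 2 of each other. Along any
direction of the grid either u or v is strictly monotone with slope at least
del, so the corners lie in a window of side 2 A + 1. *)
Lemma corner_count :
  \sum_(k < m1.+1) \sum_(j < m2.+1) (corner k j)%:R <= ((2 * A).+1 ^ 2)%N%:R :> R.
Proof.
have [[k0 [j0 /and3P[k0m j0m c0]]]|nc] := pselect (exists k0 j0,
    [&& (k0 <= m1)%N, (j0 <= m2)%N & corner k0 j0]); last first.
  rewrite big1// => k _; rewrite big1// => j _.
  case: (boolP (corner k j)) => // ckj; exfalso; apply: nc; exists k, j.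
  by rewrite ckj -ltnS ltn_ord -ltnS ltn_ord.
have close k j : (k <= m1)%N -> (j <= m2)%N -> corner k j ->
    ((k0 - A <= k < k0 - A + (2 * A).+1) && (j0 - A <= j < j0 - A + (2 * A).+1))%N.
  move=> km jm ckj.
  move: c0 ckj => /and4P[a1 a2 a3 a4] /and4P[b1 b2 b3 b4].
  have bound (a b : nat) : del * a%:R + del * b%:R <= 2 -> ((a <= A) && (b <= A))%N.
    move=> hab; have a0 : 0 <= del * a%:R by rewrite mulr_ge0// ltW.
    have b0 : 0 <= del * b%:R by rewrite mulr_ge0// ltW.
    have hA2 := hA; by apply/andP; split; rewrite -(ler_nat R) -(ler_pM2l del0); lra.
  have [kk|/ltnW kk] := leqP k0 k; have [jj|/ltnW jj] := leqP j0 j.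
  - have := @hu k0 k j0 j; rewrite kk jj km jm => /(_ isT isT) h.
    have /andP[h1 h2] := bound (k - k0)%N (j - j0)%N ltac:(lra).
    by rewrite !leq_window// ?(eqP kk) ?(eqP jj).
  - have := @hv k0 k j j0; rewrite kk jj km j0m => /(_ isT isT) h.
    have /andP[h1 h2] := bound (k - k0)%N (j0 - j)%N ltac:(lra).
    by rewrite !leq_window// ?(eqP kk) ?(eqP jj).
  - have := @hv k k0 j0 j; rewrite kk jj k0m jm => /(_ isT isT) h.
    have /andP[h1 h2] := bound (k0 - k)%N (j - j0)%N ltac:(lra).
    by rewrite !leq_window// ?(eqP kk) ?(eqP jj).
  - have := @hu k k0 j j0; rewrite kk jj k0m j0m => /(_ isT isT) h.
    have /andP[h1 h2] := bound (k0 - k)%N (j0 - j)%N ltac:(lra).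
    by rewrite !leq_window// ?(eqP kk) ?(eqP jj).
set P1 := fun k : nat => (k0 - A <= k < k0 - A + (2 * A).+1)%N.
set P2 := fun j : nat => (j0 - A <= j < j0 - A + (2 * A).+1)%N.
apply: (@le_trans _ _ (\sum_(k < m1.+1) \sum_(j < m2.+1) (P1 k * P2 j)%N%:R)).
  apply: ler_sum => k _; apply: ler_sum => j _; rewrite ler_nat mulnb.
  case: (boolP (corner k j)) => // ckj; rewrite close//.
    by rewrite -ltnS.
  by rewrite -ltnS.
under eq_bigr do rewrite -natr_sum -big_distrr/=.
rewrite -natr_sum -big_distrl/= ler_nat -mulnn leq_mul//; exact: sum_window.
Qed.

(** Outside the bulk the weights are small; inside it a corner costs a fraction
1 / M^2 of the wedge, and there are boundedly many corners. *)
Lemma grid_bound :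
  \sum_(k < m1.+1) \sum_(j < m2.+1) bw m1 k * bw m2 j * (corner k j)%:R <=
  \sum_(k < m1.+1) \sum_(j < m2.+1) bw m1 k * bw m2 j *
    (((2 * A).+1 ^ 2)%N%:R * expR 32 / M%:R ^+ 2 * (wedge k j)%:R +
     4 * expR (- (l ^+ 2 / 8))).
Proof.
pose t m (k : nat) : R := (~~ bulk m k)%:R.
have l0 : 0 <= l by exact: le_trans ler01 l1.
have tailE m : 6 * l <= Num.sqrt m%:R ->
    \sum_(k < m.+1) bw m k * t m k <= 2 ^+ m * (2 * expR (- (l ^+ 2 / 8))).
  move=> lm.
  have m0 : (0 < m)%N.
    by rewrite lt0n; apply/eqP => m0; move: lm; rewrite m0 sqrtr0; have := l1; lra.
  have := @binom_tail m (l * Num.sqrt m%:R) m0; rewrite mulr_ge0// => /(_ isT).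
  rewrite exprMn sqr_sqrtr//.
  have -> : l ^+ 2 * m%:R / (8 * m%:R) = l ^+ 2 / 8.
    by field; rewrite pnatr_eq0 -lt0n.
  move=> h; apply: (le_trans _ h).
  by apply: ler_sum => k _; rewrite /t /bulk negbK.
set C := ((2 * A).+1 ^ 2)%N%:R : R.
have M0' : 0 < M%:R ^+ 2 :> R by rewrite exprn_gt0// ltr0n.
set K := expR 32 * W / M%:R ^+ 2.
have W0 : 0 <= W by apply: sumr_ge0 => k _; apply: sumr_ge0 => j _; rewrite !mulr_ge0.
have K0 : 0 <= K by rewrite divr_ge0 ?mulr_ge0 ?expR_ge0// ltW.
apply: (@le_trans _ _ (\sum_(k < m1.+1) \sum_(j < m2.+1)
   (K * (corner k j)%:R + ((bw m1 k * t m1 k) * bw m2 j + bw m1 k * (bw m2 j * t m2 j))))).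
  apply: ler_sum => k _; apply: ler_sum => j _.
  have b0 : 0 <= bw m1 k * bw m2 j by rewrite mulr_ge0.
  case: (boolP (corner k j)) => ckj; last first.
    by rewrite mulr0 mulr0 add0r addr_ge0 ?mulr_ge0.
  rewrite !mulr1 /t; case: (boolP (bulk m1 k)) => bk; last first.
    apply: ler_wpDl => //; rewrite mulr1; apply: ler_wpDr; rewrite ?mulr_ge0//.
  case: (boolP (bulk m2 j)) => bj; last first.
    by apply: ler_wpDl => //; rewrite mulr0 mul0r add0r mulr1.
  rewrite !(mulr0, mul0r) !addr0 /K ler_pdivlMr//.
  by apply: corner_weight => //; rewrite -ltnS.
under eq_bigr do rewrite big_split/= -mulr_sumr.
rewrite big_split/= -mulr_sumr.
under [X in _ <= X]eq_bigr do (under eq_bigr do rewrite mulrDr).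
under [X in _ <= X]eq_bigr do rewrite big_split/=.
rewrite big_split/=; apply: lerD.
  apply: (@le_trans _ _ (K * C)); first by rewrite ler_wpM2l// corner_count.
  rewrite le_eqVlt; apply/orP; left; apply/eqP.
  rewrite /K /W [RHS](_ : _ = C * expR 32 / M%:R ^+ 2 * W).
    by rewrite /W; ring.
  rewrite /W mulr_sumr; apply: eq_bigr => k _; rewrite mulr_sumr.
  by apply: eq_bigr => j _; ring.
under eq_bigr do rewrite big_split/= -mulr_sumr -mulr_sumr sum_binom.
rewrite big_split/= -!mulr_suml sum_binom.
under [X in _ <= X]eq_bigr do rewrite -mulr_suml -mulr_sumr sum_binom.
rewrite -!mulr_suml sum_binom.
have := ler_wpM2r (exprn_ge0 m2 (ler0n R 2)) (tailE m1 lm1).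
have := ler_wpM2l (exprn_ge0 m1 (ler0n R 2)) (tailE m2 lm2).
set e := expR _; lra.
Qed.

End Grid.
End Binomial.

(** * From the cube of flips to a grid *)

Section ChainAvg.
Context (R : realType).

Definition seg m k : {set 'I_m} := [set j : 'I_m | (j < k)%N]%SET.

Lemma card_seg m k : (k <= m)%N -> #|seg m k| = k.
Proof.
move=> km; rewrite -sum1_card.
rewrite (eq_bigl (fun j : 'I_m => (j < k)%N)); last by move=> j; rewrite inE.
by rewrite -(big_ord_widen m (fun=> 1%N) km) sum1_card card_ord.
Qed.

(** Listing A before its complement. *)
Lemma perm_of_set m (A : {set 'I_m}) :
  exists s : 'S_m, [set s j | j in seg m #|A|]%SET = A.
Proof.
case: m A => [|m] A; first by exists 1%g; apply/setP => -[].
pose e := enum A ++ enum (~: A)%SET.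
have sz : size e = m.+1 by rewrite size_cat -!cardE cardsC card_ord.
have ue : uniq e.
  rewrite cat_uniq !enum_uniq andbT/=; apply/hasPn => x.
  by rewrite !mem_enum inE.
pose f (i : 'I_m.+1) := nth ord0 e i.
have finj : injective f.
  by move=> i j /eqP; rewrite /f nth_uniq ?sz// => /eqP/val_inj.
exists (perm finj); apply/setP => x; apply/imsetP/idP.
  move=> [j]; rewrite inE permE /f => jA ->.
  by rewrite /e nth_cat -cardE jA -mem_enum mem_nth// -cardE.
move=> xA; have xi : (index x (enum A) < #|A|)%N by rewrite cardE index_mem mem_enum.
have im : (index x (enum A) < m.+1)%N.
  by apply: leq_trans xi _; rewrite -[leqRHS]card_ord max_card.
exists (Ordinal im); first by rewrite inE.
by rewrite permE /f/= /e nth_cat -cardE xi nth_index// mem_enum.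
Qed.

(** The k-th set of a uniformly random maximal chain is a uniformly random set of
size k. *)
Lemma sum_sets_chain m (F : {set 'I_m} -> R) :
  \sum_(A : {set 'I_m}) F A =
  (m`!%:R)^-1 * \sum_(s : 'S_m) \sum_(k < m.+1)
     'C(m, k)%:R * F [set s j | j in seg m k]%SET.
Proof.
have m0 : (m`!%:R : R) != 0 by rewrite pnatr_eq0 -lt0n fact_gt0.
rewrite exchange_big/= mulr_sumr.
have cm (A : {set 'I_m}) : (#|A| < m.+1)%N.
  by rewrite ltnS -[leqRHS]card_ord max_card.
rewrite (partition_big (fun A => Ordinal (cm A)) xpredT)//=.
apply: eq_bigr => k _.
have km : (k <= m)%N by rewrite -ltnS.
apply: (mulfI m0); rewrite mulVKf// -mulr_sumr.
have inv (s : 'S_m) : \sum_(A : {set 'I_m} | Ordinal (cm A) == k) F [set s j | j in A]%SET =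
    \sum_(A : {set 'I_m} | Ordinal (cm A) == k) F A.
  rewrite [RHS](reindex_inj (imset_inj (@perm_inj _ s)))/=.
  by apply: eq_bigl => A; rewrite -!val_eqE/= card_imset//; exact: perm_inj.
transitivity (\sum_(s : 'S_m) \sum_(A : {set 'I_m} | Ordinal (cm A) == k)
    F [set s j | j in A]%SET).
  rewrite (eq_bigr _ (fun s _ => inv s)).
  by rewrite sumr_const -[RHS]mulr_natl; congr (_%:R * _); rewrite -[LHS]card_Sn; apply: eq_card => s; rewrite !inE.
rewrite exchange_big/=.
transitivity (\sum_(A : {set 'I_m} | Ordinal (cm A) == k)
    \sum_(s : 'S_m) F [set s j | j in seg m k]%SET).
  apply: eq_bigr => A; rewrite -val_eqE/= => /eqP Ak.
  have [r hr] := perm_of_set A; rewrite Ak in hr.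
  rewrite [RHS](reindex_inj (mulgI r))/=; apply: eq_bigr => s _; congr F.
  rewrite -[in LHS]hr -imset_comp; apply: eq_imset => j /=.
  by rewrite permM.
rewrite sumr_const -[LHS]mulr_natl; congr (_%:R * _).
have := card_draws 'I_m k; rewrite card_ord => <-.
by apply: eq_card => A; rewrite !inE.
Qed.

Section Subset.
Variables (I : finType) (E : {set I}).

Definition chain (s : 'S_#|E|) (k : nat) : {set I} :=
  [set enum_val j | j in [set s i | i in seg #|E| k]]%SET.

Lemma sum_subsets (F : {set I} -> R) :
  \sum_(T : {set I} | T \subset E) F T =
  ((#|E|)`!%:R)^-1 * \sum_(s : 'S_#|E|) \sum_(k < #|E|.+1)
     'C(#|E|, k)%:R * F (chain s k).
Proof.
rewrite -(sum_sets_chain (fun A => F [set enum_val j | j in A]%SET)).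
rewrite (reindex_onto (fun A : {set 'I_#|E|} => [set enum_val j | j in A]%SET)
   (fun T => (@enum_val _ (mem E)) @^-1: T)%SET) /=; last first.
  move=> T TE; apply/setP => x; apply/imsetP/idP.
    by move=> [j]; rewrite inE => jT ->.
  move=> xT; have xE : x \in E by move/fintype.subsetP: TE; apply.
  by exists (enum_rank_in xE x); rewrite ?inE enum_rankK_in.
apply: eq_bigl => A; apply/andP; split.
  by apply/fintype.subsetP => x /imsetP[j _ ->]; exact: enum_valP.
apply/eqP/setP => j; rewrite inE; apply/imsetP/idP.
  by move=> [i iA /enum_val_inj ->].
by move=> jA; exists j.
Qed.

Lemma chain_sub s k : chain s k \subset E.
Proof. by apply/fintype.subsetP => x /imsetP[j _ ->]; exact: enum_valP. Qed.

Lemma card_chain s k : (k <= #|E|)%N -> #|chain s k| = k.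
Proof.
move=> kE; rewrite card_imset; last exact: enum_val_inj.
by rewrite card_imset ?card_seg//; exact: perm_inj.
Qed.

Lemma chain_mono s k k' : (k <= k')%N -> chain s k \subset chain s k'.
Proof.
move=> kk; do 2 apply: imsetS; apply/fintype.subsetP => j.
by rewrite !inE => /leq_trans; apply.
Qed.
End Subset.

Lemma sum_setU (I : finType) (E D : {set I}) (F : {set I} -> R) :
  (E :&: D)%SET = finset.set0 ->
  \sum_(T : {set I} | T \subset (E :|: D)%SET) F T =
  \sum_(A : {set I} | A \subset E) \sum_(B : {set I} | B \subset D) F (A :|: B)%SET.
Proof.
move=> ED; rewrite pair_big/=.
rewrite (reindex_onto (fun z : {set I} * {set I} => (z.1 :|: z.2)%SET)
  (fun T => ((T :&: E)%SET, (T :&: D)%SET)))/=; last first.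
  by move=> T /finset.setIidPl TE; rewrite -finset.setIUr.
apply: eq_bigl => -[A B] /=; apply/andP/andP.
  by move=> [_ /eqP[<- <-]]; rewrite !finset.subsetIr.
move=> [AE BD]; split; first exact: finset.setUSS.
have sub0 (X : {set I}) : X \subset (E :&: D)%SET -> X = finset.set0.
  by rewrite ED finset.subset0 => /eqP.
have AD : (A :&: D)%SET = finset.set0 by apply: sub0; exact: finset.setSI.
have BE : (B :&: E)%SET = finset.set0.
  by apply: sub0; rewrite finset.setIC; exact: finset.setIS.
rewrite !finset.setIUl AD BE finset.setU0 finset.set0U.
by rewrite (finset.setIidPl AE) (finset.setIidPl BD).
Qed.

End ChainAvg.

Section Flip.
Context (R : realType) (I : finType).

(** The value of a sum of coordinate contributions w, each in one of two states,
when the set of flipped coordinates is T. *)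
Definition setsum (w : I -> bool -> R) (T : {set I}) : R := \sum_i w i (i \in T).

Lemma setsum_flip (w : I -> bool -> R) (E X X' B : {set I}) (a b : R) :
  X \subset X' -> X' \subset E -> (B :&: E)%SET = finset.set0 ->
  (forall i, i \in E -> a <= w i true - w i false <= b) ->
  a * (#|X'| - #|X|)%N%:R <=
    setsum w (X' :|: B)%SET - setsum w (X :|: B)%SET <= b * (#|X'| - #|X|)%N%:R.
Proof.
move=> XX' XE BE hw.
have -> : setsum w (X' :|: B)%SET - setsum w (X :|: B)%SET =
    \sum_(i in (X' :\: X)%SET) (w i true - w i false).
  rewrite -sumrB [RHS]big_mkcond/=; apply: eq_bigr => i _; rewrite !inE.
  case: (boolP (i \in X)) => iX /=.
    by rewrite (fintype.subsetP XX' _ iX) subrr.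
  case: (boolP (i \in X')) => iX' /=; last by rewrite subrr.
  case: (boolP (i \in B)) => // iB; suff : i \in (B :&: E)%SET by rewrite BE inE.
  by rewrite inE iB (fintype.subsetP XE).
rewrite -(cardsDS XX') !mulr_natr -!sumr_const; apply/andP; split;
  apply: ler_sum => i; rewrite inE => /andP[_ iX'];
  by have /andP[] := hw i (fintype.subsetP XE _ iX').
Qed.

(** All flips outside E1 and E2 are frozen; a maximal chain through E1 and one
through E2 then span a grid to which [grid_bound] applies. *)
Lemma two_chain_bound (u v : I -> bool -> R) (E1 E2 : {set I}) (del s l : R)
    (M Q A : nat) :
  (E1 :&: E2)%SET = finset.set0 -> 0 < del ->
  (forall i, i \in E1 -> del <= u i true - u i false <= 1) ->
  (forall i, i \in E1 -> del <= v i true - v i false <= 1) ->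
  (forall i, i \in E2 -> del <= u i true - u i false <= 1) ->
  (forall i, i \in E2 -> -1 <= v i true - v i false <= - del) ->
  1 <= l -> 6 * l <= Num.sqrt #|E1|%:R -> 6 * l <= Num.sqrt #|E2|%:R ->
  (0 < M)%N ->
  (Q.+1 * M)%N%:R * l <= Num.sqrt #|E1|%:R ->
  (Q.+1 * M)%N%:R * l <= Num.sqrt #|E2|%:R ->
  1 <= del * Q%:R -> 2 <= del * A%:R ->
  \sum_(T : {set I}) [&& s - 1 < setsum u T, setsum u T <= s + 1,
      s - 1 < setsum v T & setsum v T <= s + 1]%:R <=
  \sum_(T : {set I}) (((2 * A).+1 ^ 2)%N%:R * expR 32 / M%:R ^+ 2 *
       ((setsum u T <= s) && (setsum v T <= s))%:R + 4 * expR (- (l ^+ 2 / 8))) :> R.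
Proof.
move=> E12 del0 u1 v1 u2 v2 l1 lm1 lm2 M0 Mm1 Mm2 dQ dA.
have part (F : {set I} -> R) : \sum_(T : {set I}) F T =
    \sum_(T3 : {set I} | T3 \subset (~: (E1 :|: E2))%SET)
    \sum_(T1 : {set I} | T1 \subset E1) \sum_(T2 : {set I} | T2 \subset E2)
      F (T1 :|: (T2 :|: T3))%SET.
  rewrite (eq_bigl (fun T : {set I} => T \subset (~: (E1 :|: E2) :|: (E1 :|: E2))%SET));
    last by move=> T; rewrite finset.setUC finset.setUCr finset.subsetT.
  rewrite sum_setU; last by rewrite finset.setIC finset.setICr.
  apply: eq_bigr => T3 _; rewrite sum_setU//.
  by do 2 apply: eq_bigr => ? _; congr F; rewrite finset.setUC finset.setUA.
pose F1 (T : {set I}) : R := [&& s - 1 < setsum u T, setsum u T <= s + 1,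
      s - 1 < setsum v T & setsum v T <= s + 1]%:R.
pose F2 (T : {set I}) : R := ((2 * A).+1 ^ 2)%N%:R * expR 32 / M%:R ^+ 2 *
       ((setsum u T <= s) && (setsum v T <= s))%:R + 4 * expR (- (l ^+ 2 / 8)).
suff : \sum_(T : {set I}) F1 T <= \sum_(T : {set I}) F2 T by [].
rewrite !part; apply: ler_sum => T3 hT3.
have dist (E T2 : {set I}) : T2 \subset E2 -> (E2 :&: E)%SET = finset.set0 ->
    E \subset (E1 :|: E2)%SET -> ((T2 :|: T3) :&: E)%SET = finset.set0.
  move=> T2E E2E EE; apply/eqP; rewrite -finset.subset0 finset.setIUl finset.subUset.
  rewrite -{1}E2E finset.setSI//=.
  rewrite -(finset.setICr (E1 :|: E2)%SET) finset.setIC; exact: finset.setISS.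
have dist1 (T2 : {set I}) : T2 \subset E2 -> ((T2 :|: T3) :&: E1)%SET = finset.set0.
  by move=> hT2; apply: dist => //; [rewrite finset.setIC|rewrite finset.subsetUl].
have dist2 (T1 : {set I}) : T1 \subset E1 -> ((T1 :|: T3) :&: E2)%SET = finset.set0.
  move=> hT1; apply/eqP; rewrite -finset.subset0 finset.setIUl finset.subUset.
  rewrite -{1}E12 finset.setSI//=.
  rewrite -(finset.setICr (E1 :|: E2)%SET) finset.setIC; apply: finset.setISS => //.
  by rewrite finset.subsetUr.
have avg (F : {set I} -> R) :
    \sum_(T1 : {set I} | T1 \subset E1) \sum_(T2 : {set I} | T2 \subset E2)
      F (T1 :|: (T2 :|: T3))%SET =
    (#|E1|)`!%:R^-1 * (#|E2|)`!%:R^-1 * \sum_(s1 : 'S_#|E1|) \sum_(s2 : 'S_#|E2|)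
      \sum_(k < #|E1|.+1) \sum_(j < #|E2|.+1) 'C(#|E1|, k)%:R * 'C(#|E2|, j)%:R *
        F (chain s1 k :|: (chain s2 j :|: T3))%SET.
  rewrite sum_subsets -mulrA; congr (_ * _); rewrite mulr_sumr.
  apply: eq_bigr => s1 _; rewrite exchange_big mulr_sumr; apply: eq_bigr => k _.
  rewrite sum_subsets mulrCA; congr (_ * _); rewrite mulr_sumr.
  by apply: eq_bigr => s2 _; rewrite mulr_sumr; apply: eq_bigr => j _; rewrite mulrA.
rewrite (avg F1) (avg F2); apply: ler_wpM2l; first by rewrite mulr_ge0// invr_ge0.
apply: ler_sum => s1 _; apply: ler_sum => s2 _.
pose f (w : I -> bool -> R) k j := setsum w (chain s1 k :|: (chain s2 j :|: T3))%SET.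
have step1 (w : I -> bool -> R) (a b : R) k k' j :
    (forall i, i \in E1 -> a <= w i true - w i false <= b) ->
    (k <= k' <= #|E1|)%N ->
    a * (k' - k)%N%:R <= f w k' j - f w k j <= b * (k' - k)%N%:R.
  move=> hw /andP[kk kE].
  have := setsum_flip (chain_mono s1 kk) (chain_sub s1 k') (dist1 _ (chain_sub s2 j)) hw.
  by rewrite !card_chain// (leq_trans kk).
have step2 (w : I -> bool -> R) (a b : R) k j j' :
    (forall i, i \in E2 -> a <= w i true - w i false <= b) ->
    (j <= j' <= #|E2|)%N ->
    a * (j' - j)%N%:R <= f w k j' - f w k j <= b * (j' - j)%N%:R.
  move=> hw /andP[jj jE].
  have := setsum_flip (chain_mono s2 jj) (chain_sub s2 j') (dist2 _ (chain_sub s1 k)) hw.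
  rewrite !card_chain//; last by rewrite (leq_trans jj).
  by rewrite /f ![(chain s1 k :|: (_ :|: T3))%SET]finset.setUCA.
apply: (@grid_bound R #|E1| #|E2| (f u) (f v) del s l M Q) => //.
- move=> k k' j j' hk hj.
  have /andP[h1 _] := step1 u del 1 k k' j u1 hk.
  have /andP[h2 _] := step2 u del 1 k' j j' u2 hj.
  lra.
- move=> k j j' hk hj; have /andP[_] := step2 u del 1 k j j' u2 hj.
  by rewrite mul1r.
- move=> k k' j j' hk hj.
  have /andP[h1 _] := step1 v del 1 k k' j v1 hk.
  have /andP[_ h2] := step2 v (-1) (- del) k j j' v2 hj.
  lra.
Qed.

(** The orientation o of each coordinate is absorbed by a symmetric difference,
which permutes the sets of flips. *)
Lemma flip_bound (u v : I -> bool -> R) (E1 E2 : {set I}) (o : I -> bool)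
    (del s l : R) (M Q A : nat) :
  (E1 :&: E2)%SET = finset.set0 -> 0 < del ->
  (forall i, i \in E1 -> del <= u i (~~ o i) - u i (o i) <= 1) ->
  (forall i, i \in E1 -> del <= v i (~~ o i) - v i (o i) <= 1) ->
  (forall i, i \in E2 -> del <= u i (~~ o i) - u i (o i) <= 1) ->
  (forall i, i \in E2 -> -1 <= v i (~~ o i) - v i (o i) <= - del) ->
  1 <= l -> 6 * l <= Num.sqrt #|E1|%:R -> 6 * l <= Num.sqrt #|E2|%:R ->
  (0 < M)%N ->
  (Q.+1 * M)%N%:R * l <= Num.sqrt #|E1|%:R ->
  (Q.+1 * M)%N%:R * l <= Num.sqrt #|E2|%:R ->
  1 <= del * Q%:R -> 2 <= del * A%:R ->
  \sum_(T : {set I}) [&& s - 1 < setsum u T, setsum u T <= s + 1,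
      s - 1 < setsum v T & setsum v T <= s + 1]%:R <=
  \sum_(T : {set I}) (((2 * A).+1 ^ 2)%N%:R * expR 32 / M%:R ^+ 2 *
       ((setsum u T <= s) && (setsum v T <= s))%:R + 4 * expR (- (l ^+ 2 / 8))) :> R.
Proof.
move=> E12 del0 u1 v1 u2 v2 *.
(* change of variable from sets of flipped coordinates to sets of states *)
pose h (T : {set I}) := [set i | (i \in T) (+) o i]%SET.
have hK : involutive h by move=> T; apply/setP => i; rewrite !inE addbK.
pose w' (w : I -> bool -> R) i b := w i (b (+) o i).
have hs w T : setsum w (h T) = setsum (w' w) T.
  by apply: eq_bigr => i _; rewrite inE.
rewrite (reindex_inj (inv_inj hK)) [leRHS](reindex_inj (inv_inj hK))/=.
under eq_bigr do rewrite !hs.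
under [leRHS]eq_bigr do rewrite !hs.
exact: (@two_chain_bound _ _ E1 E2 del s l M Q A).
Qed.

End Flip.

(** * The circle as the line modulo integers *)

Section Circle.
Context (R : realType).

(** The representative in [-1/2, 1/2) of a real number modulo integers. *)
Definition wrap (t : R) : R := t - (Num.floor (t + 2^-1))%:~R.
(** The distance to the nearest integer. Unlike the distance of the circle
represented by an interval, it is periodic, so translations need no case
analysis. *)
Definition cd (t : R) : R := `|wrap t|.

Lemma wrap_itv t : - 2^-1 <= wrap t < 2^-1.
Proof.
have := floor_itv (t + 2^-1); rewrite /wrap intrD => /andP[h1 h2].
apply/andP; split; lra.
Qed.

Lemma wrap_int t (z : int) : wrap (t + z%:~R) = wrap t.
Proof.
rewrite /wrap (addrAC t _ 2^-1) floorDrz//.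
by rewrite intrD intrKfloor; ring.
Qed.

Lemma wrap_id t : - 2^-1 <= t < 2^-1 -> wrap t = t.
Proof.
move=> /andP[h1 h2]; rewrite /wrap (_ : Num.floor _ = 0) ?subr0//.
by apply: floor_def; rewrite add0r /=; apply/andP; split; lra.
Qed.

Lemma wrapE t : exists z : int, wrap t = t + z%:~R.
Proof. by exists (- Num.floor (t + 2^-1)); rewrite /wrap rmorphN. Qed.

Lemma cd_ge0 t : 0 <= cd t. Proof. exact: normr_ge0. Qed.

Lemma cd_le t : cd t <= 2^-1.
Proof. by have /andP[h1 h2] := wrap_itv t; rewrite /cd ler_norml; lra. Qed.

Lemma cd_int t (z : int) : cd (t + z%:~R) = cd t.
Proof. by rewrite /cd wrap_int. Qed.

Lemma cd_wrapl a b : cd (wrap a - b) = cd (a - b).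
Proof. by have [z ->] := wrapE a; rewrite -(cd_int (a - b) z); congr cd; ring. Qed.

Lemma cd_wrapr a b : cd (a - wrap b) = cd (a - b).
Proof.
have [z ->] := wrapE b; rewrite -(cd_int (a - b) (- z)); congr cd.
by rewrite rmorphN; ring.
Qed.

Lemma cd_id t : `|t| <= 2^-1 -> cd t = `|t|.
Proof.
rewrite ler_norml => /andP[h1 h2]; have [->|h3] := eqVneq t 2^-1.
  rewrite /cd -(wrap_int _ (-1)) wrap_id; first by rewrite rmorphN/= ltr0_norm ?gtr0_norm; lra.
  by rewrite rmorphN/=; lra.
by rewrite /cd wrap_id// h1 lt_neqAle h3.
Qed.

Lemma cd_pos t : 0 <= t <= 2^-1 -> cd t = t.
Proof. by move=> /andP[h1 h2]; rewrite cd_id ger0_norm. Qed.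

Lemma cd_neg t : - 2^-1 <= t <= 0 -> cd t = - t.
Proof. by move=> /andP[h1 h2]; rewrite cd_id ler0_norm//; lra. Qed.

Lemma cd_le_dist t (z : int) : cd t <= `|t + z%:~R|.
Proof.
have [h|h] := leP `|t + z%:~R| 2^-1; last exact: le_trans (cd_le t) (ltW h).
by rewrite -(cd_id h) cd_int.
Qed.

Lemma cdN t : cd (- t) = cd t.
Proof.
have h u : cd (- u) <= cd u.
  have [z hz] := wrapE u; rewrite [leRHS]/cd hz -normrN opprD -rmorphN.
  exact: cd_le_dist.
by apply/eqP; rewrite eq_le h; have := h (- t); rewrite opprK.
Qed.

Lemma cdC a b : cd (a - b) = cd (b - a).
Proof. by rewrite -cdN opprB. Qed.

Lemma cdD a b : cd (a + b) <= cd a + cd b.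
Proof.
have [z hz] := wrapE a; have [y hy] := wrapE b.
rewrite [X in _ <= X + _]/cd [X in _ <= _ + X]/cd hz hy.
apply: le_trans (ler_normD _ _).
rewrite (_ : a + _ + _ = a + b + (z + y)%:~R); last by rewrite intrD; ring.
exact: cd_le_dist.
Qed.

(** The antipode exchanges near and far; this makes antipodal flips useful. *)
Lemma cd_half t : cd (t + 2^-1) = 2^-1 - cd t.
Proof.
have [z hz] := wrapE t.
rewrite [in RHS]/cd -(cd_int _ z) (_ : t + 2^-1 + _ = wrap t + 2^-1); last by rewrite hz; ring.
have /andP[h1 h2] := wrap_itv t; have [h0|h0] := leP 0 (wrap t).
  rewrite [`|wrap t|]ger0_norm// -(cd_int _ (-1)) rmorphN/= cd_neg; first by lra.
  by apply/andP; split; lra.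
by rewrite [`|wrap t|]ltr0_norm// cd_pos; [lra|apply/andP; split; lra].
Qed.

Lemma circ_dist_wrap x y : circ_dist (wrap x) (wrap y) = cd (x - y).
Proof.
rewrite -cd_wrapl -cd_wrapr.
have /andP[h1 h2] := wrap_itv x; have /andP[h3 h4] := wrap_itv y.
set a := wrap x in h1 h2 *; set b := wrap y in h3 h4 *.
wlog ab : a b h1 h2 h3 h4 / b <= a.
  move=> h; have [ba|/ltW ab] := leP b a; first exact: h.
  by rewrite cdC -h// /circ_dist distrC.
rewrite /circ_dist ger0_norm; last by rewrite subr_ge0.
rewrite /Num.min; case: ltP => h.
  by rewrite cd_pos//; apply/andP; split; lra.
by rewrite -(cd_int _ (-1)) rmorphN/= cd_neg; [ring|apply/andP; split; lra].
Qed.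

Lemma measurable_wrap : measurable_fun [set: measurableTypeR R] wrap.
Proof.
apply: measurable_funB; first exact: measurable_id.
apply: (@measurableT_comp _ _ _ _ _ _ (fun t : R => (Num.floor t)%:~R : R)).
  apply: nondecreasing_measurable => //.
  by move=> x y xy; rewrite ler_int; exact: le_floor.
apply: measurable_funD; [exact: measurable_id|exact: measurable_cst].
Qed.

Lemma measurable_cd : measurable_fun [set: measurableTypeR R] cd.
Proof. by apply: measurableT_comp measurable_wrap; exact: normr_measurable. Qed.

Local Notation mu := (@lebesgue_measure R).

Lemma measurable_shift (t : R) :
  measurable_fun [set: measurableTypeR R] (fun x : R => x + t).
Proof. by apply: measurable_funD; [exact: measurable_id|exact: measurable_cst]. Qed.

Lemma lebesgue_shift (t : R) (A : set (measurableTypeR R)) : measurable A ->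
  mu ((fun x : R => x + t) @^-1` A) = mu A.
Proof.
move=> mA.
pose f : measurableTypeR R -> measurableTypeR R := fun x => x + t.
pose fM := isMeasurableFun.Build _ _ _ _ f (measurable_shift t).
pose F : {mfun measurableTypeR R >-> measurableTypeR R} := HB.pack f fM.
rewrite [RHS](@lebesgue_measure_unique R (pushforward mu F))// => X [[a b] /= _ <-].
rewrite /pushforward /=.
rewrite (_ : F @^-1` _ = `]a - t, b - t]%classic); last first.
  apply/seteqP; split => x /=; rewrite !in_itv/=.
    by move=> /andP[h1 h2]; apply/andP; split; rewrite ?ltrBlDr ?lerBrDr.
  by move=> /andP[h1 h2]; apply/andP; split; rewrite -?ltrBlDr -?lerBrDr.
rewrite !lebesgue_measure_itv/= !lte_fin ltrD2r; case: ifP => // _.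
by rewrite -!EFinD; congr EFin; ring.
Qed.

Local Notation P := (uniform_prob (ltNhalf_half R)).
Local Notation I := (`[- 2^-1, 2^-1[%classic : set (measurableTypeR R)).

Lemma uniform_probE (U : set (measurableTypeR R)) : measurable U ->
  P U = mu (U `&` I).
Proof.
move=> mU; rewrite /uniform_prob integral_uniform_pdf.
pose J : set (measurableTypeR R) := U `&` `[- 2^-1, 2^-1]%classic.
rewrite (_ : (\int[_]_(x in _) _)%E = (\int[mu]_(x in J) (cst 1%E x))%E).
  rewrite integral_cst ?mul1e; last by apply: measurableI.
  apply/eqP; rewrite eq_le; apply/andP; split; last first.
    apply: le_measure; rewrite ?inE; [exact: measurableI|exact: measurableI|].
    move=> x /= [Ux]; rewrite in_itv/= => /andP[h1 h2].
    by split=> //=; rewrite in_itv/= h1 ltW.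
  apply: (@le_trans _ _ (mu ((U `&` I) `|` [set 2^-1]))).
    apply: le_measure; rewrite ?inE.
    - exact: measurableI.
    - by apply: measurableU; [exact: measurableI|exact: measurable_set1].
    move=> x [Ux] /=; rewrite in_itv/= => /andP[h1 h2].
    have [->|h3] := eqVneq x 2^-1; [by right|left; split=> //=].
    by rewrite in_itv/= h1 lt_neqAle h3.
  apply: le_trans (measureU2 _ _ _) _.
  - exact: measurableI.
  - exact: measurable_set1.
  by rewrite [X in (_ + X)%E](_ : _ = 0%E) ?adde0//; exact: lebesgue_measure_set1.
apply: eq_integral => x; rewrite inE => -[_ /=]; rewrite in_itv/= => xI.
by rewrite /uniform_pdf xI opprK (_ : 2^-1 + 2^-1 = 1) ?invr1//; lra.
Qed.

Lemma uniform_wrap_pos (t : R) (U : set (measurableTypeR R)) : 0 <= t < 1 ->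
  measurable U -> P ((fun x => wrap (x + t)) @^-1` U) = P U.
Proof.
move=> /andP[t0 t1] mU.
have mW : measurable_fun [set: measurableTypeR R] (fun x => wrap (x + t)).
  exact: (measurableT_comp measurable_wrap (measurable_shift t)).
have mWU : measurable ((fun x => wrap (x + t)) @^-1` U).
  by rewrite -[X in measurable X]setTI; exact: mW.
rewrite !uniform_probE//.
pose U1 := U `&` `[t - 2^-1, 2^-1[%classic.
pose U2 := U `&` `[- 2^-1, t - 2^-1[%classic.
have mU1 : measurable U1 by apply: measurableI => //; exact: measurable_itv.
have mU2 : measurable U2 by apply: measurableI => //; exact: measurable_itv.
have -> : U `&` I = U1 `|` U2.
  apply/seteqP; split => x /=; rewrite /U1 /U2 /= !in_itv/=.
    move=> [Ux /andP[h1 h2]]; have [h|h] := leP (t - 2^-1) x; [left|right]; split=> //; apply/andP; split; lra.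
  move=> [[Ux /andP[h1 h2]]|[Ux /andP[h1 h2]]]; split=> //; apply/andP; split=> //; lra.
rewrite measureU//; last first.
  apply/seteqP; split => x //=; rewrite /U1 /U2 /= !in_itv/=.
  by move=> [[_ /andP[h _]] [_ /andP[_]]]; rewrite ltNge h.
pose V1 := (fun x : R => x + t) @^-1` U1.
pose V2 := (fun x : R => x + (t - 1)) @^-1` U2.
have mV s (A : set (measurableTypeR R)) : measurable A -> measurable ((fun x : R => x + s) @^-1` A).
  by move=> mA; rewrite -[X in measurable X]setTI; exact: measurable_shift.
have -> : (fun x => wrap (x + t)) @^-1` U `&` I = V1 `|` V2.
  have e1 x : t - 2^-1 <= x + t < 2^-1 -> wrap (x + t) = x + t.
    by move=> /andP[h1 h2]; apply: wrap_id; apply/andP; split; lra.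
  have e2 x : - 2^-1 <= x + (t - 1) < t - 2^-1 -> wrap (x + t) = x + (t - 1).
    move=> /andP[h1 h2]; rewrite -(wrap_int _ (-1)) rmorphN/= -addrA.
    by apply: wrap_id; apply/andP; split; lra.
  apply/seteqP; split => x /=; rewrite /V1 /V2 /U1 /U2 /= !in_itv/=.
    move=> [Ux /andP[h1 h2]]; have [h|h] : x + t < 2^-1 \/ 2^-1 <= x + t.
        by case: (ltP (x + t) 2^-1); [left|right].
      have h' : t - 2^-1 <= x + t < 2^-1 by apply/andP; split; lra.
      by rewrite (e1 _ h') in Ux; left.
    have h' : - 2^-1 <= x + (t - 1) < t - 2^-1 by apply/andP; split; lra.
    by rewrite (e2 _ h') in Ux; right.
  move=> [[Ux h]|[Ux h]].
    by rewrite (e1 _ h); split=> //; move/andP: h => [h1 h2]; apply/andP; split; lra.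
  by rewrite (e2 _ h); split=> //; move/andP: h => [h1 h2]; apply/andP; split; lra.
rewrite measureU; [|exact: mV|exact: mV|]; last first.
  apply/seteqP; split => x //=; rewrite /V1 /V2 /U1 /U2 /= !in_itv/=.
  move=> [[_ /andP[h1 h2]] [_ /andP[h3 h4]]]; lra.
by congr (_ + _)%E; exact: lebesgue_shift.
Qed.

Lemma uniform_wrap (t : R) (U : set (measurableTypeR R)) :
  measurable U -> P ((fun x => wrap (x + t)) @^-1` U) = P U.
Proof.
move=> mU; pose s := t - (Num.floor t)%:~R.
rewrite -(@uniform_wrap_pos s U)//.
  congr P; apply/funext => x; rewrite /preimage/=.
  by rewrite /s -(wrap_int (x + t) (- Num.floor t)) rmorphN addrA.
have := floor_itv t; rewrite /s intrD => /andP[h1 h2]; apply/andP; split; lra.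
Qed.

(** The uniform law of the circle is invariant under rotations. *)
Lemma Ex_uniform_wrap (t : R) (G : measurableTypeR R -> R) : bm G ->
  Ex P (fun x => G (wrap (x + t))) = Ex P G.
Proof.
move=> hG.
pose f : measurableTypeR R -> measurableTypeR R := fun x => wrap (x + t).
have mf : measurable_fun setT f.
  exact: (measurableT_comp measurable_wrap (measurable_shift t)).
pose fM := isMeasurableFun.Build _ _ _ _ f mf.
pose F : {mfun measurableTypeR R >-> measurableTypeR R} := HB.pack f fM.
rewrite -(Ex_distribution P F hG) /Ex; congr fine.
apply: eq_measure_integral => A mA _; exact: uniform_wrap.
Qed.

End Circle.

(** * Balls, codegrees and corners on the torus *)

(** A pointwise inequality between indicators, where u and v are the sums over the
coordinates other than the moving one. The left side exceeds the first and the
last term on the right only if both u and v are within 1 of s. *)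
Lemma corner_indicator (R : realType) (a b c u v s : R) :
  0 <= a <= 1 -> 0 <= b <= 1 -> 0 <= c <= 1 ->
  ((a + u <= s) && (c + v <= s))%:R + ((u <= s) && (b + v <= s))%:R <=
  ((a + u <= s) && (b + v <= s))%:R +
  [&& s - 1 < a + u, a + u <= s + 1, s - 1 < b + v & b + v <= s + 1]%:R +
  ((u <= s) && (c + v <= s))%:R :> R.
Proof.
move=> /andP[a0 a1] /andP[b0 b1] /andP[c0 c1].
case: (leP (a + u) s) => h1; case: (leP (c + v) s) => h2;
case: (leP (b + v) s) => h3; case: (leP u s) => h4 /=; try by lra.
all: try by case: (_ && _) => /=; lra.
have -> : s - 1 < a + u by lra.
have -> : a + u <= s + 1 by lra.
have -> : s - 1 < b + v by lra.
have -> : b + v <= s + 1 by lra.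
by rewrite /=; lra.
Qed.

Section Torus.
Context (R : realType) (q : R).
Hypothesis q1 : 1 <= q.
Local Notation P := (uniform_prob (ltNhalf_half R)).
Local Notation pt n := (n.-tuple (measurableTypeR R)).

(** The contribution of one coordinate to the q-th power of the torus distance. *)
Definition fq (t : R) : R := cd t `^ q.

Lemma powR_le_one (x : R) : 0 <= x <= 1 -> x `^ q <= 1.
Proof.
move=> /andP[x0 x1]; apply: (@le_trans _ _ (1 `^ q)); last by rewrite powR1.
by apply: ge0_ler_powR; rewrite ?nnegrE//; exact: le_trans ler01 q1.
Qed.

Lemma fq_ge0 t : 0 <= fq t. Proof. exact: powR_ge0. Qed.

Lemma fq_le1 t : fq t <= 1.
Proof. by apply: powR_le_one; rewrite cd_ge0/=; have := cd_le t; lra. Qed.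

Lemma fq_wrapl a b : fq (wrap a - b) = fq (a - b).
Proof. by rewrite /fq cd_wrapl. Qed.

Lemma measurable_fq : measurable_fun [set: measurableTypeR R] fq.
Proof. by apply: (measurableT_comp (measurable_powR q)); exact: measurable_cd. Qed.

Definition distq n (y t : pt n) : R := \sum_i fq (tnth t i - tnth y i).

Lemma measurable_distq n : measurable_fun setT (fun z : pt n * pt n => distq z.1 z.2).
Proof.
apply: measurable_sum => i; apply: (measurableT_comp measurable_fq).
apply: measurable_funB.
  by apply: (measurableT_comp (measurable_tnth i)); exact: measurable_snd.
by apply: (measurableT_comp (measurable_tnth i)); exact: measurable_fst.
Qed.

Lemma measurable_distq_center n (y : pt n) : measurable_fun setT (distq y).
Proof. exact: (measurableT_comp (@measurable_distq n) (pair1_measurable y)). Qed.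

(** Translation of the torus by w. *)
Definition shift n (w t : pt n) : pt n :=
  coordmap (fun i (x : measurableTypeR R) => wrap (x + tnth w i) : measurableTypeR R) t.

Lemma Ex_shift n (w : pt n) (F : pt n -> R) : bm F ->
  Ex (iid P n) (fun t => F (shift w t)) = Ex (iid P n) F.
Proof.
move=> hF; rewrite -(@Ex_iid_coordmap _ _ _ P n
  (fun i (x : measurableTypeR R) => wrap (x + tnth w i) : measurableTypeR R) F)//.
- move=> i; exact: (measurableT_comp (@measurable_wrap R) (measurable_shift _)).
- move=> i G hG; exact: Ex_uniform_wrap.
Qed.

Lemma measurable_shiftt n (w : pt n) : measurable_fun setT (shift w).
Proof.
apply: measurable_coordmap => i.
exact: (measurableT_comp (@measurable_wrap R) (measurable_shift _)).
Qed.

Lemma distq_shift n (w y t : pt n) :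
  distq y (shift w t) = \sum_i fq (tnth t i + tnth w i - tnth y i).
Proof. by apply: eq_bigr => i _; rewrite tnth_mktuple fq_wrapl. Qed.

Section Threshold.
Variable s : R.

(** Membership of t in the ball around y; s is the q-th power of the radius. *)
Definition near n (y t : pt n) : bool := distq y t <= s.
(** Both boundaries are so close to t that a change of one coordinate could make
it cross either of them. *)
Definition corner n (y z t : pt n) : bool :=
  [&& s - 1 < distq y t, distq y t <= s + 1, s - 1 < distq z t & distq z t <= s + 1].

Definition codeg n (y z : pt n) : R :=
  Ex (iid P n) (fun t => (near y t && near z t)%:R).
Definition cornerP n (y z : pt n) : R := Ex (iid P n) (fun t => (corner y z t)%:R).

Lemma measurable_near2 n : measurable_fun setT (fun z : pt n * pt n => near z.1 z.2).
Proof. by apply: measurable_fun_ler; [exact: measurable_distq|exact: measurable_cst]. Qed.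

Lemma measurable_near n (y : pt n) : measurable_fun setT (near y).
Proof. by apply: measurable_fun_ler; [exact: measurable_distq_center|exact: measurable_cst]. Qed.

Lemma bm_near n (y : pt n) : bm (fun t => (near y t)%:R : R).
Proof. by apply: bm_bool; exact: measurable_near. Qed.

Lemma bm_near2 n (y z : pt n) : bm (fun t => (near y t && near z t)%:R : R).
Proof. by apply: bm_bool; apply: measurable_and; exact: measurable_near. Qed.

Lemma bm_corner n (y z : pt n) : bm (fun t => (corner y z t)%:R : R).
Proof.
have mS := @measurable_distq_center n; have mc c := @measurable_cst _ _ (pt n) R setT c.
apply: bm_bool; apply: measurable_and; first exact: measurable_fun_ltr.
apply: measurable_and; first exact: measurable_fun_ler.
apply: measurable_and; first exact: measurable_fun_ltr.
exact: measurable_fun_ler.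
Qed.

(** Let g be the event that the coordinates of t other than the i-th do not exclude
t from the ball of y. A translation of the i-th coordinate of t carries z' to z
and preserves g, so g meets the balls of z and of z' with the same probability.
The difference between g and the ball of y is compared pointwise by
[corner_indicator]. *)
Lemma codeg_coord n (y z z' : pt n) i :
  (forall j, j != i -> tnth z j = tnth z' j) ->
  codeg y z' <= codeg y z + cornerP y z.
Proof.
move=> zz'.
pose Sm (y t : pt n) : R := \sum_(j | j != i) fq (tnth t j - tnth y j).
have SE (x t : pt n) : distq x t = fq (tnth t i - tnth x i) + Sm x t.
  by rewrite /distq (bigD1 i).
pose g (t : pt n) : bool := Sm y t <= s.
have mg : measurable_fun setT g.
  apply: measurable_fun_ler; last exact: measurable_cst.
  rewrite (_ : Sm y = fun t => distq y t - fq (tnth t i - tnth y i)); last first.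
    by apply/funext => t; rewrite SE addrC addKr.
  apply: measurable_funB; first exact: measurable_distq_center.
  apply: (measurableT_comp measurable_fq).
  by apply: measurable_funB; [exact: measurable_tnth|exact: measurable_cst].
have bg (x : pt n) : bm (fun t => (g t && near x t)%:R : R).
  by apply: bm_bool; apply: measurable_and => //; exact: measurable_near.
have eg : Ex (iid P n) (fun t => (g t && near z' t)%:R) =
          Ex (iid P n) (fun t => (g t && near z t)%:R).
  (* the translation that carries z to z' moves only the i-th coordinate *)
  pose w : pt n := [tuple tnth z' j - tnth z j | j < n].
  rewrite -(Ex_shift w (bg z')); congr Ex; apply/funext => t.
  congr ((_ && _)%:R).
    rewrite /g /Sm; congr (_ <= _); apply: eq_bigr => j ji.
    by rewrite !tnth_mktuple fq_wrapl zz'// subrr addr0.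
  rewrite /near distq_shift; congr (_ <= _); apply: eq_bigr => j _.
  by rewrite tnth_mktuple; congr fq; ring.
suff : codeg y z' + Ex (iid P n) (fun t => (g t && near z t)%:R) <=
       codeg y z + cornerP y z + Ex (iid P n) (fun t => (g t && near z' t)%:R).
  by rewrite eg lerD2r.
have b1 (x x' : pt n) := bm_near2 x x'; have b2 := bm_corner y z.
rewrite -[leLHS](ExD (iid P n) (b1 y z') (bg z)).
rewrite -[codeg y z + cornerP y z](ExD (iid P n) (b1 y z) b2).
rewrite -[leRHS](ExD (iid P n) (bmD (b1 y z) b2) (bg z')).
apply: (le_Ex _ (bmD (b1 y z') (bg z)) (bmD (bmD (b1 y z) b2) (bg z'))) => t.
have f0 x := fq_ge0 x; have f1 x := fq_le1 x.
have Smz : Sm z' t = Sm z t by apply: eq_bigr => j ji; rewrite zz'.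
rewrite /corner /g /near !SE Smz.
by rewrite /=; apply: corner_indicator; rewrite f0 f1.
Qed.

End Threshold.
End Torus.

(** * Coordinates where an antipodal flip is effective *)

Section Flips.
Context (R : realType) (q : R).
Hypothesis q1 : 1 <= q.
Local Notation P := (uniform_prob (ltNhalf_half R)).
Local Notation pt n := (n.-tuple (measurableTypeR R)).
Local Notation T1 := (measurableTypeR R).

Lemma measurable_cdB (w : R) : measurable_fun setT (fun x : T1 => cd (x - w)).
Proof. exact: (measurableT_comp (@measurable_cd R) (@measurable_shift R (- w))). Qed.

Lemma measurable_ball_cd (w r : R) :
  measurable_fun setT (fun x : T1 => cd (x - w) <= r).
Proof. by apply: measurable_fun_ler; [exact: measurable_cdB|exact: measurable_cst]. Qed.

Lemma ball_prob (w r : R) : 0 <= r < 2^-1 ->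
  2 * r <= Ex P (fun x => (cd (x - w) <= r)%R%:R).
Proof.
move=> /andP[r0 r1].
have m0 : measurable_fun setT (fun x : T1 => cd x <= r).
  by apply: measurable_fun_ler; [exact: measurable_cd|exact: measurable_cst].
have b0 : bm (fun x : T1 => (cd x <= r)%R%:R : R) by exact: bm_bool.
have -> : Ex P (fun x => (cd (x - w) <= r)%R%:R) = Ex P (fun x : T1 => (cd x <= r)%R%:R).
  rewrite -[RHS](Ex_uniform_wrap (- w) b0); congr Ex; apply/funext => x.
  by rewrite -[in RHS](subr0 (wrap _)) cd_wrapl subr0.
rewrite Ex_bool//.
have mA : measurable [set x : T1 | cd x <= r] by exact: measurable_bool_set.
have hA : ((2 * r)%:E <= P [set x : T1 | (cd x <= r)%R])%E.
  rewrite uniform_probE//.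
  apply: (@le_trans _ _ (lebesgue_measure (`[- r, r]%classic : set T1))).
    rewrite lebesgue_measure_itv/= lte_fin; case: ifP => h.
      by rewrite -EFinB lee_fin; lra.
    by rewrite lee_fin; move/negbT: h; rewrite -leNgt; lra.
  apply: le_measure; rewrite ?inE.
  - exact: measurable_itv.
  - by apply: measurableI => //; exact: measurable_itv.
  move=> x /=; rewrite in_itv/= => /andP[h1 h2].
  have hx : `|x| <= r by rewrite ler_norml h1.
  split; first by rewrite /= cd_id// (le_trans hx)// ltW.
  by rewrite /= in_itv/=; apply/andP; split; lra.
rewrite -lee_fin fineK//; exact: fin_num_measure.
Qed.

(** The circle points at which flipping x to the antipode moves both distances
across 1/4 by a definite amount, in the same direction (e = true) or in
opposite ones (e = false). *)
Definition active (e : bool) (y z x : R) : bool :=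
  [&& 32^-1 <= `|cd (x - y) - 4^-1|, 32^-1 <= `|cd (x - z) - 4^-1| &
      ((cd (x - y) < 4^-1) == (cd (x - z) < 4^-1)) == e].

Lemma measurable_active e y z : measurable_fun setT (active e y z : T1 -> bool).
Proof.
have m1 w : measurable_fun setT (fun x : T1 => 32^-1 <= `|cd (x - w) - 4^-1|).
  apply: measurable_fun_ler; first exact: measurable_cst.
  apply: (measurableT_comp (@normr_measurable R setT)).
  by apply: measurable_funB; [exact: measurable_cdB|exact: measurable_cst].
have m2 w : measurable_fun setT (fun x : T1 => cd (x - w) < 4^-1).
  by apply: measurable_fun_ltr; [exact: measurable_cdB|exact: measurable_cst].
have meq (f g : T1 -> bool) : measurable_fun setT f -> measurable_fun setT g ->
    measurable_fun setT (fun x => f x == g x).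
  move=> mf mg; rewrite (_ : (fun x => _) = fun x => (f x && g x) || (~~ f x && ~~ g x)).
    by apply: measurable_or; apply: measurable_and => //; exact: measurable_neg.
  by apply/funext => x; case: (f x); case: (g x).
apply: measurable_and (m1 y) _; apply: measurable_and (m1 z) _.
exact: meq (meq _ _ (m2 y) (m2 z)) (measurable_cst _).
Qed.

(** General position: z is about a quarter turn ahead of y, hence neither close to
it nor nearly antipodal. *)
Definition mid (y z : R) : bool := cd (z - y - 4^-1) <= 8^-1.

Lemma cd_quarter_near (x w : R) (r c : R) : cd w = c -> cd (x - w) <= r ->
  c - r <= cd x <= c + r.
Proof.
move=> <- h; have h1 := cdD (x - w) w; rewrite subrK in h1.
have h2 := cdD (w - x) x; rewrite subrK cdC in h2.
by apply/andP; split; lra.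
Qed.

(** Around the middle of the arc from y to z both distances are small; a quarter
turn away one is small and the other is large. *)
Lemma active_ball e (y z : R) : mid y z ->
  exists w, forall x, cd (x - w) <= 32^-1 -> active e y z x.
Proof.
rewrite /mid => hm.
have /andP[m1 m2] : 4^-1 - 8^-1 <= cd (z - y) <= 4^-1 + 8^-1.
  by apply: (cd_quarter_near _ hm); rewrite cd_pos//; lra.
have [k hk] := wrapE (z - y).
set D := wrap (z - y) in hk; have hD : `|D| = cd (z - y) by [].
have zE : z = y + D - k%:~R by rewrite hk; ring.
have D1 : 8^-1 <= `|D| by rewrite hD; lra.
have D2 : `|D| <= 3 / 8 by rewrite hD; lra.
(* the middle of the arc from y to z, or the point a quarter turn away *)
pose w := y + D / 2 - (if e then 0 else 4^-1).
exists w => x xw.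
have near c0 c : cd (w - c0) = c -> c - 32^-1 <= cd (x - c0) <= c + 32^-1.
  move=> h; apply: (cd_quarter_near h).
  by rewrite (_ : x - c0 - (w - c0) = x - w)//; ring.
have wy : w - y = D / 2 - (if e then 0 else 4^-1) by rewrite /w; ring.
have wz : cd (w - z) = cd (- (D / 2) - (if e then 0 else 4^-1)).
  by rewrite -(cd_int (- (D / 2) - _) k); congr cd; rewrite /w zE; field.
have case_le (c c' : R) : cd (w - y) = c -> cd (w - z) = c' ->
   (c <= 3 / 16 /\ c' <= 3 / 16 /\ e) \/ (c <= 3 / 16 /\ 5 / 16 <= c' /\ ~~ e) \/
   (5 / 16 <= c /\ c' <= 3 / 16 /\ ~~ e) -> active e y z x.
  move=> /near/andP[a1 a2] /near/andP[b1 b2] h.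
  have lo (v : R) : v <= 7 / 32 -> (32^-1 <= `|v - 4^-1|) /\ v < 4^-1.
    by move=> hv; rewrite ler0_norm; [split; lra|lra].
  have hi (v : R) : 9 / 32 <= v -> (32^-1 <= `|v - 4^-1|) /\ (v < 4^-1) = false.
    by move=> hv; rewrite ger0_norm; [split; [lra|apply/negbTE; rewrite -leNgt; lra]|lra].
  rewrite /active; case: h => [[h1 [h2 h3]]|[[h1 [h2 /negbTE h3]]|[h1 [h2 /negbTE h3]]]].
  - have [-> ->] := lo (cd (x - y)) ltac:(lra).
    by have [-> ->] := lo (cd (x - z)) ltac:(lra); rewrite h3.
  - have [-> ->] := lo (cd (x - y)) ltac:(lra).
    by have [-> ->] := hi (cd (x - z)) ltac:(lra); rewrite h3.
  - have [-> ->] := hi (cd (x - y)) ltac:(lra).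
    by have [-> ->] := lo (cd (x - z)) ltac:(lra); rewrite h3.
have [D0|D0] := leP 0 D.
- rewrite ger0_norm// in D1 D2.
  case: e @w xw near wy wz case_le => w xw near wy wz case_le.
  + apply: (case_le (D / 2) (D / 2)).
    * by rewrite wy subr0 cd_pos//; lra.
    * by rewrite wz subr0 cdN cd_pos//; lra.
    * by left; split; [lra|split; [lra|]].
  + apply: (case_le (4^-1 - D / 2) (D / 2 + 4^-1)).
    * by rewrite wy cd_neg; [ring|lra].
    * by rewrite wz cd_neg; [ring|lra].
    * by right; left; split; [lra|split; [lra|]].
- rewrite ltr0_norm// in D1 D2.
  case: e @w xw near wy wz case_le => w xw near wy wz case_le.
  + apply: (case_le (- (D / 2)) (- (D / 2))).
    * by rewrite wy subr0 cd_neg//; lra.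
    * by rewrite wz subr0 cd_pos//; lra.
    * by left; split; [lra|split; [lra|]].
  + apply: (case_le (4^-1 - D / 2) (D / 2 + 4^-1)).
    * by rewrite wy cd_neg; [ring|lra].
    * by rewrite wz cd_neg; [ring|lra].
    * by right; right; split; [lra|split; [lra|]].
Qed.

Lemma active_prob e (y z : R) :
  (mid y z)%:R / 16 <= Ex P (fun x => (active e y z x)%:R).
Proof.
have ba : bm (fun x : T1 => (active e y z x)%:R : R).
  by apply: bm_bool; exact: measurable_active.
case: (boolP (mid y z)) => [hm|_]; last by rewrite mul0r; exact: Ex_ge0.
have [w hw] := active_ball e hm.
apply: (@le_trans _ _ (Ex P (fun x => (cd (x - w) <= 32^-1)%R%:R))).
  apply: le_trans (ball_prob w _); first by rewrite /= mul1r; lra.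
  by apply/andP; split; lra.
apply: le_Ex => //; first by apply: bm_bool; exact: measurable_ball_cd.
move=> x; have [h|h] := boolP (cd (x - w) <= 32^-1) => //.
by rewrite (hw _ h).
Qed.

End Flips.

(** * Corners are rare compared with the codegree *)

Section Corner.
Context (R : realType) (q : R).
Hypothesis q1 : 1 <= q.
Local Notation P := (uniform_prob (ltNhalf_half R)).
Local Notation pt n := (n.-tuple (measurableTypeR R)).

(** The least change of the q-th power of a distance under an effective flip. *)
Definition gap : R := (9 / 32) `^ q - (7 / 32) `^ q.

Lemma gap_gt0 : 0 < gap.
Proof.
rewrite /gap subr_gt0; apply: gt0_ltr_powR; rewrite ?nnegrE; try lra.
by apply: lt_le_trans ltr01 q1.
Qed.

Definition halfstep (b : bool) : R := if b then 2^-1 else 0.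

Lemma le_powRq (a b : R) : 0 <= a -> a <= b -> a `^ q <= b `^ q.
Proof.
move=> a0 ab; apply: ge0_ler_powR; rewrite ?nnegrE//; last exact: le_trans ab.
exact: le_trans ler01 q1.
Qed.

Lemma powR_gap (c : R) : 0 <= c <= 7 / 32 ->
  gap <= (2^-1 - c) `^ q - c `^ q <= 1.
Proof.
move=> /andP[c0 c1]; apply/andP; split.
  have h1 : c `^ q <= (7 / 32) `^ q by exact: le_powRq.
  have h2 : (9 / 32) `^ q <= (2^-1 - c) `^ q by apply: le_powRq; lra.
  by rewrite /gap; lra.
have h1 : (2^-1 - c) `^ q <= 1 by apply: powR_le_one => //; lra.
by have := powR_ge0 c q; lra.
Qed.

Lemma fq_half (x : R) : fq q (x + 2^-1) = (2^-1 - cd x) `^ q.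
Proof. by rewrite /fq cd_half. Qed.

(** The state o in which the distance is small is the one before the flip. *)
Lemma fq_flip (x : R) (o := ~~ (cd x < 4^-1)) : 32^-1 <= `|cd x - 4^-1| ->
  gap <= fq q (x + halfstep (~~ o)) - fq q (x + halfstep o) <= 1.
Proof.
rewrite /o /halfstep => h; have c0 := cd_ge0 x; have c1 := cd_le x.
have [hx|hx] : cd x < 4^-1 \/ 4^-1 <= cd x by case: (ltP (cd x) 4^-1); [left|right].
  rewrite hx/= addr0 fq_half; apply: powR_gap; rewrite c0/=.
  by move: h; rewrite ler0_norm; lra.
rewrite ltNge hx/= addr0 fq_half.
have := @powR_gap (2^-1 - cd x); rewrite subKr; apply.
by move: h; rewrite ger0_norm; [move=> h; apply/andP; split; lra|lra].
Qed.

Section Bound.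
Variables (s L l : R) (M Q A : nat) (n : nat) (y z : pt n).
Hypotheses (dQ : 1 <= gap * Q%:R) (dA : 2 <= gap * A%:R) (l1 : 1 <= l) (M0 : (0 < M)%N).
Hypothesis hmid : 16 * L <= \sum_i (mid (tnth y i) (tnth z i))%:R.
Hypotheses (lL : 36 * l ^+ 2 <= L / 4)
  (ML : ((Q.+1 * M)%N%:R * l) ^+ 2 <= L / 4).

Let lam : R := ((2 * A).+1 ^ 2)%N%:R * expR 32 / M%:R ^+ 2.
Let tau : R := 4 * expR (- (l ^+ 2 / 8)).

Let few e (t : pt n) : bool :=
  \sum_i (active e (tnth y i) (tnth z i) (tnth t i))%:R <= L / 4 :> R.

Let flipw (T : {set 'I_n}) : pt n := [tuple halfstep (i \in T) | i < n].

Let u (w t : pt n) (i : 'I_n) (b : bool) : R := fq q (tnth t i - tnth w i + halfstep b).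

Let distq_flip w t T : distq q w (shift (flipw T) t) = setsum (u w t) T.
Proof.
rewrite distq_shift; apply: eq_bigr => i _; rewrite tnth_mktuple; congr fq.
by rewrite addrAC.
Qed.

(** For fixed t with many active coordinates of both kinds, the flips of t form
the cube of [flip_bound]. *)
Lemma corner_flip (t : pt n) : ~~ few true t -> ~~ few false t ->
  \sum_(T : {set 'I_n}) (corner q s y z (shift (flipw T) t))%:R <=
  \sum_(T : {set 'I_n}) (lam * (near q s y (shift (flipw T) t) &&
      near q s z (shift (flipw T) t))%:R + tau) :> R.
Proof.
rewrite /few -!ltNge => f1 f2.
pose E e : {set 'I_n} := [set i | active e (tnth y i) (tnth z i) (tnth t i)]%SET.
have cE e : #|E e|%:R = \sum_i (active e (tnth y i) (tnth z i) (tnth t i))%:R :> R.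
  rewrite -sum1_card natr_sum big_mkcond/=; apply: eq_bigr => i _.
  by rewrite inE; case: ifP.
rewrite -cE in f1; rewrite -cE in f2.
have l0 : 0 <= l by exact: le_trans ler01 l1.
have sq (a b : R) : 0 <= a -> a ^+ 2 <= L / 4 -> L / 4 < b -> a <= Num.sqrt b.
  move=> a0 h1 h2; rewrite -[a]ger0_norm// -sqrtr_sqr ler_wsqrtr//.
  exact: le_trans h1 (ltW h2).
have lL' : (6 * l) ^+ 2 <= L / 4 by rewrite exprMn -natrX.
have l60 : 0 <= 6 * l by rewrite mulr_ge0.
have Ml0 : 0 <= (Q.+1 * M)%N%:R * l by rewrite mulr_ge0.
have disj : (E true :&: E false)%SET = finset.set0.
  apply/setP => i; rewrite !inE; apply/negbTE/negP.
  by move=> /andP[/and3P[_ _ /eqP e1] /and3P[_ _ /eqP]]; rewrite e1.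
pose o i : bool := ~~ (cd (tnth t i - tnth y i) < 4^-1).
have hu e i : i \in E e -> gap <= u y t i (~~ o i) - u y t i (o i) <= 1.
  by rewrite inE => /and3P[h _ _]; exact: fq_flip.
have hv i : i \in E true -> gap <= u z t i (~~ o i) - u z t i (o i) <= 1.
  rewrite inE => /and3P[_ h /eqP /eqP e]; rewrite /o e; exact: fq_flip.
have hv' i : i \in E false -> -1 <= u z t i (~~ o i) - u z t i (o i) <= - gap.
  rewrite inE => /and3P[_ h e].
  have -> : o i = (cd (tnth t i - tnth z i) < 4^-1).
    by rewrite /o; move: e; do 2 case: (_ < 4^-1).
  have /andP[h1 h2] := fq_flip h; rewrite negbK in h1 h2.
  by apply/andP; split; rewrite /u; lra.
rewrite /corner /near.
under eq_bigr do rewrite !distq_flip.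
under [leRHS]eq_bigr do rewrite !distq_flip.
by apply: (@flip_bound R _ (u y t) (u z t) (E true) (E false) o gap s l M Q A
  disj gap_gt0 (hu true) hv (hu false) hv' l1 (sq _ _ l60 lL' f1) (sq _ _ l60 lL' f2)
  M0 (sq _ _ Ml0 ML f1) (sq _ _ Ml0 ML f2) dQ dA).
Qed.

(** Each coordinate in general position is active with probability at least 1/16. *)
Lemma few_prob e : Ex (iid P n) (fun t => (few e t)%:R) <= expR (- (L / 4)).
Proof.
apply: (@count_tail R _ _ P n (fun i => active e (tnth y i) (tnth z i)) L).
  by move=> i; exact: measurable_active.
have : 16 * L / 16 <= (\sum_i (mid (tnth y i) (tnth z i))%:R) / 16 :> R.
  by rewrite ler_wpM2r// invr_ge0.
rewrite mulrAC divff// mul1r => /le_trans; apply.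
by rewrite mulr_suml; apply: ler_sum => i _; exact: active_prob.
Qed.

(** Flips preserve the law of t, so the probability of a corner is an average
over the cube of flips, to which [corner_flip] applies unless t has few active
coordinates. *)
Lemma corner_le :
  cornerP q s y z <= lam * codeg q s y z + tau + 2 * expR (- (L / 4)).
Proof.
have N0 : 0 < #|{set 'I_n}|%:R :> R.
  by rewrite ltr0n; apply/card_gt0P; exists finset.set0.
set N := #|_|%:R in N0.
have bc : bm (fun t => (corner q s y z t)%:R : R) by exact: bm_corner.
have bn : bm (fun t => (near q s y t && near q s z t)%:R : R) by exact: bm_near2.
have bcs T := bm_comp (@measurable_shiftt R n (flipw T)) bc.
have bns T := bm_comp (@measurable_shiftt R n (flipw T)) bn.
have mfew e : measurable_fun setT (few e).
  apply: measurable_fun_ler; last exact: measurable_cst.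
  apply: measurable_sum => i.
  have [+ _] := bm_tnth i (bm_bool R (@measurable_active R e (tnth y i) (tnth z i))).
  exact.
have bf e : bm (fun t => (few e t)%:R : R) by exact: bm_bool.
pose F1 t : R := \sum_(T : {set 'I_n}) (corner q s y z (shift (flipw T) t))%:R.
pose F2 t : R := \sum_(T : {set 'I_n}) (lam * (near q s y (shift (flipw T) t) &&
      near q s z (shift (flipw T) t))%:R + tau).
pose F3 t : R := N * ((few true t)%:R + (few false t)%:R).
have bF1 : bm F1 by exact: (bm_sum _ bcs).
have bF2' T := bmD (bmZ lam (bns T)) (bm_cst (pt n) tau).
have bF2 : bm F2 by exact: (bm_sum _ bF2').
have bF3 : bm F3 by exact: (bmZ N (bmD (bf true) (bf false))).
have E1 : Ex (iid P n) F1 = N * cornerP q s y z.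
  rewrite (Ex_sum _ _ bcs) (eq_bigr (fun=> cornerP q s y z)); last first.
    by move=> T _; rewrite (Ex_shift _ bc).
  by rewrite sumr_const -[LHS]mulr_natl.
have E2 : Ex (iid P n) F2 = N * (lam * codeg q s y z + tau).
  rewrite (Ex_sum _ _ bF2') (eq_bigr (fun=> lam * codeg q s y z + tau)); last first.
    move=> T _; rewrite (ExD _ (bmZ lam (bns T)) (bm_cst _ tau)) Ex_cst.
    by rewrite (ExZ _ lam (bns T)) (Ex_shift _ bn).
  by rewrite sumr_const -[LHS]mulr_natl.
have E3 : Ex (iid P n) F3 <= N * (2 * expR (- (L / 4))).
  rewrite (ExZ _ N (bmD (bf true) (bf false))) (ExD _ (bf true) (bf false)).
  apply: (ler_wpM2l (ltW N0)).
  by have h1 := few_prob true; have h2 := few_prob false; lra.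
have lam0 : 0 <= lam by rewrite divr_ge0// mulr_ge0// expR_ge0.
have tau0 : 0 <= tau by rewrite mulr_ge0// expR_ge0.
have F2_ge0 t : 0 <= F2 t.
  by apply: sumr_ge0 => T _; rewrite addr_ge0// mulr_ge0.
have F1_le t : F1 t <= N.
  rewrite [N](_ : _ = \sum_(T : {set 'I_n}) 1); last by rewrite sumr_const.
  by apply: ler_sum => T _; rewrite lern1 leq_b1.
have h : Ex (iid P n) F1 <= Ex (iid P n) (fun t => F2 t + F3 t).
  apply: (le_Ex _ bF1 (bmD bF2 bF3)) => t.
  case: (boolP (few true t)) => f1.
    rewrite /F3 f1; have := F2_ge0 t; have := F1_le t.
    have : 0 <= N * (few false t)%:R by rewrite mulr_ge0// ltW.
    by rewrite mulrDr mulr1; lra.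
  case: (boolP (few false t)) => f2.
    rewrite /F3 f2 (negbTE f1); have := F2_ge0 t; have := F1_le t.
    by rewrite mulrDr mulr1 mulr0; lra.
  rewrite /F3 (negbTE f1) (negbTE f2) addr0 mulr0 addr0.
  exact: corner_flip.
rewrite -(ler_pM2l N0) -E1; apply: le_trans h _.
rewrite (ExD _ bF2 bF3) E2 [leRHS]mulrDr.
by rewrite lerD2l.
Qed.

End Bound.
End Corner.

(** * Concentration of the codegree *)

Section Arithmetic.
Variable R : realType.
Implicit Types a b c k m e lam eta p u : R.

Lemma growth_bad a b e lam : 0 <= lam -> 0 < e -> a <= 1 -> 0 <= b ->
  a <= (1 + lam) * b + e + 1.
Proof.
move=> l0 e0 a1 b0; have : 0 <= (1 + lam) * b by rewrite mulr_ge0// addr_ge0.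
lra.
Qed.

Lemma growth_good a b k e lam : a <= b + k -> k <= lam * b + e ->
  a <= (1 + lam) * b + e + 0.
Proof. by rewrite mulrDl mul1r; lra. Qed.

(** Adding eta = 2 e / lam to both sides turns an additive error into a purely
multiplicative one. *)
Lemma growth_mean a b e lam eta : a <= (1 + lam) * b + e + e ->
  lam * eta = 2 * e -> a + eta <= (1 + lam) * (b + eta).
Proof. by move=> h le; rewrite mulrDr [X in _ <= _ + X]mulrDl mul1r le; lra. Qed.

Lemma growth_step a b k e lam eta : 0 < e -> a <= b + k -> k <= lam * b + e ->
  lam * eta = 2 * e -> a + eta <= (1 + lam) * (b + eta).
Proof.
move=> e0 h1 h2 h3; apply: (growth_mean _ h3).
by apply: le_trans (growth_good h1 h2) _; rewrite lerD2l ltW.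
Qed.

(** With b the indicator of a bad event: off it this is an identity, and on it all
terms are bounded by constants. *)
Lemma sqr_center b c p eta (N := c + eta) (m := p ^+ 2 + eta) :
  0 <= c -> 0 <= eta -> N <= 2 -> (b = 0 \/ b = 1) -> m <= 2 ->
  (c - p ^+ 2) ^+ 2 <= (1 - b) * N ^+ 2 - 2 * m * N + (m ^+ 2 + 9 * b).
Proof.
move=> c0 e0 N2 b01 m2; rewrite (_ : c - p ^+ 2 = N - m); last by rewrite /N /m; ring.
have N0 : 0 <= N by rewrite addr_ge0.
have NN : N * N <= 2 * 2 by apply: ler_pM.
by case: b01 => ->; rewrite !expr2; lra.
Qed.

Lemma expR_half_le u : 0 <= u <= 1 -> expR (u / 2) <= 1 + u.
Proof.
move=> /andP[u0 u1].
have h1 : 1 - u / 2 <= expR (- (u / 2)) by exact: expR_ge1Dx.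
have h2 : 1 <= (1 + u) * (1 - u / 2).
  have : 0 <= u * (1 - u) by rewrite mulr_ge0// subr_ge0.
  lra.
rewrite -[expR (u / 2)]mul1r; apply: le_trans (ler_wpM2r (expR_ge0 _) h2) _.
rewrite -mulrA ler_piMr//; first lra.
by apply: le_trans (ler_wpM2r (expR_ge0 _) h1) _; rewrite -expRD addNr expR0.
Qed.

Lemma excess_le c p eta u (m := p ^+ 2 + eta) : u * m <= c - p ^+ 2 ->
  m * (1 + u) <= c + eta.
Proof. by rewrite /m; lra. Qed.

End Arithmetic.

Section Codegree.
Context (R : realType) (q : R).
Hypothesis q1 : 1 <= q.
Local Notation P := (uniform_prob (ltNhalf_half R)).
Local Notation pt n := (n.-tuple (measurableTypeR R)).

Lemma distq_sym n (y t : pt n) : distq q y t = distq q t y.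
Proof. by apply: eq_bigr => i _; rewrite /fq cdC. Qed.

Lemma codeg_ge0 s n (y z : pt n) : 0 <= codeg q s y z.
Proof. exact: Ex_ge0. Qed.

Lemma bm_codeg s n : bm (fun w : pt n * pt n => codeg q s w.1 w.2).
Proof.
pose F (w : (pt n * pt n) * pt n) : R := (near q s w.1.1 w.2 && near q s w.1.2 w.2)%:R.
have mn (f : pt n * pt n -> pt n) : measurable_fun setT f ->
    measurable_fun setT (fun w : (pt n * pt n) * pt n => near q s (f w.1) w.2).
  move=> mf.
  have mg : measurable_fun setT (fun w : (pt n * pt n) * pt n => (f w.1, w.2)).
    apply: measurable_fun_pair; last exact: measurable_snd.
    exact: (measurableT_comp mf measurable_fst).
  exact: (measurableT_comp (@measurable_near2 R q s n) mg).
have bF : bm F.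
  apply: bm_bool; apply: measurable_and.
    exact: (mn fst measurable_fst).
  exact: (mn snd measurable_snd).
exact: (bm_Ex (iid P n \x iid P n)%E (iid P n) bF).
Qed.

Lemma bm_codegr s n (y : pt n) : bm (codeg q s y).
Proof. exact: (bm_comp (pair1_measurable y) (bm_codeg s n)). Qed.

Section Fixed.
Variables (n1 n2 : nat) (y : pt (n1 + n2)) (s p lam eps epsb K1 K2 : R).
Local Notation n := (n1 + n2)%N.
Hypothesis nearp : forall z : pt n, Ex (iid P n) (fun t => (near q s z t)%:R) = p.
Hypotheses (lam0 : 0 < lam) (eps0 : 0 < eps).

Let mids1 (z' : pt n1) : R := \sum_i (mid (tnth y (lshift n2 i)) (tnth z' i))%:R.
Let mids2 (z'' : pt n2) : R := \sum_i (mid (tnth y (rshift n1 i)) (tnth z'' i))%:R.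
Let bad1 (z' : pt n1) : bool := mids1 z' <= K1.
Let bad2 (z'' : pt n2) : bool := mids2 z'' <= K2.

Hypothesis hcorner : forall z' z'', ~~ bad1 z' || ~~ bad2 z'' ->
  cornerP q s y (cat_tuple z' z'') <= lam * codeg q s y (cat_tuple z' z'') + eps.
Hypothesis hbad1 : Ex (iid P n1) (fun z' => (bad1 z')%:R) <= epsb.
Hypothesis hbad2 : Ex (iid P n2) (fun z'' => (bad2 z'')%:R) <= eps.
Hypothesis epsb_le : epsb <= eps.

Let cg (z' : pt n1) (z'' : pt n2) : R := codeg q s y (cat_tuple z' z'').
Let eta : R := 2 * eps / lam.
Let N z' z'' : R := cg z' z'' + eta.
Let m : R := p ^+ 2 + eta.
Let v : R := lam ^+ 2 * n%:R.

Lemma eta0 : 0 < eta. Proof. by rewrite divr_gt0// mulr_gt0. Qed.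

Lemma lam_eta : lam * eta = 2 * eps.
Proof. by rewrite /eta mulrC divfK// gt_eqF. Qed.

Lemma codeg_le (z : pt n) : codeg q s y z <= p.
Proof.
rewrite -(nearp y); apply: (le_Ex _ (bm_near2 _ _ _ _) (bm_near _ _ _)) => t.
by case: (near q s y t) => //=; rewrite lern1 leq_b1.
Qed.

Lemma p_le1 : p <= 1.
Proof.
rewrite -(nearp y); apply: (Ex_le_cst _ (bm_near _ _ _)) => t.
by rewrite lern1 leq_b1.
Qed.

Lemma cg_ge0 z' z'' : 0 <= cg z' z''. Proof. exact: codeg_ge0. Qed.

Lemma cg_le1 z' z'' : cg z' z'' <= 1. Proof. exact: le_trans (codeg_le _) p_le1. Qed.

Let bcg : bm (fun z : pt n1 * pt n2 => cg z.1 z.2).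
Proof. exact: (bm_cat (bm_codegr s y)). Qed.
Let bcgr z' : bm (cg z').
Proof. exact: (bm_catr z' (bm_codegr s y)). Qed.
Let bN : bm (fun z : pt n1 * pt n2 => N z.1 z.2).
Proof. exact: bmD bcg (bm_cst _ eta). Qed.
Let bNr z' : bm (N z').
Proof. exact: bmD (bcgr z') (bm_cst _ eta). Qed.

Lemma measurable_mids k (w : 'I_k -> R) :
  measurable_fun setT (fun z : pt k => \sum_i (mid (w i) (tnth z i))%:R : R).
Proof.
have mm (a : R) : measurable_fun setT (fun x : measurableTypeR R => mid a x).
  rewrite (_ : (fun x => _) = fun x => (cd (x - (a + 4^-1)) <= 8^-1)).
    exact: measurable_ball_cd.
  by apply/funext => x; rewrite /mid opprD addrA.
by have [] := bm_sum (index_enum 'I_k) (fun i => bm_tnth i (bm_bool R (mm (w i)))).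
Qed.

Let bbad1 : bm (fun z => (bad1 z)%:R : R).
Proof.
apply: bm_bool; apply: measurable_fun_ler; last exact: measurable_cst.
exact: measurable_mids.
Qed.
Let bbad2 : bm (fun z => (bad2 z)%:R : R).
Proof.
apply: bm_bool; apply: measurable_fun_ler; last exact: measurable_cst.
exact: measurable_mids.
Qed.

Lemma cg_coordr i z' (z1 z2 : pt n2) :
  (forall j, j != i -> tnth z1 j = tnth z2 j) ->
  cg z' z2 <= cg z' z1 + cornerP q s y (cat_tuple z' z1).
Proof.
move=> h; apply: (@codeg_coord R q q1 s n y _ _ (rshift n1 i)) => j.
case: (split_ordP j) => k -> jk; first by rewrite !tnth_lshift.
by rewrite !tnth_rshift h//; apply: contra_neq jk => ->.
Qed.

Lemma cg_coordl i (z1 z2 : pt n1) z'' :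
  (forall j, j != i -> tnth z1 j = tnth z2 j) ->
  cg z2 z'' <= cg z1 z'' + cornerP q s y (cat_tuple z1 z'').
Proof.
move=> h; apply: (@codeg_coord R q q1 s n y _ _ (lshift n2 i)) => j.
case: (split_ordP j) => k -> jk; last by rewrite !tnth_rshift.
by rewrite !tnth_lshift h//; apply: contra_neq jk => ->.
Qed.

Let Nbar z' : R := Ex (iid P n2) (N z').
Let bNbar : bm Nbar. Proof. exact: (bm_Ex (iid P n1) (iid P n2) bN). Qed.

(** After averaging over z'' the general position of z'' is available up to an
error eps, so the increments in z' are controlled without assumption on z'. *)
Lemma Nbar_coord i (z1 z2 : pt n1) :
  (forall j, j != i -> tnth z1 j = tnth z2 j) -> Nbar z2 <= (1 + lam) * Nbar z1.
Proof.
move=> h.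
have step z'' : cg z2 z'' <= (1 + lam) * cg z1 z'' + eps + (bad2 z'')%:R.
  case: (boolP (bad2 z'')) => b2.
    exact: (growth_bad (ltW lam0) eps0 (cg_le1 z2 z'') (cg_ge0 z1 z'')).
  apply: growth_good (cg_coordl z'' h) _.
  by apply: hcorner; rewrite b2 orbT.
have b := bmD (bmD (bmZ (1 + lam) (bcgr z1)) (bm_cst (pt n2) eps)) bbad2.
have e1 : Ex (iid P n2) (cg z2) <= (1 + lam) * Ex (iid P n2) (cg z1) + eps + eps.
  apply: le_trans (le_Ex _ (bcgr z2) b step) _.
  rewrite (ExD _ (bmD (bmZ (1 + lam) (bcgr z1)) (bm_cst (pt n2) eps)) bbad2).
  rewrite (ExD _ (bmZ (1 + lam) (bcgr z1)) (bm_cst (pt n2) eps)) Ex_cst.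
  by rewrite (ExZ _ _ (bcgr z1)) lerD2l.
have NE z : Nbar z = Ex (iid P n2) (cg z) + eta.
  by rewrite /Nbar (ExD _ (bcgr z) (bm_cst _ eta)) Ex_cst.
by rewrite !NE; exact: growth_mean e1 lam_eta.
Qed.

Lemma N_coord z' i (z1 z2 : pt n2) : ~~ bad1 z' ->
  (forall j, j != i -> tnth z1 j = tnth z2 j) -> N z' z2 <= (1 + lam) * N z' z1.
Proof.
move=> b1 h; apply: (growth_step eps0 (cg_coordr z' h) _ lam_eta).
by apply: hcorner; rewrite b1.
Qed.

(** Fubini: for fixed t the relation is symmetric, so the probability over z that z
is near t is p. *)
Lemma Ex_cg : Ex (iid P n1) (fun z' => Ex (iid P n2) (cg z')) = p ^+ 2.
Proof.
rewrite -(Ex_iid_cat P (bm_codegr s y)).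
have bF : bm (fun w : pt n * pt n => (near q s y w.2 && near q s w.1 w.2)%:R : R).
  apply: bm_bool; apply: measurable_and; last exact: measurable_near2.
  exact: (measurableT_comp (@measurable_near R q s n y) measurable_snd).
rewrite /codeg (Ex_swap (F := fun z t => (near q s y t && near q s z t)%:R) _ _ bF).
rewrite expr2 -[X in X * _](nearp y) -(ExZr _ _ (bm_near _ _ _)).
congr Ex; apply/funext => t; rewrite -(nearp t) -(ExZ _ _ (bm_near _ _ _)).
by congr Ex; apply/funext => z; rewrite -natrM mulnb /near (distq_sym z t).
Qed.

Lemma Ex_N : Ex (iid P n1) Nbar = m.
Proof.
rewrite /m -Ex_cg -[X in _ + X](Ex_cst (iid P n1) eta).
have bcb : bm (fun z' => Ex (iid P n2) (cg z')).
  exact: (bm_Ex (iid P n1) (iid P n2) bcg).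
rewrite -(ExD _ bcb (bm_cst _ eta)); congr Ex; apply/funext => z'.
by rewrite /Nbar (ExD _ (bcgr z') (bm_cst _ eta)) Ex_cst.
Qed.
Let E2 (F : pt n1 -> pt n2 -> R) : R :=
  Ex (iid P n1) (fun z' => Ex (iid P n2) (F z')).

(** The moment bound is applied first in z'' for fixed good z', then in z' to the
average over z''. *)
Lemma moment_good r :
  E2 (fun z' z'' => (~~ bad1 z')%:R * N z' z'' ^+ r) <=
  m ^+ r * expR (2 * r%:R ^+ 2 * v).
Proof.
have l0 := ltW lam0.
have bg : bm (fun z => (~~ bad1 z)%:R : R).
  rewrite (_ : (fun z => _) = fun z => 1 - (bad1 z)%:R); last first.
    by apply/funext => z; case: (bad1 z); rewrite ?subrr ?subr0.
  exact: (bmB (bm_cst _ 1) bbad1).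
have bNX z' := bmX r (bNr z').
pose c2 : R := expR (2 * r%:R ^+ 2 * lam ^+ 2 * n2%:R).
have etaN z' z'' : eta <= N z' z'' by rewrite lerDr cg_ge0.
have h1 z' : Ex (iid P n2) (fun z'' => (~~ bad1 z')%:R * N z' z'' ^+ r) <=
    Nbar z' ^+ r * c2.
  rewrite (ExZ _ _ (bNX z')); case: (boolP (bad1 z')) => b1 /=.
    rewrite mul0r mulr_ge0 ?expR_ge0// exprn_ge0//; apply: Ex_ge0 => z''.
    exact: le_trans (ltW eta0) (etaN _ _).
  rewrite mul1r; apply: (moment_iid _ r (bNr z') eta0 l0 (etaN z')).
  by move=> i t t'; exact: N_coord.
have bj : bm (fun z : pt n1 * pt n2 => (~~ bad1 z.1)%:R * N z.1 z.2 ^+ r).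
  exact: (bmM (bm_comp measurable_fst bg) (bmX r bN)).
have h2 := le_Ex (iid P n1) (bm_Ex (iid P n1) (iid P n2) bj)
  (bmM (bmX r bNbar) (bm_cst _ c2)) h1.
apply: le_trans h2 _; rewrite (ExZr _ _ (bmX r bNbar)).
have etab z' : eta <= Nbar z' by exact: (Ex_ge_cst _ (bNr z') (etaN z')).
have h3 := moment_iid P r bNbar eta0 l0 etab Nbar_coord.
rewrite Ex_N in h3.
apply: le_trans (ler_wpM2r (expR_ge0 _) h3) _.
rewrite /c2 -(mulrA (m ^+ r)) -expRD; apply: ler_wpM2l.
  rewrite exprn_ge0// /m; apply: addr_ge0; [exact: sqr_ge0|exact: ltW eta0].
by rewrite ler_expR /v natrD le_eqVlt; apply/orP; left; apply/eqP; ring.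
Qed.

Hypothesis m_le2 : m <= 2.
Hypothesis eta_le1 : eta <= 1.

Let bg : bm (fun z => (~~ bad1 z)%:R : R).
Proof.
rewrite (_ : (fun z => _) = fun z => 1 - (bad1 z)%:R); last first.
  by apply/funext => z; case: (bad1 z); rewrite ?subrr ?subr0.
exact: (bmB (bm_cst _ 1) bbad1).
Qed.

Let E2E (F : pt n1 -> pt n2 -> R) : bm (fun z : pt n1 * pt n2 => F z.1 z.2) ->
  E2 F = Ex (iid P n1 \x iid P n2)%E (fun z => F z.1 z.2).
Proof. by move=> bF; rewrite (Ex_prod _ _ bF). Qed.

Lemma codeg_var :
  E2 (fun z' z'' => (cg z' z'' - p ^+ 2) ^+ 2) <=
  m ^+ 2 * (expR (8 * v) - 1) + 9 * epsb.
Proof.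
have bbm := bm_comp (@measurable_fst _ _ (pt n1) (pt n2)) bbad1.
have bgm := bm_comp (@measurable_fst _ _ (pt n1) (pt n2)) bg.
set Q := (iid P n1 \x iid P n2)%E.
have bV := bmX 2 (bmB bcg (bm_cst _ (p ^+ 2))).
have bN2 := bmM bgm (bmX 2 bN).
have e2 := moment_good 2; rewrite (E2E bN2) -/Q in e2.
rewrite (E2E bV) -/Q.
have eN : Ex Q (fun z => N z.1 z.2) = m by rewrite -(E2E bN); exact: Ex_N.
have eb : Ex Q (fun z => (bad1 z.1)%:R) <= epsb.
  rewrite -(E2E (F := fun z' _ => (bad1 z')%:R) bbm) /E2.
  by under eq_fun do rewrite Ex_cst; exact: hbad1.
have m0 : 0 <= m by rewrite addr_ge0 ?sqr_ge0// ltW// eta0.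
have bR := bmD (bmB bN2 (bmZ (2 * m) bN)) (bmD (bm_cst _ (m ^+ 2)) (bmZ 9 bbm)).
have key (z : pt n1 * pt n2) : (cg z.1 z.2 - p ^+ 2) ^+ 2 <=
    (~~ bad1 z.1)%:R * N z.1 z.2 ^+ 2 - 2 * m * N z.1 z.2 +
    (m ^+ 2 + 9 * (bad1 z.1)%:R).
  have N2 : N z.1 z.2 <= 2.
    by rewrite (_ : 2 = 1 + 1)//; apply: lerD => //; exact: cg_le1.
  have b01 : (bad1 z.1)%:R = 0 :> R \/ (bad1 z.1)%:R = 1 :> R.
    by case: (bad1 z.1); [right|left].
  have := sqr_center (cg_ge0 z.1 z.2) (ltW eta0) N2 b01 m_le2.
  by case: (bad1 z.1); rewrite /= ?subrr ?subr0.
apply: le_trans (le_Ex _ bV bR key) _.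
rewrite (ExD _ (bmB bN2 (bmZ (2 * m) bN)) (bmD (bm_cst _ (m ^+ 2)) (bmZ 9 bbm))).
rewrite (ExB _ bN2 (bmZ (2 * m) bN)) (ExD _ (bm_cst _ (m ^+ 2)) (bmZ 9 bbm)).
rewrite (ExZ _ _ bN) (ExZ _ _ bbm) Ex_cst eN.
rewrite (_ : 2 * 2 ^+ 2 * v = 8 * v) in e2; last by ring.
by move: e2; lra.
Qed.

(** Markov's inequality for the r-th moment; r is free and is optimised later. *)
Lemma codeg_tail (u : R) (r : nat) : 0 <= u <= 1 ->
  E2 (fun z' z'' => (u * m <= cg z' z'' - p ^+ 2)%R%:R) <=
  epsb + expR (2 * r%:R ^+ 2 * v - r%:R * (u / 2)).
Proof.
move=> u01.
have bbm := bm_comp (@measurable_fst _ _ (pt n1) (pt n2)) bbad1.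
have bgm := bm_comp (@measurable_fst _ _ (pt n1) (pt n2)) bg.
set Q := (iid P n1 \x iid P n2)%E.
have bNr2 := bmM bgm (bmX r bN).
have er := moment_good r; rewrite (E2E bNr2) -/Q in er.
have m0 : 0 < m by rewrite ltr_wpDl ?sqr_ge0// eta0.
have bV : bm (fun z : pt n1 * pt n2 => (u * m <= cg z.1 z.2 - p ^+ 2)%R%:R : R).
  apply: bm_bool; apply: measurable_fun_ler; first exact: measurable_cst.
  by have [] := bmB bcg (bm_cst _ (p ^+ 2)).
rewrite (E2E bV) -/Q.
have eb : Ex Q (fun z => (bad1 z.1)%:R) <= epsb.
  rewrite -(E2E (F := fun z' _ => (bad1 z')%:R) bbm) /E2.
  by under eq_fun do rewrite Ex_cst; exact: hbad1.
(* a codegree above (1 + u) m makes N at least m exp (u / 2), hence c N^r at least 1 *)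
pose c := (m * expR (u / 2)) ^- r.
have c0 : 0 <= c by rewrite invr_ge0 exprn_ge0// mulr_ge0 ?expR_ge0// ltW.
have eu := expR_half_le u01.
have key (z : pt n1 * pt n2) : (u * m <= cg z.1 z.2 - p ^+ 2)%R%:R <=
    (bad1 z.1)%:R + c * ((~~ bad1 z.1)%:R * N z.1 z.2 ^+ r).
  have c1 := cg_ge0 z.1 z.2.
  have N0 : 0 <= N z.1 z.2 by rewrite addr_ge0// ltW// eta0.
  case: (bad1 z.1) => /=; first by rewrite mul0r mulr0 addr0 lern1 leq_b1.
  rewrite mul1r add0r; have [h|h] := leP (u * m) (cg z.1 z.2 - p ^+ 2); last first.
    by rewrite mulr_ge0// exprn_ge0.
  rewrite /= mulrC ler_pdivlMr ?mul1r; last by rewrite exprn_gt0// mulr_gt0// expR_gt0.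
  apply: lerXn2r; rewrite ?nnegrE//; first by rewrite mulr_ge0 ?expR_ge0// ltW.
  by apply: le_trans (ler_wpM2l (ltW m0) eu) _; exact: excess_le h.
apply: le_trans (le_Ex _ bV (bmD bbm (bmZ c bNr2)) key) _.
rewrite (ExD _ bbm (bmZ c bNr2)) (ExZ _ _ bNr2) lerD//.
apply: le_trans (ler_wpM2l c0 er) _.
rewrite /c exprMn -expRM_natr invfM -expRN mulrACA.
rewrite mulVf ?mul1r; last by rewrite expf_neq0// gt_eqF.
by rewrite -expRD ler_expR addrC [r%:R * _]mulrC.
Qed.

End Fixed.
End Codegree.

(** * Second-order expansion of a k-th moment *)

Section PowerMean.
Context (R : realType) d (T : measurableType d) (Q : probability T R).
(** Below the threshold, k t <= 1/2 and (1 + t)^k <= exp (k t) is expanded to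
second order, the first-order term having mean 0. Above it, t <= 1 bounds the
power by 2^k. *)
Lemma power_mean (g : T -> R) (p V tl : R) (k K : nat) :
  bm g -> 0 < p < 1 -> (forall x, 0 <= g x <= p) -> (forall x, 2 * p - 1 <= g x) ->
  Ex Q g = p ^+ 2 -> Ex Q (fun x => (g x - p ^+ 2) ^+ 2) <= V ->
  (k <= K)%N -> (0 < K)%N ->
  Ex Q (fun x => (p * (1 - p) / (2 * K%:R) <= g x - p ^+ 2)%R%:R) <= tl ->
  Ex Q (fun x => (1 + (g x - p ^+ 2) / (p * (1 - p))) ^+ k) <=
  1 + (2 * K%:R ^+ 2 * V / (p * (1 - p)) ^+ 2 + 2 ^+ K * tl).
Proof.
move=> bg /andP[p0 p1] g01 g2 gE gV kK K0 gt.
pose w := p * (1 - p); have w0 : 0 < w by rewrite mulr_gt0// subr_gt0.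
rewrite -/w in gt *.
have K0' : 0 < K%:R :> R by rewrite ltr0n.
pose t x := (g x - p ^+ 2) / w.
have bt := bmM (bmB bg (bm_cst _ (p ^+ 2))) (bm_cst _ w^-1).
pose b x : bool := w / (2 * K%:R) <= g x - p ^+ 2.
have bb : bm (fun x => (b x)%:R : R).
  apply: bm_bool; apply: measurable_fun_ler; first exact: measurable_cst.
  by have [] := bmB bg (bm_cst _ (p ^+ 2)).
have kK' : k%:R <= K%:R :> R by rewrite ler_nat.
have k0 : 0 <= k%:R :> R by [].
have key x : (1 + t x) ^+ k <=
    1 + (k%:R * t x + (2 * K%:R ^+ 2 * t x ^+ 2 + 2 ^+ K * (b x)%:R)).
  have /andP[gx0 gxp] := g01 x.
  have t1 : t x <= 1.
    by rewrite ler_pdivrMr// mul1r /w mulrBr mulr1 -expr2 lerD2r.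
  have t0 : 0 <= 1 + t x.
    have : -1 <= t x; last lra.
    rewrite ler_pdivlMr// /w mulN1r.
    have [h|h] := leP (2 * p - 1) 0; last by have := g2 x; nra.
    by nra.
  have tt : (k%:R * t x) ^+ 2 <= K%:R ^+ 2 * t x ^+ 2.
    by rewrite exprMn ler_wpM2r ?sqr_ge0// lerXn2r ?nnegrE.
  case: (boolP (b x)) => bx; last first.
    have kt : k%:R * t x <= 2^-1.
      have [t00|t00] := leP (t x) 0.
        by apply: (@le_trans _ _ 0); [rewrite mulr_ge0_le0|rewrite invr_ge0].
      have : K%:R * t x <= 2^-1.
        move: bx; rewrite /b -ltNge => /ltW h.
        have : t x <= (2 * K%:R)^-1.
          by rewrite /t ler_pdivrMr// mulrC.
        move=> /(ler_wpM2l (ltW K0')).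
        by rewrite (_ : K%:R * (2 * K%:R)^-1 = 2^-1)//; field; rewrite gt_eqF.
      by apply: le_trans; rewrite ler_wpM2r// ltW.
    apply: (@le_trans _ _ (expR (k%:R * t x))).
      rewrite mulrC expRM_natr; apply: lerXn2r; rewrite ?nnegrE ?expR_ge0//.
      exact: expR_ge1Dx.
    have := expR_le_quad kt; rewrite mulr0 addr0; lra.
  apply: (@le_trans _ _ (2 ^+ K)).
    apply: (@le_trans _ _ (2 ^+ k)); first by apply: lerXn2r; rewrite ?nnegrE//; lra.
    by rewrite ler_weXn2l// ler1n.
  have : 0 <= (k%:R * t x + 2^-1) ^+ 2 by exact: sqr_ge0.
  have : 0 <= K%:R ^+ 2 * t x ^+ 2 by rewrite mulr_ge0// sqr_ge0.
  rewrite mulr1 -(mulrA 2); move: tt.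
  by set a := K%:R ^+ 2 * _; set b' := k%:R * t x; rewrite expr2; lra.
have bR := bmD (bm_cst _ (1 : R)) (bmD (bmZ k%:R bt)
  (bmD (bmZ (2 * K%:R ^+ 2) (bmX 2 bt)) (bmZ (2 ^+ K) bb))).
have bL := bmX k (bmD (bm_cst _ (1 : R)) bt).
apply: le_trans (le_Ex Q bL bR key) _.
rewrite (ExD _ (bm_cst _ (1 : R)) (bmD (bmZ k%:R bt)
  (bmD (bmZ (2 * K%:R ^+ 2) (bmX 2 bt)) (bmZ (2 ^+ K) bb)))).
rewrite (ExD _ (bmZ k%:R bt) (bmD (bmZ (2 * K%:R ^+ 2) (bmX 2 bt)) (bmZ (2 ^+ K) bb))).
rewrite (ExD _ (bmZ (2 * K%:R ^+ 2) (bmX 2 bt)) (bmZ (2 ^+ K) bb)).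
rewrite (ExZ _ _ bt) (ExZ _ _ (bmX 2 bt)) (ExZ _ _ bb) Ex_cst lerD2l.
rewrite (ExZr _ _ (bmB bg (bm_cst _ (p ^+ 2)))) (ExB _ bg (bm_cst _ (p ^+ 2))) gE.
rewrite Ex_cst subrr mul0r mulr0 add0r; apply: lerD; last first.
  by rewrite ler_wpM2l// exprn_ge0.
rewrite -[leRHS]mulrA; apply: ler_wpM2l; first by rewrite mulr_ge0// sqr_ge0.
under eq_fun do rewrite expr_div_n.
rewrite (ExZr _ _ (bmX 2 (bmB bg (bm_cst _ (p ^+ 2))))).
by rewrite ler_wpM2r// invr_ge0 sqr_ge0.
Qed.

End PowerMean.

(** * The chi-square bound with explicit parameters *)

Section Chi2.
Context (R : realType) (q : R).
Hypothesis q1 : 1 <= q.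
Local Notation P := (uniform_prob (ltNhalf_half R)).
Local Notation pt n := (n.-tuple (measurableTypeR R)).

(** The relative change of the codegree when one coordinate moves. *)
Definition ratio (C : R) (d : nat) : R := C * ln d%:R ^+ 2 / d%:R.
(** The additive error in the comparison of corners with the codegree, smaller
than every power of d. *)
Definition slack (d : nat) : R :=
  4 * expR (- (ln d%:R ^+ 2 / 8)) + 2 * expR (- (d%:R / 48 / 64)).
(** A bound on the probability that too few coordinates in one half of z are in
general position. *)
Definition rare (d : nat) : R := expR (- (d%:R / 48)).

(** Each pair of coordinates is in general position with probability at least 1/4. *)
Lemma mids_rare n (w : 'I_n -> R) :
  Ex (iid P n) (fun z => (\sum_i (mid (w i) (tnth z i))%:R <= n%:R / 16 :> R)%R%:R) <=
  expR (- (n%:R / 16)).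
Proof.
have e : n%:R / 16 = (n%:R / 4) / 4 :> R by field.
rewrite e; apply: (@count_tail R _ _ P n (fun i x => mid (w i) x)).
  move=> i; rewrite (_ : mid (w i) = fun x => (cd (x - (w i + 4^-1)) <= 8^-1)).
    exact: measurable_ball_cd.
  by apply/funext => x; rewrite /mid opprD addrA.
have -> : n%:R / 4 = \sum_(i < n) 4^-1 :> R by rewrite sumr_const card_ord mulr_natl.
apply: ler_sum => i _.
have := @ball_prob R (w i + 4^-1) 8^-1; rewrite (_ : 2 * 8^-1 = 4^-1 :> R); last by field.
have -> : (fun x : R => (cd (x - (w i + 4^-1)) <= 8^-1)%R%:R : R) =
    (fun x => (mid (w i) x)%:R).
  by apply/funext => x; rewrite /mid opprD addrA.
by apply; apply/andP; split; lra.
Qed.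

(** [corner_le] with M of order sqrt d / ln d, the largest value allowed by the
range in which binomial weights are comparable, and tails cut at ln d standard
deviations. *)
Lemma corner_le_ratio : exists C c0 : R, [/\ 0 < C, 0 < c0 &
  forall (d : nat) (s : R) (y z : pt d), 1 <= ln (d%:R : R) -> c0 * ln d%:R ^+ 2 <= d%:R ->
  d%:R / 48 <= \sum_i (mid (tnth y i) (tnth z i))%:R :> R ->
  cornerP q s y z <= ratio C d * codeg q s y z + slack d].
Proof.
have g0 := gap_gt0 q1.
pose Q := (Num.truncn (gap q)^-1).+1; pose A := (2 * Q)%N.
have dQ : 1 <= gap q * Q%:R.
  rewrite mulrC -ler_pdivrMr// mul1r ltW//.
  have i0 : 0 <= (gap q)^-1 by rewrite invr_ge0 ltW.
  by have /andP[] := truncn_itv i0.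
have dA : 2 <= gap q * A%:R by rewrite natrM mulrCA; lra.
pose B : R := ((2 * A).+1 ^ 2)%N%:R * expR 32.
have B0 : 0 < B by rewrite mulr_gt0 ?expR_gt0// ltr0n expn_gt0.
exists (B * (4 * (48 * 64) * Q.+1%:R ^+ 2)), (48 * 64 * (36 + Q.+1%:R ^+ 2)); split.
- by rewrite !(mulr_gt0, exprn_gt0).
- by rewrite !(mulr_gt0, addr_gt0, exprn_gt0).
move=> d s y z l1 hd hm; set l := ln d%:R in l1 hd *.
have l0 : 0 < l by exact: lt_le_trans ltr01 l1.
have d0 : 0 < d%:R :> R.
  apply: lt_le_trans hd; apply: mulr_gt0; last exact: exprn_gt0.
  by rewrite !(mulr_gt0, addr_gt0, exprn_gt0).
pose W : R := d%:R / 48 / 64.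
have W0 : 0 < W by rewrite !divr_gt0.
have Q0 : 0 < Q.+1%:R :> R by rewrite ltr0n.
(* M is the integer part of X, the largest M with ((Q + 1) M l)^2 <= W *)
pose X : R := Num.sqrt W / (Q.+1%:R * l).
have Ql0 : 0 < Q.+1%:R * l by rewrite mulr_gt0.
have X2 : X ^+ 2 = W / (Q.+1%:R * l) ^+ 2 by rewrite expr_div_n sqr_sqrtr// ltW.
have hW : (36 + Q.+1%:R ^+ 2) * l ^+ 2 <= W.
  by rewrite /W -mulrA -invfM ler_pdivlMr ?mulr_gt0// mulrC mulrA.
have [lW QW] : 36 * l ^+ 2 <= W /\ (Q.+1%:R * l) ^+ 2 <= W.
  rewrite exprMn; have : 0 <= Q.+1%:R ^+ 2 * l ^+ 2 by rewrite mulr_ge0 ?sqr_ge0.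
  have : 0 <= 36 * l ^+ 2 by rewrite mulr_ge0 ?sqr_ge0.
  by move: hW; rewrite mulrDl => *; split; lra.
have X1 : 1 <= X.
  rewrite ler_pdivlMr// mul1r -[leLHS]ger0_norm ?(ltW Ql0)// -sqrtr_sqr.
  by rewrite ler_wsqrtr.
pose M := Num.truncn X.
have /andP[MX XM] : M%:R <= X < M.+1%:R by apply: truncn_itv; exact: le_trans X1.
have M0 : (0 < M)%N.
  by rewrite lt0n; apply/eqP => M0; move: XM; rewrite M0 ltNge X1.
have M0' : 0 < M%:R :> R by rewrite ltr0n.
have M1 : 1 <= M%:R :> R by rewrite ler1n.
have XM2 : X <= 2 * M%:R by move: XM; rewrite -natr1; lra.
have hL : 16 * (d%:R / 48 / 16) = d%:R / 48 :> R by field.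
have hL4 : d%:R / 48 / 16 / 4 = W :> R by rewrite /W; field.
have := @corner_le R q q1 s (d%:R / 48 / 16) l M Q A d y z dQ dA l1 M0.
rewrite hL hL4 => /(_ hm lW) h.
have hML : ((Q.+1 * M)%N%:R * l) ^+ 2 <= W.
  have -> : (Q.+1 * M)%N%:R * l = M%:R * (Q.+1%:R * l) by rewrite natrM; ring.
  have : M%:R ^+ 2 <= X ^+ 2 by rewrite lerXn2r ?nnegrE// (le_trans _ X1).
  rewrite X2 ler_pdivlMr ?exprn_gt0// -exprMn; exact: id.
apply: le_trans (h hML) _; rewrite -addrA /slack -/l -/W lerD2r.
rewrite ler_wpM2r ?codeg_ge0// /ratio -/l -/B -mulrA -[leRHS]mulrA.
rewrite ler_wpM2l ?(ltW B0)//.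
rewrite -[leLHS]mul1r ler_pdivrMr ?exprn_gt0//.
have hX : X ^+ 2 <= 4 * M%:R ^+ 2.
  have X0 : 0 <= X by exact: le_trans ler01 X1.
  have h2 := ler_pM X0 X0 XM2 XM2.
  by rewrite expr2; apply: le_trans h2 _; rewrite expr2; lra.
have -> : 4 * (48 * 64) * Q.+1%:R ^+ 2 * (l ^+ 2 / d%:R) * M%:R ^+ 2 =
    (4 * M%:R ^+ 2) * ((Q.+1%:R * l) ^+ 2 / W).
  by rewrite /W; field; rewrite gt_eqF.
have hW1 : 0 < (Q.+1%:R * l) ^+ 2 / W by rewrite divr_gt0// exprn_gt0.
apply: le_trans (ler_wpM2r (ltW hW1) hX); rewrite X2.
rewrite mulrA divfK ?divff// gt_eqF// exprn_gt0//.
Qed.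

Lemma half_split d : (1 < d)%N ->
  exists n1 n2, [/\ d = (n1 + n2)%N, (d <= 3 * n1)%N & (d <= 3 * n2)%N].
Proof.
move=> d1; exists d./2, (d - d./2)%N.
by have := odd_double_half d; rewrite -muln2; split; lia.
Qed.

(** Bonferroni; it keeps 1 + t nonnegative in [power_mean] when p > 1/2. *)
Lemma codeg_ge s n (y z : pt n) (p : R) :
  (forall x : pt n, Ex (iid P n) (fun t => (near q s x t)%:R) = p) ->
  2 * p - 1 <= codeg q s y z.
Proof.
move=> hp; rewrite (_ : 2 * p - 1 = Ex (iid P n) (fun t => (near q s y t)%:R) +
    Ex (iid P n) (fun t => (near q s z t)%:R) - Ex (iid P n) (fun=> 1)); last first.
  by rewrite !hp Ex_cst; ring.
have by_ := bm_near q s y; have bz := bm_near q s z.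
rewrite -(ExD _ by_ bz) -(ExB _ (bmD by_ bz) (bm_cst _ (1 : R))).
apply: (le_Ex _ (bmB (bmD by_ bz) (bm_cst _ (1 : R))) (bm_near2 q s y z)) => t.
by case: (near q s y t); case: (near q s z t) => /=; lra.
Qed.

Lemma rare_le_slack d : rare d <= slack d.
Proof.
rewrite /rare /slack; apply: ler_wpDl; first by rewrite mulr_ge0// expR_ge0.
apply: (@le_trans _ _ (expR (- (d%:R / 48 / 64)))).
  by rewrite ler_expR lerN2 ler_pdivrMr// ler_peMr ?divr_ge0// ler1n.
by rewrite ler_peMl ?expR_ge0// ler1n.
Qed.

(** The two halves of the coordinates are those of a point z; the bound is uniform
in y, so averaging over y costs nothing. *)
Lemma chi2_le : exists C c0 : R, [/\ 0 < C, 0 < c0 &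
  forall (d : nat) (s p u : R) (k K r : nat),
  let eta := 2 * slack d / ratio C d in
  let v := ratio C d ^+ 2 * d%:R in
  (1 < d)%N -> 1 <= ln (d%:R : R) -> c0 * ln d%:R ^+ 2 <= d%:R ->
  (forall x : pt d, Ex (iid P d) (fun t => (near q s x t)%:R) = p) ->
  0 < p < 1 -> eta <= 1 -> (k <= K)%N -> (0 < K)%N -> 0 <= u <= 1 ->
  u * (p ^+ 2 + eta) <= p * (1 - p) / (2 * K%:R) ->
  chi2 (iid P d) (near q s (n := d)) p k <=
  2 * K%:R ^+ 2 * ((p ^+ 2 + eta) ^+ 2 * (expR (8 * v) - 1) + 9 * rare d) /
    (p * (1 - p)) ^+ 2 +
  2 ^+ K * (rare d + expR (2 * r%:R ^+ 2 * v - r%:R * (u / 2)))].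
Proof.
have [C [c0 [C0 c00 hcorner]]] := corner_le_ratio.
exists C, c0; split=> // d s p u k K r eta v d1 ld hd hp p01 eta1 kK K0 u01 hu.
have [n1 [n2 [dE dn1 dn2]]] := half_split d1.
rewrite /v {v}; rewrite /eta {eta} in eta1 hu *; subst d.
set eta := 2 * slack _ / _ in eta1 hu *.
have d0 : 0 < (n1 + n2)%:R :> R by rewrite ltr0n; exact: ltnW d1.
have l0 : 0 < ln (n1 + n2)%:R :> R by exact: lt_le_trans ltr01 ld.
have lam0 : 0 < ratio C (n1 + n2) by rewrite divr_gt0// mulr_gt0// exprn_gt0.
have sl0 : 0 < slack (n1 + n2) :> R.
  by rewrite addr_gt0// mulr_gt0// expR_gt0.
have dn1' : (n1 + n2)%:R / 48 <= n1%:R / 16 :> R.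
  have : (n1 + n2)%:R <= 3 * n1%:R :> R by rewrite -natrM ler_nat.
  by lra.
have dn2' : (n1 + n2)%:R / 48 <= n2%:R / 16 :> R.
  have : (n1 + n2)%:R <= 3 * n2%:R :> R by rewrite -natrM ler_nat.
  by lra.
have p1 : p <= 1 by case/andP: p01 => _ /ltW.
have m2 : p ^+ 2 + eta <= 2.
  rewrite (_ : 2 = 1 + 1)// lerD// expr_le1//.
  by case/andP: p01 => /ltW.
have rare1 n (w : 'I_n -> R) : (n1 + n2)%:R / 48 <= n%:R / 16 :> R ->
    Ex (iid P n) (fun z => (\sum_i (mid (w i) (tnth z i))%:R <= n%:R / 16 :> R)%R%:R) <=
    rare (n1 + n2).
  move=> h; apply: le_trans (mids_rare w) _.
  by rewrite /rare ler_expR lerN2.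
rewrite /chi2 lerBlDl.
have bF := bm_Ex (iid P (n1 + n2)) (iid P (n1 + n2))
  (bmX k (bmD (bm_cst _ (1 : R)) (bmM (bmB (bm_codeg q s (n1 + n2)) (bm_cst _ (p ^+ 2)))
    (bm_cst _ (p * (1 - p))^-1)))).
apply: (Ex_le_cst _ bF) => y /=.
have hc (z' : pt n1) (z'' : pt n2) :
    ~~ (\sum_i (mid (tnth y (lshift n2 i)) (tnth z' i))%:R <= n1%:R / 16 :> R) ||
    ~~ (\sum_i (mid (tnth y (rshift n1 i)) (tnth z'' i))%:R <= n2%:R / 16 :> R) ->
    cornerP q s y (cat_tuple z' z'') <=
    ratio C (n1 + n2) * codeg q s y (cat_tuple z' z'') + slack (n1 + n2).
  move=> h; apply: hcorner => //.
  rewrite big_split_ord/=.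
  under eq_bigr do rewrite tnth_lshift.
  under [X in _ <= _ + X]eq_bigr do rewrite tnth_rshift.
  case/orP: h; rewrite -ltNge => h.
    by apply: le_trans dn1' (le_trans (ltW h) _); rewrite lerDl; exact: sumr_ge0.
  by apply: le_trans dn2' (le_trans (ltW h) _); rewrite lerDr; exact: sumr_ge0.
have hb1 := @rare1 n1 (fun i => tnth y (lshift n2 i)) dn1'.
have hb2 := @rare1 n2 (fun i => tnth y (rshift n1 i)) dn2'.
have hb2' := le_trans hb2 (rare_le_slack (n1 + n2)).
have V := codeg_var q1 hp lam0 sl0 hc hb1 hb2' m2 eta1.
have T := codeg_tail q1 hp lam0 sl0 hc hb1 hb2' r u01.
have bg := bm_codegr q s y.
have bt : bm (fun z => (p * (1 - p) / (2 * K%:R) <= codeg q s y z - p ^+ 2)%R%:R : R).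
  apply: bm_bool; apply: measurable_fun_ler; first exact: measurable_cst.
  by have [] := bmB bg (bm_cst _ (p ^+ 2)).
have bu : bm (fun z => (u * (p ^+ 2 + eta) <= codeg q s y z - p ^+ 2)%R%:R : R).
  apply: bm_bool; apply: measurable_fun_ler; first exact: measurable_cst.
  by have [] := bmB bg (bm_cst _ (p ^+ 2)).
apply: (power_mean bg p01 _ _ _ _ kK K0 _).
- by move=> z; rewrite codeg_ge0 (codeg_le y hp).
- by move=> z; exact: codeg_ge.
- by rewrite (Ex_iid_cat P bg); exact: (Ex_cg y hp).
- by rewrite (Ex_iid_cat P (bmX 2 (bmB bg (bm_cst _ (p ^+ 2))))).
- apply: le_trans (le_Ex _ bt bu _) _.
    move=> z; have [h|h] := leP (p * (1 - p) / (2 * K%:R)) (codeg q s y z - p ^+ 2).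
      by rewrite (le_trans hu h).
    exact: ler0n.
  by rewrite (Ex_iid_cat P bu).
Qed.

End Chi2.

(** * Existence of the threshold *)

Section Threshold.
Context (R : realType) (q : R).
Hypothesis q1 : 1 <= q.
Local Notation P := (uniform_prob (ltNhalf_half R)).
Local Notation T1 := (measurableTypeR R).
Local Notation pt n := (n.-tuple (measurableTypeR R)).

Let q0 : 0 < q. Proof. exact: lt_le_trans ltr01 q1. Qed.

(** This is where q >= 1 makes the inverse of the q-th power uniformly continuous. *)
Lemma powR_superadd (a b : R) : 0 <= a -> 0 <= b -> a `^ q + b `^ q <= (a + b) `^ q.
Proof.
move=> a0 b0; have [ab|ab] := eqVneq (a + b) 0.
  have [-> ->] : a = 0 /\ b = 0 by split; lra.
  by rewrite addr0 powR0 ?addr0// gt_eqF.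
have c0 : 0 < a + b by rewrite lt_neqAle eq_sym ab addr_ge0.
have le1 x : 0 <= x <= 1 -> x `^ q <= x.
  move=> /andP[x0 x1]; have [->|xn] := eqVneq x 0; first by rewrite powR0// gt_eqF.
  by apply: ge1r_powR q1; rewrite x1 andbT lt_neqAle eq_sym xn.
have h x : 0 <= x -> x <= a + b -> x `^ q <= (a + b) `^ q * (x / (a + b)).
  move=> x0 xab; rewrite -{1}[x](divfK ab) powRM ?divr_ge0// ?(ltW c0)// mulrC.
  rewrite ler_wpM2l ?powR_ge0// le1// divr_ge0// ?(ltW c0)//=.
  by rewrite ler_pdivrMr// mul1r.
have := h a a0; have := h b b0; rewrite lerDl lerDr => /(_ a0) hb /(_ b0) ha.
apply: le_trans (lerD ha hb) _.
by rewrite -mulrDr -mulrDl divff// mulr1.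
Qed.

(** A shell consists of two arcs of length g. *)
Lemma cd_shell (a g : R) : 0 <= a -> 0 <= g ->
  Ex P (fun x => (a <= cd x <= a + g)%R%:R) <= 2 * g.
Proof.
move=> a0 g0.
have mb : measurable_fun setT (fun x : T1 => a <= cd x <= a + g).
  apply: measurable_and; apply: measurable_fun_ler;
    solve [exact: measurable_cst|exact: measurable_cd].
rewrite Ex_bool//.
have mA : measurable [set x : T1 | a <= cd x <= a + g] by exact: measurable_bool_set.
have mI (b c : R) : lebesgue_measure (`[b, c]%classic : set T1) =
    (if b < c then c - b else 0)%:E.
  by rewrite lebesgue_measure_itv/= lte_fin; case: ifP.
have hA : (P [set x : T1 | (a <= cd x <= a + g)%R] <= (2 * g)%:E)%E.
  rewrite uniform_probE//.
  apply: (@le_trans _ _ (lebesgue_measure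
     (`[a, a + g]%classic `|` `[- a - g, - a]%classic : set T1))).
    apply: le_measure; rewrite ?inE.
    - by apply: measurableI => //; exact: measurable_itv.
    - by apply: measurableU; exact: measurable_itv.
    move=> x [/= /andP[h1 h2]]; rewrite in_itv/= => /andP[h3 h4].
    have [x0|x0] := leP 0 x.
      by left; rewrite cd_pos in h1 h2; [rewrite /= in_itv/= h1|rewrite x0 ltW].
    by right; rewrite cd_neg in h1 h2; [rewrite /= in_itv/=|]; lra.
  apply: le_trans (measureU2 _ _ _) _; [exact: measurable_itv|exact: measurable_itv|].
  rewrite [X in (X + _ <= _)%E]mI [X in (_ + X <= _)%E]mI -EFinD lee_fin.
  by case: ifP; case: ifP; lra.
by rewrite -lee_fin fineK//; exact: fin_num_measure.
Qed.

Lemma fq_shell (r h : R) : 0 <= h ->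
  Ex P (fun x => (r < fq q x <= r + h)%R%:R) <= 2 * h `^ q^-1.
Proof.
move=> h0.
have mb : measurable_fun setT (fun x : T1 => r < fq q x <= r + h).
  apply: measurable_and; [apply: measurable_fun_ltr|apply: measurable_fun_ler];
    solve [exact: measurable_cst|exact: measurable_fq].
pose a := (Num.max r 0) `^ q^-1; pose g := h `^ q^-1.
have mb2 : measurable_fun setT (fun x : T1 => a <= cd x <= a + g).
  apply: measurable_and; apply: measurable_fun_ler;
    solve [exact: measurable_cst|exact: measurable_cd].
have a0 : 0 <= a by exact: powR_ge0.
have g0 : 0 <= g by exact: powR_ge0.
have pK (x : R) : 0 <= x -> (x `^ q^-1) `^ q = x.
  by move=> x0; rewrite -powRrM mulVf ?gt_eqF// powRr1.
have qlt (x y : R) : 0 <= x -> x < y -> x `^ q < y `^ q.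
  by move=> x0 xy; apply: gt0_ltr_powR; rewrite ?nnegrE// ltW// (le_lt_trans x0).
apply: le_trans (cd_shell a0 g0).
apply: (le_Ex _ (bm_bool R mb) (bm_bool R mb2)) => x.
case: (boolP (r < fq q x <= r + h)) => // /andP[h1 h2].
have -> : a <= cd x.
  rewrite leNgt; apply/negP => /(qlt _ _ (cd_ge0 x)); rewrite pK ?le_max ?lexx ?orbT//.
  rewrite lt_max => /orP[h3|]; last by rewrite ltNge powR_ge0.
  by have := lt_trans h1 h3; rewrite ltxx.
have -> // : cd x <= a + g.
rewrite leNgt; apply/negP => /(qlt _ _ (addr_ge0 a0 g0)).
apply/negP; rewrite -leNgt; apply: le_trans (powR_superadd a0 g0).
rewrite !pK// ?le_max ?lexx ?orbT//; apply: le_trans h2 _; rewrite lerD2r.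
by rewrite le_max lexx.
Qed.

(** Translating by the origin wraps a point of R^n into the cube. *)
Definition origin n : pt n := [tuple 0 | i < n].

Definition ball_vol n (s : R) : R := Ex (iid P n) (fun t => (near q s (origin n) t)%:R).

Lemma near_vol n s (y : pt n) : Ex (iid P n) (fun t => (near q s y t)%:R) = ball_vol n s.
Proof.
rewrite -(Ex_shift y (bm_near q s y)); congr Ex; apply/funext => t.
rewrite /near distq_shift; congr ((_ <= _)%R%:R); apply: eq_bigr => i _.
by rewrite tnth_mktuple; congr fq; ring.
Qed.

Lemma distq_origin_cons n x (t : pt n) :
  distq q (origin n.+1) (cons_pair (x, t)) = fq q x + distq q (origin n) t.
Proof.
rewrite /distq big_ord_recl tnth_cons0 tnth_mktuple subr0; congr (_ + _).
by apply: eq_bigr => i _; rewrite tnth_consS !tnth_mktuple.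
Qed.

(** Given the other coordinates, the first one must lie in a thin shell. *)
Lemma ball_vol_step n s h : 0 <= h ->
  ball_vol n.+1 (s + h) <= ball_vol n.+1 s + 2 * h `^ q^-1.
Proof.
move=> h0.
(* the shell between the two balls *)
pose b (t : pt n.+1) : bool := s < distq q (origin n.+1) t <= s + h.
have mb : measurable_fun setT b.
  apply: measurable_and; [apply: measurable_fun_ltr|apply: measurable_fun_ler];
    solve [exact: measurable_cst|exact: measurable_distq_center].
have bb := bm_bool R mb.
have n1 := bm_near q s (origin n.+1); have n2 := bm_near q (s + h) (origin n.+1).
apply: (@le_trans _ _ (ball_vol n.+1 s + Ex (iid P n.+1) (fun t => (b t)%:R))).
  rewrite /ball_vol -(ExD _ n1 bb); apply: (le_Ex _ n2 (bmD n1 bb)) => t.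
  rewrite /near /b; have [h1|h1] := leP (distq q (origin n.+1) t) s.
    by rewrite /= addr0 lern1 leq_b1.
  by rewrite /= add0r.
rewrite lerD2l (Ex_iidS P bb) (Ex_swap (F := fun x t => (b (cons_pair (x, t)))%:R)
  P (iid P n) (bm_comp (@measurable_cons_pair _ _ n) bb)).
have bE := bm_Ex (iid P n) P (bm_comp (measurable_fun_pair
  (@measurable_snd _ _ (pt n) T1) (@measurable_fst _ _ (pt n) T1))
  (bm_comp (@measurable_cons_pair _ _ n) bb)).
apply: (Ex_le_cst _ bE) => t.
apply: le_trans (fq_shell (s - distq q (origin n) t) h0).
rewrite le_eqVlt; apply/orP; left; apply/eqP; congr Ex; apply/funext => x /=.
by rewrite /b distq_origin_cons ltrBlDr addrAC lerBrDr.
Qed.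

Lemma ball_vol_mono n s s' : s <= s' -> ball_vol n s <= ball_vol n s'.
Proof.
move=> ss; apply: (le_Ex _ (bm_near _ _ _) (bm_near _ _ _)) => t.
rewrite ler_nat; case: (boolP (near q s (origin n) t)) => // h.
by rewrite [near q s' _ _](le_trans h ss).
Qed.

Lemma distq_ge0 n (y t : pt n) : 0 <= distq q y t.
Proof. by apply: sumr_ge0 => i _; exact: fq_ge0. Qed.

Lemma distq_le n (y t : pt n) : distq q y t <= n%:R.
Proof.
rewrite -[X in _ <= X%:R]card_ord -sumr_const; apply: ler_sum => i _; exact: fq_le1.
Qed.

Lemma ball_vol_lt0 n s : s < 0 -> ball_vol n s = 0.
Proof.
move=> s0; rewrite -[RHS](Ex_cst (iid P n)); congr Ex; apply/funext => t.
by rewrite /near leNgt (lt_le_trans s0 (distq_ge0 _ _)).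
Qed.

Lemma ball_vol_top n : ball_vol n n%:R = 1.
Proof.
rewrite -[RHS](Ex_cst (iid P n)); congr Ex; apply/funext => t.
by rewrite /near distq_le.
Qed.

(** The volume is continuous in the q-th power of the radius by [ball_vol_step]
and [ball_vol_mono], so the intermediate value theorem applies between the
levels -1, where it vanishes, and n, where it is 1. *)
Lemma ball_vol_onto n p : 0 < p < 1 -> exists2 s, 0 <= s & ball_vol n.+1 s = p.
Proof.
move=> /andP[p0 p1].
have cont : continuous (ball_vol n.+1 : R -> R).
  move=> x; apply/cvgrPdist_le => e e0; near=> y.
  have pe : (e / 2) `^ q `^ q^-1 = e / 2.
    by rewrite -powRrM divff ?gt_eqF// powRr1// divr_ge0// ltW.
  have key a b : a <= b -> b - a <= (e / 2) `^ q ->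
      0 <= ball_vol n.+1 b - ball_vol n.+1 a <= e.
    move=> ab hab; rewrite subr_ge0 ball_vol_mono//= lerBlDl.
    rewrite -{1}(subrKC a b); apply: le_trans (ball_vol_step _ _ _) _.
      by rewrite subr_ge0.
    rewrite lerD2l -[leRHS](divfK (_ : 2 != 0)) ?pnatr_eq0// mulrC ler_wpM2r// -pe.
    apply: ge0_ler_powR => //; first by rewrite invr_ge0 ltW.
      by rewrite nnegrE subr_ge0.
    by rewrite nnegrE powR_ge0.
  have hxy : `|x - y| <= (e / 2) `^ q.
    near: y; apply: cvgr_dist_le; first exact: cvg_id.
    by rewrite powR_gt0// divr_gt0.
  have [xy|/ltW xy] := leP x y.
    have yx : y - x <= (e / 2) `^ q by rewrite -[leLHS]ger0_norm ?subr_ge0// distrC.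
    by have /andP[h1 h2] := key _ _ xy yx; rewrite distrC ger0_norm.
  have yx : x - y <= (e / 2) `^ q by rewrite -[leLHS]ger0_norm ?subr_ge0.
  by have /andP[h1 h2] := key _ _ xy yx; rewrite ger0_norm.
have [] := @IVT R (ball_vol n.+1) (- 1) n.+1%:R p.
- by rewrite (le_trans (_ : _ <= 0))//.
- exact: continuous_subspaceT.
- rewrite ball_vol_lt0// ball_vol_top; apply/andP; split.
    by rewrite ge_min ltW.
  by rewrite le_max (ltW p1) orbT.
move=> s _ sp; exists s => //; rewrite leNgt; apply/negP => s0.
by move: p0; rewrite -sp ball_vol_lt0// ltxx.
Unshelve. all: by end_near.
Qed.


Lemma torus_dist_shift n (x y : pt n) :
  torus_dist q (shift (origin n) x) (shift (origin n) y) = distq q x y `^ q^-1.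
Proof.
congr (_ `^ _); rewrite distq_sym; apply: eq_bigr => i _.
by rewrite !tnth_mktuple circ_dist_wrap !addr0.
Qed.

(** The q-th power of the radius; a negative radius gives the empty ball, as does
the level -1. *)
Definition level (tau : R) : R := if 0 <= tau then tau `^ q else - 1.

(** The cube and its boundary identifications are replaced by the periodic
distance on wrapped points. *)
Lemma torus_dist_le n (x y : pt n) tau :
  (torus_dist q (shift (origin n) x) (shift (origin n) y) <= tau) =
  near q (level tau) x y.
Proof.
rewrite torus_dist_shift /level /near.
have S0 := distq_ge0 x y; have [t0|t0] := leP 0 tau; last first.
  by rewrite !leNgt (lt_le_trans t0 (powR_ge0 _ _)) (lt_le_trans _ S0)// ltrN10.
have SK : (distq q x y `^ q^-1) `^ q = distq q x y by rewrite -powRrM mulVf ?gt_eqF// powRr1.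
apply/idP/idP => h.
  rewrite -SK; apply: ge0_ler_powR => //; first exact: ltW.
  by rewrite nnegrE powR_ge0.
have -> : tau = (tau `^ q) `^ q^-1 by rewrite -powRrM divff ?gt_eqF// powRr1.
by apply: ge0_ler_powR => //; rewrite ?nnegrE ?powR_ge0// invr_ge0 ltW.
Qed.

Lemma measurable_torus_dist_le n tau :
  measurable_fun setT (fun z : pt n * pt n => torus_dist q z.1 z.2 <= tau).
Proof.
apply: measurable_fun_ler; last exact: measurable_cst.
apply: (measurableT_comp (measurable_powR q^-1)).
apply: measurable_sum => i; apply: (measurableT_comp (measurable_powR q)).
have mB : measurable_fun setT (fun z : pt n * pt n => `|tnth z.1 i - tnth z.2 i| : R).
  apply: (measurableT_comp (@normr_measurable R setT)); apply: measurable_funB.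
    by apply: (measurableT_comp (measurable_tnth i)); exact: measurable_fst.
  by apply: (measurableT_comp (measurable_tnth i)); exact: measurable_snd.
apply: measurable_minr => //; apply: measurable_funB => //; exact: measurable_cst.
Qed.

(** Both points may be wrapped since this preserves their law; the probability
that the second is near the first does not depend on the first. *)
Lemma edge_probE n tau : edge_prob q n tau = (ball_vol n (level tau))%:E.
Proof.
have mb := @measurable_torus_dist_le n tau; have bb := bm_bool R mb.
have hb (x : pt n) : bm (fun y => (torus_dist q x y <= tau)%R%:R : R).
  exact: (bm_comp (pair1_measurable x) bb).
pose Q : probability (pt n * pt n)%type R := (iid P n \x iid P n)%E.
rewrite [LHS](_ : _ = Q [set z | torus_dist q z.1 z.2 <= tau])//.
rewrite -[LHS]fineK; last first.
  by apply: fin_num_measure; exact: measurable_bool_set.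
congr EFin; rewrite -(Ex_bool _ mb) (Ex_prod _ _ bb).
have bE := bm_Ex (iid P n) (iid P n) bb.
rewrite -[LHS](Ex_shift (origin n) bE) -[RHS](Ex_cst (iid P n)).
congr Ex; apply/funext => x; rewrite -(Ex_shift (origin n) (hb _)) -(near_vol _ x).
by congr Ex; apply/funext => y; rewrite torus_dist_le.
Qed.

(** Some radius gives edge probability p, so the threshold, which is chosen among
such radii, gives it too. *)
Lemma near_threshold n p : 0 < p < 1 -> forall y : pt n.+1,
  Ex (iid P n.+1) (fun t => (near q (level (threshold q n.+1 p)) y t)%:R) = p.
Proof.
move=> p01 y; rewrite near_vol; apply: EFin_inj; rewrite -edge_probE.
have [s s0 hs] := @ball_vol_onto n _ p01.
apply: (@getPex _ [set tau | edge_prob q n.+1 tau = p%:E]).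
exists (s `^ q^-1) => /=; rewrite edge_probE /level powR_ge0.
by rewrite -powRrM mulVf ?gt_eqF// powRr1// hs.
Qed.

End Threshold.

(** * The laws of the two graphs as laws of triangular arrays *)

Lemma set2_eq (T : finType) (a b u v : T) : u != v ->
  [set a; b]%SET = [set u; v]%SET -> a = u /\ b = v \/ a = v /\ b = u.
Proof.
move=> uv h.
have ha : a \in [set u; v]%SET by rewrite -h set21.
have hb : b \in [set u; v]%SET by rewrite -h set22.
have hu : u \in [set a; b]%SET by rewrite h set21.
have hv : v \in [set a; b]%SET by rewrite h set22.
case/set2P: ha hu hv uv => ->; case/set2P: hb => -> hu hv uv; [|by left|by right|].
  by case/set2P: hv uv => ->; rewrite eqxx.
by case/set2P: hu uv => ->; rewrite eqxx.
Qed.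

(** The upper triangle of the adjacency matrix. *)
Definition upper n (G : sgraph n) : tri n :=
  enc (fun u v => [set u; v]%SET \in val G).

Lemma all_pairsP n (e : {set 'I_n}) : e \in all_pairs n ->
  exists u v : 'I_n, (u < v)%N /\ e = [set u; v]%SET.
Proof.
rewrite inE => /cards2P [u [v [uv ->]]].
have [h|h] := boolP (u < v)%N; first by exists u, v.
exists v, u; split; last by rewrite finset.setUC.
by rewrite ltn_neqAle eq_sym val_eqE uv leqNgt.
Qed.

Lemma upper_inj n : injective (@upper n).
Proof.
move=> G H GH; apply: val_inj; apply/setP => e.
case: (boolP (e \in all_pairs n)) => [/all_pairsP[u [v [uv ->]]]|he].
  exact: (enc_inj GH uv).
have out (K : sgraph n) : e \in val K = false.
  by apply/negP => /(fintype.subsetP (valP K)); rewrite (negbTE he).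
by rewrite !out.
Qed.

Section Laws.
Context (R : realType) (q : R).
Local Notation P := (uniform_prob (ltNhalf_half R)).
Local Notation pt n := (n.-tuple (measurableTypeR R)).

Lemma torus_distC d (x y : pt d) : torus_dist q x y = torus_dist q y x.
Proof.
congr (_ `^ _); apply: eq_bigr => i _; congr (_ `^ _).
by rewrite /circ_dist distrC.
Qed.

Lemma upper_geom n d tau (x : n.-tuple (pt d)) :
  upper (geom_graph q tau x) =
  enc (fun i j => torus_dist q (tnth x i) (tnth x j) <= tau).
Proof.
apply: enc_ext => i j ij; rewrite inE; apply/existsP/idP => [[u /existsP[v]]|h].
  move=> /and3P[uv /eqP e h]; have [[-> ->]//|[-> ->]] := set2_eq uv e.
  by rewrite torus_distC.
exists i; apply/existsP; exists j; rewrite eqxx h andbT/= -val_eqE/=.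
by rewrite neq_ltn ij.
Qed.

Lemma GnpE n (p : R) (G : sgraph n) : Gnp p G = er_law p (upper G).
Proof.
rewrite er_law_enc /Gnp.
transitivity (\prod_(e in [set [set z.1; z.2]%SET | z in
    [set z : 'I_n * 'I_n | (z.1 < z.2)%N]]%SET) bern p (e \in val G)).
  apply: eq_bigl => e; apply/idP/imsetP => [/all_pairsP[u [v [uv ->]]]|[z]].
    by exists (u, v); rewrite ?inE.
  by rewrite !inE => zz ->; rewrite cards2 -val_eqE/= neq_ltn zz.
rewrite big_imset/=; first by apply: eq_bigl => z; rewrite inE.
move=> [a b] [u v]; rewrite !inE/= => ab uv /set2_eq.
rewrite -val_eqE/= neq_ltn uv => /(_ isT)[[-> ->]//|[ha hb]].
by move: ab; rewrite ha hb ltnNge ltnW.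
Qed.

Hypothesis q1 : 1 <= q.

(** Wrapping all positions does not change their joint law. *)
Lemma RGGE n d p (G : sgraph n) :
  RGG q d p G = Ex (iid (torus_uniform R d) n) (fun x =>
    (enc (fun i j => near q (level q (threshold q d p)) (tnth x i) (tnth x j))
       == upper G)%:R).
Proof.
set tau := threshold q d p.
pose adj (x y : pt d) := torus_dist q x y <= tau.
have madj : measurable_fun setT (fun z : pt d * pt d => adj z.1 z.2).
  exact: measurable_torus_dist_le.
have bg := bm_graph R madj (upper G).
pose b (x : n.-tuple (pt d)) : bool := enc (fun i j => adj (tnth x i) (tnth x j)) == upper G.
have mb : measurable_fun setT b.
  rewrite (_ : b = fun x => (1 <= (b x)%:R :> R)); last first.
    by apply/funext => x; case: (b x); rewrite ?lexx// lt_geF.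
  by apply: measurable_fun_ler; [exact: measurable_cst|case: bg].
rewrite /RGG (_ : [set x | _] = [set x | b x]); last first.
  apply/seteqP; split=> x /=; rewrite /b /adj -upper_geom; first by move=> ->.
  by move=> /eqP/upper_inj.
rewrite -(Ex_bool _ mb).
have ms : forall i : 'I_n, measurable_fun setT (shift (origin R d)).
  by move=> _; exact: measurable_shiftt.
have es : forall (i : 'I_n) F, bm F ->
    Ex (torus_uniform R d) (fun t => F (shift (origin R d) t)) = Ex (torus_uniform R d) F.
  by move=> _ F; exact: Ex_shift.
rewrite -[LHS](Ex_iid_coordmap ms es bg).
congr Ex; apply/funext => x; congr ((_ == _)%:R).
by apply: enc_ext => i j _; rewrite /adj !tnth_mktuple torus_dist_le.
Qed.

(** The coding of graphs is injective, so the sum over graphs is part of the sum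
over triangular arrays. *)
Lemma tv_le_chi2 n d p c : 0 < p < 1 -> 0 < c ->
  TV (@RGG R q n d.+1 p) (@Gnp R n p) <=
  c * \sum_(k < n) chi2 (iid P d.+1) (near q (level q (threshold q d.+1 p)) (n:=d.+1)) p k + c^-1.
Proof.
move=> p01 c0; set s := level _ _.
have madj := @measurable_near2 R q s d.+1.
apply: le_trans (tv_graph_law madj p01 (near_threshold q1 p01) n c0).
rewrite /TV ler_pM2l ?invr_gt0//.
pose h (g : tri n) : R := `|Ex (iid (iid P d.+1) n) (fun x =>
    (enc (fun i j => near q s (tnth x i) (tnth x j)) == g)%:R) - er_law p g|.
rewrite (eq_bigr (fun G => h (upper G))); last by move=> G _; rewrite RGGE GnpE.
have -> : \sum_G h (upper G) = \sum_(g in @upper n @: [set: sgraph n]%SET) h g.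
  rewrite big_imset/=; last by move=> G H _ _; exact: upper_inj.
  by apply: eq_bigl => G; rewrite inE.
rewrite [leRHS](bigID (mem (@upper n @: [set: sgraph n]%SET)))/= lerDl.
by apply: sumr_ge0 => g _; exact: normr_ge0.
Qed.

End Laws.

(** * Growth rates *)

Section Growth.
Context (R : realType).
Implicit Types x e c : R.

Lemma pow_le_expR (k : nat) e c : 0 < e -> 0 < c ->
  exists2 A : R, 0 < A & forall x, A <= x -> x ^+ k <= e * expR (c * x).
Proof.
move=> e0 c0; pose a := c / k.+1%:R.
have a0 : 0 < a by rewrite divr_gt0.
have ak : 0 < e * a ^+ k.+1 by rewrite mulr_gt0// exprn_gt0.
exists (e * a ^+ k.+1)^-1 => [|x Ax]; first by rewrite invr_gt0.
have x0 : 0 < x by apply: lt_le_trans Ax; rewrite invr_gt0.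
have h : (a * x) ^+ k.+1 <= expR (c * x).
  have -> : c * x = k.+1%:R * (a * x) by rewrite /a; field; rewrite gt_eqF.
  rewrite expRM_natl lerXn2r// ?nnegrE ?expR_ge0//; first by rewrite mulr_ge0// ltW.
  by apply: le_trans (expR_ge1Dx _); rewrite lerDr.
apply: (@le_trans _ _ (e * (a * x) ^+ k.+1)); last by rewrite ler_pM2l.
have -> : e * (a * x) ^+ k.+1 = x ^+ k * (e * a ^+ k.+1 * x).
  by rewrite exprMn (exprSr x); ring.
by rewrite ler_peMr ?exprn_ge0 ?(ltW x0)// -ler_pdivrMl// mulr1.
Qed.

(** The slack is at most 6 exp (- ln d) / d^3, because (ln d)^2 / 8 exceeds
4 ln d for large d. *)
Lemma slack_small e : 0 < e -> exists2 A : R, 0 < A &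
  forall d : nat, (0 < d)%N -> A <= ln d%:R -> slack R d * d%:R ^+ 3 <= e.
Proof.
move=> e0.
have b0 : 0 < (4 * (48 * 64))^-1 :> R by rewrite invr_gt0 !mulr_gt0.
have e6 : 0 < e / 6 by rewrite divr_gt0.
have [A1 A10 h1] := pow_le_expR 1 b0 ltr01.
have [A2 A20 h2] := pow_le_expR 0 e6 ltr01.
exists (A1 + A2 + 32) => [|d d0 hA]; first by rewrite !addr_gt0.
have {}d0 : 0 < d%:R :> R by rewrite ltr0n.
set l := ln d%:R in hA.
have dE : d%:R = expR l :> R by rewrite lnK.
have := h1 l; have := h2 l; rewrite !mul1r expr0 expr1 => /(_ _)h3 /(_ _)h4.
have {}h3 : 1 <= e / 6 * expR l by apply: h3; lra.
have {}h4 : l <= (4 * (48 * 64))^-1 * expR l by apply: h4; lra.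
have d3 : d%:R ^+ 3 = expR (3 * l) :> R by rewrite expRM_natl -dE.
rewrite /slack d3 -/l mulrDl -[4 * _ * _]mulrA -[2 * _ * _]mulrA -!expRD.
have k1 : expR (- (l ^+ 2 / 8) + 3 * l) <= expR (- l).
  have l32 : 32 <= l by lra.
  by rewrite ler_expR; nra.
have k2 : expR (- (d%:R / 48 / 64) + 3 * l) <= expR (- l).
  have e1 : (4 * (48 * 64))^-1 * expR l = expR l / 48 / 64 / 4 by field.
  by rewrite ler_expR [in leLHS]dE; move: h4; rewrite e1; lra.
have k3 : expR (- l) <= e / 6.
  by rewrite expRN -[leLHS]mul1r ler_pdivrMr ?expR_gt0.
lra.
Qed.

(** If d <= n^5 then ln d <= 5 ln n, and two of the six logarithms in the
hypothesis are to spare. If d > n^5 then n^3 <= d^(3/5) leaves room for any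
power of ln d. *)
Lemma codegree_scale e : 0 < e -> exists2 A : R, 0 < A & exists2 M : R, 0 < M &
  forall (n d : nat) (p : R), (0 < n)%N -> A <= ln n%:R -> (n <= d)%N -> 0 <= p <= 1 ->
  M * (p ^+ 2 * n%:R ^+ 3 * ln n%:R ^+ 6) <= d%:R ->
  p ^+ 2 * n%:R ^+ 3 * ln d%:R ^+ 4 <= e * d%:R.
Proof.
move=> e0.
have c0 : 0 < 2 / 5 :> R by rewrite divr_gt0.
have [A A0 hA] := pow_le_expR 4 e0 c0.
exists (A + 1); first by rewrite addr_gt0.
exists (5 ^+ 4 / e) => [|n d p n0 hn nd /andP[p0 p1] hM]; first by rewrite divr_gt0 ?exprn_gt0.
have N0 : 0 < n%:R :> R by rewrite ltr0n.
have D0 : 0 < d%:R :> R by rewrite ltr0n (leq_trans n0).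
set L := ln n%:R in hn hM; set l := ln d%:R.
have Ll : L <= l by rewrite ler_ln ?posrE// ler_nat.
have L1 : 1 <= L by lra.
have X0 : 0 <= p ^+ 2 * n%:R ^+ 3 by rewrite mulr_ge0 ?sqr_ge0// exprn_ge0// ltW.
have [h|h] := leP l (5 * L).
  have k1 : l ^+ 4 <= 5 ^+ 4 * L ^+ 6.
    apply: (@le_trans _ _ ((5 * L) ^+ 4)).
      by rewrite lerXn2r// ?nnegrE; lra.
    by rewrite exprMn ler_pM2l ?exprn_gt0// ler_weXn2l.
  rewrite mulrAC in hM *; apply: le_trans (ler_wpM2l X0 k1) _.
  rewrite -ler_pdivrMl//; apply: le_trans hM.
  by rewrite le_eqVlt; apply/orP; left; apply/eqP; ring.
have k2 : p ^+ 2 * n%:R ^+ 3 <= expR (3 / 5 * l).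
  apply: (@le_trans _ _ (n%:R ^+ 3)).
    by rewrite ler_piMl ?exprn_ge0 ?(ltW N0)// exprn_ile1.
  rewrite -[n%:R](@lnK R) ?posrE// -/L -expRM_natl ler_expR; lra.
have k3 : l ^+ 4 <= e * expR (2 / 5 * l) by apply: hA; lra.
apply: le_trans (ler_pM X0 _ k2 k3) _; first by rewrite exprn_ge0//; lra.
rewrite mulrCA -expRD ler_pM2l// -[leRHS](@lnK R) ?posrE// -/l ler_expR; lra.
Qed.

(** The optimal order of the moment is r = u / (8 v), which gives an exponent
of order - u^2 / v. *)
Lemma tail_exponent (N u v : R) : 1 <= N -> 0 < v -> 0 < u <= 1 ->
  192 * (N * v) <= u ^+ 2 ->
  exists r : nat, 2 * r%:R ^+ 2 * v - r%:R * (u / 2) <= - (3 * N).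
Proof.
move=> N1 v0 /andP[u0 u1] h.
pose k := Num.truncn (u / (8 * v)); exists k; pose r : R := k%:R; rewrite -/r.
have v8 : 0 < 8 * v by rewrite mulr_gt0.
have /andP[] := @truncn_itv R (u / (8 * v)) (divr_ge0 (ltW u0) (ltW v8)).
rewrite -/k -[k.+1%:R]natr1 -/r ler_pdivlMr// ltr_pdivrMr// => r1 r2.
have r0 : 0 <= r by exact: ler0n.
have hv : v <= N * v by rewrite ler_peMl// ltW.
have hu : u ^+ 2 <= u by rewrite expr2 ler_piMl// ltW.
have h1 : 2 * r ^+ 2 * v <= r * (u / 4).
  have : r * (r * (8 * v)) <= r * u by rewrite ler_wpM2l.
  by rewrite expr2; lra.
have h2 : u / 2 <= r * (8 * v) by lra.
have h3 : 12 * N <= r * u.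
  rewrite -(ler_pM2r v0).
  have : u * (u / 2) <= u * (r * (8 * v)) by rewrite ler_wpM2l// ltW.
  lra.
lra.
Qed.

Lemma second_moment_term (N p eps eta v ra : R) :
  0 < p <= 1 - eps -> 0 < eps -> 0 <= eta <= p ^+ 2 -> 0 <= v -> 16 * v <= 1 ->
  0 <= ra -> 0 <= N ->
  2 * N ^+ 2 * ((p ^+ 2 + eta) ^+ 2 * (expR (8 * v) - 1) + 9 * ra) / (p * (1 - p)) ^+ 2
  <= 128 / eps ^+ 2 * (p ^+ 2 * N ^+ 2 * v) + 18 / eps ^+ 2 * (N ^+ 2 * ra / p ^+ 2).
Proof.
move=> /andP[p0 p1] eps0 /andP[et0 et1] v0 v8 ra0 N0.
have hexp : expR (8 * v) - 1 <= 16 * v.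
  have v81 : 8 * v <= 2^-1 by lra.
  have := expR_le_quad v81.
  have : (8 * v) ^+ 2 <= 2^-1 * (8 * v) by rewrite expr2 ler_wpM2r// mulr_ge0.
  lra.
have hexp0 : 0 <= expR (8 * v) - 1 by rewrite subr_ge0 -[leLHS](@expR0 R) ler_expR mulr_ge0.
have h2 : (p ^+ 2 + eta) ^+ 2 <= 4 * p ^+ 4.
  have -> : 4 * p ^+ 4 = (2 * p ^+ 2) ^+ 2 by ring.
  by rewrite lerXn2r// ?nnegrE; have := sqr_ge0 p; lra.
have hnum : (p ^+ 2 + eta) ^+ 2 * (expR (8 * v) - 1) + 9 * ra <= 64 * p ^+ 4 * v + 9 * ra.
  rewrite lerD2r; apply: le_trans (ler_pM (sqr_ge0 _) hexp0 h2 hexp) _.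
  by rewrite le_eqVlt; apply/orP; left; apply/eqP; ring.
have hden : p ^+ 2 * eps ^+ 2 <= (p * (1 - p)) ^+ 2.
  rewrite exprMn ler_wpM2l ?sqr_ge0// lerXn2r// ?nnegrE; lra.
have den0 : 0 < p ^+ 2 * eps ^+ 2 by rewrite mulr_gt0// exprn_gt0.
have den1 := lt_le_trans den0 hden.
rewrite ler_pdivrMr//; set Y := (X in _ <= X * _).
have Y0 : 0 <= Y.
  have k1 : 0 <= p ^+ 2 * N ^+ 2 * v by rewrite mulr_ge0// mulr_ge0 ?sqr_ge0.
  have k2 : 0 <= N ^+ 2 * ra / p ^+ 2 by rewrite divr_ge0 ?sqr_ge0// mulr_ge0 ?sqr_ge0.
  have k3 (c : R) : 0 <= c -> 0 <= c / eps ^+ 2 by move=> c0; rewrite divr_ge0 ?sqr_ge0.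
  by apply: addr_ge0; apply: mulr_ge0 => //; apply: k3.
have YE : Y * (p ^+ 2 * eps ^+ 2) = 2 * N ^+ 2 * (64 * p ^+ 4 * v + 9 * ra).
  by rewrite /Y; field; rewrite !gt_eqF.
apply: le_trans (ler_wpM2l Y0 hden); rewrite YE ler_wpM2l//.
by rewrite mulr_ge0// sqr_ge0.
Qed.


(** Both N and 2^N are at most exp N. *)
Lemma exp_terms (n : nat) (ra : R) : 0 <= ra <= expR (- (4 * n%:R)) ->
  n%:R * (2 ^+ n * (ra + expR (- (3 * n%:R)))) <= 2 * expR (- n%:R).
Proof.
move=> /andP[ra0 hra]; have N0 : 0 <= n%:R :> R by exact: ler0n.
have k1 : n%:R <= expR n%:R :> R.
  by apply: le_trans (expR_ge1Dx _); rewrite lerDr.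
have k2 : 2 ^+ n <= expR n%:R :> R.
  rewrite -[n%:R]mulr1 expRM_natl lerXn2r// ?nnegrE ?expR_ge0//.
  by have := @expR_ge1Dx R 1; lra.
have k3 : ra + expR (- (3 * n%:R)) <= 2 * expR (- (3 * n%:R)).
  have : expR (- (4 * n%:R)) <= expR (- (3 * n%:R)) :> R by rewrite ler_expR; lra.
  by lra.
have k4 : 0 <= ra + expR (- (3 * n%:R)) by rewrite addr_ge0// expR_ge0.
have k5 : 0 <= 2 ^+ n :> R by exact: exprn_ge0.
apply: le_trans (ler_pM N0 (mulr_ge0 k5 k4) k1 (ler_pM k5 k4 k2 k3)) _.
have -> : expR n%:R * (expR n%:R * (2 * expR (- (3 * n%:R)))) =
   2 * (expR n%:R * (expR n%:R * expR (- (3 * n%:R)))) :> R by ring.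
by rewrite -!expRD ler_pM2l// ler_expR; lra.
Qed.

(** The deviation p (1 - p) / (2 N) of the codegree is a relative deviation u of
order 1 / (N p), which has to be capped at 1. In both cases u^2 / v is large
compared with N. *)
Lemma slope_bound (N p eps eta v u : R) :
  0 < p <= 1 - eps -> 0 < eps -> 0 <= eta <= p ^+ 2 -> 1 <= N ->
  192 * (N * v) <= 1 -> 192 * 16 * (p ^+ 2 * N ^+ 3 * v) <= eps ^+ 2 ->
  u = Num.min 1 (eps / (4 * N * p)) ->
  [/\ 0 < u <= 1, u * (p ^+ 2 + eta) <= p * (1 - p) / (2 * N) &
      192 * (N * v) <= u ^+ 2].
Proof.
move=> /andP[p0 p1] eps0 /andP[et0 et1] N1 h1 h2 ->.
have N0 : 0 < N by lra.
have w0 : 0 < 4 * N * p by rewrite !mulr_gt0.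
have y0 : 0 < eps / (4 * N * p) by rewrite divr_gt0.
have u0 : 0 < Num.min 1 (eps / (4 * N * p)) by rewrite lt_min ltr01.
split.
- by rewrite u0 ge_min lexx.
- apply: (@le_trans _ _ (eps / (4 * N * p) * (2 * p ^+ 2))).
    apply: ler_pM; [exact: ltW|by rewrite addr_ge0 ?sqr_ge0|by rewrite ge_min lexx orbT|lra].
  have -> : eps / (4 * N * p) * (2 * p ^+ 2) = p * eps / (2 * N) by field; rewrite !gt_eqF.
  by rewrite ler_pM2r ?invr_gt0 ?mulr_gt0// ler_pM2l//; lra.
have [h|h] := leP 1 (eps / (4 * N * p)); first by rewrite expr1n.
rewrite expr_div_n ler_pdivlMr ?exprn_gt0//.
by apply: le_trans h2; rewrite le_eqVlt; apply/orP; left; apply/eqP; ring.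
Qed.


(** As p >= alpha / N >= alpha / D, an error smaller than D^-2 is smaller
than p^2. *)
Lemma eta_le_sqr (sl D C alpha N p l : R) : 0 <= sl -> 1 <= l -> 0 < C -> 0 < alpha ->
  0 < N <= D -> alpha / N <= p -> sl * D ^+ 3 <= C * alpha ^+ 2 / 2 ->
  2 * sl / (C * l ^+ 2 / D) <= p ^+ 2.
Proof.
move=> sl0 l1 C0 al0 /andP[N0 ND] hp hs.
have D0 : 0 < D by exact: lt_le_trans ND.
have l2 : 1 <= l ^+ 2 by rewrite exprn_ege1.
have aD : alpha / D <= p by apply: le_trans hp; rewrite ler_pM2l// lef_pV2.
apply: (@le_trans _ _ ((alpha / D) ^+ 2)); last first.
  by rewrite lerXn2r// nnegrE; [|apply: le_trans aD]; rewrite ltW ?divr_gt0.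
have Cl : 0 < C * l ^+ 2 by rewrite mulr_gt0//; lra.
rewrite ler_pdivrMr ?divr_gt0//.
have -> : (alpha / D) ^+ 2 * (C * l ^+ 2 / D) = C * alpha ^+ 2 * l ^+ 2 / D ^+ 3.
  by field; rewrite gt_eqF.
rewrite ler_pdivlMr ?exprn_gt0//.
have c0 : 0 <= C * alpha ^+ 2 by rewrite mulr_ge0 ?sqr_ge0// ltW.
have : C * alpha ^+ 2 <= C * alpha ^+ 2 * l ^+ 2 by rewrite ler_peMr.
lra.
Qed.

(** In the sparse range p^2 N^2 is bounded below, so N v is controlled by
p^2 N^3 v. *)
Lemma sparse_scale (N p alpha v : R) : 0 < alpha -> 0 < N -> 0 <= v -> alpha / N <= p ->
  N * v <= p ^+ 2 * N ^+ 3 * v / alpha ^+ 2.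
Proof.
move=> al0 N0 v0 hp.
have h : alpha ^+ 2 <= (p * N) ^+ 2.
  have : alpha <= p * N by rewrite -ler_pdivrMr.
  by move=> h; rewrite lerXn2r// nnegrE ltW//; apply: lt_le_trans h.
rewrite ler_pdivlMr ?exprn_gt0//.
have -> : p ^+ 2 * N ^+ 3 * v = N * v * (p * N) ^+ 2 by ring.
by rewrite ler_wpM2l// mulr_ge0// ltW.
Qed.

Lemma rare_scale (N p alpha ra : R) : 0 < alpha -> 0 < N -> 0 <= ra -> alpha / N <= p ->
  N * (N ^+ 2 * ra / p ^+ 2) <= N ^+ 5 * ra / alpha ^+ 2.
Proof.
move=> al0 N0 ra0 hp.
have p0 : 0 < p by apply: lt_le_trans hp; rewrite divr_gt0.
have := sparse_scale al0 N0 (mulr_ge0 (exprn_ge0 2 (ltW N0)) ra0) hp.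
have p20 : 0 < p ^+ 2 by rewrite exprn_gt0.
rewrite -(ler_pM2r (_ : 0 < (p ^+ 2)^-1)) ?invr_gt0// => h.
apply: le_trans (_ : _ <= _ * _) (le_trans h _).
  by rewrite le_eqVlt; apply/orP; left; apply/eqP; ring.
by rewrite le_eqVlt; apply/orP; left; apply/eqP; field; rewrite !gt_eqF.
Qed.


Lemma le_of_sum5 (a b c d e l : R) : 0 < a -> 0 < b -> 0 < c -> 0 < d -> 0 < e ->
  a + b + c + d + e + 1 <= l ->
  [/\ a <= l, b <= l, c <= l, d <= l & e <= l] /\ 1 <= l.
Proof. by move=> *; split; [split|]; lra. Qed.

End Growth.

Section Asymptotics.
Context (R : realType) (q alpha eps : R).
Hypotheses (q1 : 1 <= q) (alpha0 : 0 < alpha) (eps0 : 0 < eps).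
Local Notation P := (uniform_prob (ltNhalf_half R)).
Local Notation pt n := (n.-tuple (measurableTypeR R)).

(** With v of order (ln d)^4 / d, all n summands are bounded by the same quantity,
whose n-fold is of order n^3 p^2 v plus terms exponentially small in n. *)
Lemma sum_chi2_small (e : R) : 0 < e ->
  exists2 A : R, 0 < A & exists2 M : R, 0 < M &
  forall (n d : nat) (p s : R), (0 < n)%N -> A <= ln n%:R ->
  alpha / n%:R <= p <= 1 - eps ->
  M * (n%:R * ln n%:R) <= d%:R -> M * (p ^+ 2 * n%:R ^+ 3 * ln n%:R ^+ 6) <= d%:R ->
  (forall y : pt d, Ex (iid P d) (fun t => (near q s y t)%:R) = p) ->
  \sum_(k < n) chi2 (iid P d) (near q s (n := d)) p k <= e.
Proof.
move=> e0; have [C [c0 [C0 c00 hchi]]] := chi2_le q1.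
have ma : 0 < alpha ^+ 2 by rewrite exprn_gt0.
have me : 0 < eps ^+ 2 by rewrite exprn_gt0.
have mc : 0 < C ^+ 2 by rewrite exprn_gt0.
(* t bounds p^2 n^3 v: its three parts serve the variance term, the case u < 1 and
   the case u = 1 of the tail term *)
pose t := Num.min (e * eps ^+ 2 / (3 * 128))
  (Num.min (eps ^+ 2 / (192 * 16)) (alpha ^+ 2 / 192)).
have t0 : 0 < t by rewrite !lt_min !divr_gt0// ?mulr_gt0.
have [A1 A10 [M1 M10 h1]] := codegree_scale (divr_gt0 t0 mc).
have z1 : 0 < C * alpha ^+ 2 / 2 by rewrite divr_gt0// mulr_gt0.
have [A2 A20 h2] := slack_small z1.
have [A3 A30 h3] := pow_le_expR 2 (divr_gt0 ltr01 c00) ltr01.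
have z2 : 0 < e / 3 / (18 / (alpha ^+ 2 * eps ^+ 2)).
  by rewrite !(divr_gt0, mulr_gt0).
have [A4 A40 h4] := pow_le_expR 5 z2 (ltr0n R 4).
have z3 : 0 < e / 6 by rewrite divr_gt0.
have [A5 A50 h5] := pow_le_expR 0 z3 ltr01.
exists (A1 + A2 + A3 + A4 + A5 + 1); first by rewrite !addr_gt0.
exists (M1 + 4 * 48) => [|n d p s n0 hA /andP[pl pu] hd1 hd2 hs]; first by rewrite addr_gt0.
have N0 : 0 < n%:R :> R by rewrite ltr0n.
have [[g1 g2 g3 g4 g5] L1] := le_of_sum5 A10 A20 A30 A40 A50 hA.
have N1 : 1 <= n%:R :> R by rewrite ler1n.
have LN : ln n%:R <= n%:R :> R.
  by rewrite -[leRHS](@lnK R) ?posrE//; apply: le_trans (expR_ge1Dx _); rewrite lerDr.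
have NL : n%:R <= n%:R * ln n%:R :> R by rewrite ler_peMr.
have NL0 : 0 <= n%:R * ln n%:R :> R by exact: le_trans (ltW N0) NL.
have dN : 4 * 48 * n%:R <= d%:R :> R.
  have c48 : 0 <= 4 * 48 :> R by exact: mulr_ge0.
  apply: le_trans hd1; apply: le_trans (ler_wpM2l c48 NL) _; rewrite [leRHS]mulrDl.
  by rewrite lerDr mulr_ge0// ltW.
have c48 : 1 < 4 * 48 :> R by rewrite -natrM ltr1n.
have dN1 : 4 * 48 <= d%:R :> R by apply: le_trans dN; rewrite ler_peMr ?mulr_ge0.
have nd : (n <= d)%N.
  by rewrite -(ler_nat R); apply: le_trans dN; rewrite ler_peMl ?(ltW c48) ?(ltW N0).
have d0 : (0 < d)%N by exact: leq_trans nd.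
have D0 : 0 < d%:R :> R by rewrite ltr0n.
have Ll : ln n%:R <= ln d%:R :> R by rewrite ler_ln ?posrE// ler_nat.
have d1 : (1 < d)%N by rewrite -(ltr_nat R); exact: lt_le_trans c48 dN1.
have p0 : 0 < p by apply: lt_le_trans pl; rewrite divr_gt0.
have p1 : p < 1 by apply: le_lt_trans pu _; rewrite ltrBlDr ltrDl.
have p01 : 0 < p < 1 by rewrite p0.
set l := ln d%:R in Ll *.
have l1 : 1 <= l by exact: le_trans L1 Ll.
have hX : p ^+ 2 * n%:R ^+ 3 * l ^+ 4 <= t / C ^+ 2 * d%:R.
  have p01' : 0 <= p <= 1 by rewrite !ltW.
  apply: (h1 n d p n0 g1 nd p01'); apply: le_trans hd2.
  apply: ler_wpM2r; last by rewrite lerDl mulr_ge0.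
  apply: mulr_ge0; last by rewrite exprn_ge0// (le_trans ler01).
  by apply: mulr_ge0; rewrite exprn_ge0// ltW.
have sl0 : 0 <= slack R d by rewrite addr_ge0// mulr_ge0 ?expR_ge0.
have hsl : slack R d * d%:R ^+ 3 <= C * alpha ^+ 2 / 2.
  exact: h2 d d0 (le_trans g2 Ll).
set eta := 2 * slack R d / ratio C d.
have eta1 : eta <= p ^+ 2.
  by apply: (eta_le_sqr sl0 l1 C0 alpha0 _ pl hsl); rewrite N0 ler_nat.
have l0 : 0 < l by exact: lt_le_trans l1.
have ra0 : 0 < ratio C d by rewrite divr_gt0// mulr_gt0// exprn_gt0.
have eta0 : 0 <= eta by apply: divr_ge0; [exact: mulr_ge0|exact: ltW].
have eta01 : 0 <= eta <= p ^+ 2 by rewrite eta0.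
pose v := ratio C d ^+ 2 * d%:R.
have vE : v = C ^+ 2 * l ^+ 4 / d%:R by rewrite /v /ratio -/l; field; rewrite gt_eqF.
have v0 : 0 < v by rewrite mulr_gt0// exprn_gt0.
have hV : p ^+ 2 * n%:R ^+ 3 * v <= t.
  rewrite vE (_ : _ * (_ / _) = p ^+ 2 * n%:R ^+ 3 * l ^+ 4 * (C ^+ 2 / d%:R)); last by ring.
  rewrite -ler_pdivlMr ?divr_gt0//; apply: le_trans hX _.
  by rewrite le_eqVlt; apply/orP; left; apply/eqP; field; rewrite !gt_eqF.
have [t1 t2 t3] : [/\ t <= e * eps ^+ 2 / (3 * 128), t <= eps ^+ 2 / (192 * 16) &
    t <= alpha ^+ 2 / 192].
  by rewrite /t; split; rewrite !ge_min lexx ?orbT.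
have hNv : 192 * (n%:R * v) <= 1.
  apply: le_trans (_ : 192 * (t / alpha ^+ 2) <= _).
    rewrite ler_pM2l//; apply: le_trans (sparse_scale alpha0 N0 (ltW v0) pl) _.
    by rewrite ler_pM2r// invr_gt0.
  by rewrite mulrA ler_pdivrMr// mul1r mulrC -ler_pdivlMr.
have hV2 : 192 * 16 * (p ^+ 2 * n%:R ^+ 3 * v) <= eps ^+ 2.
  by rewrite mulrC -ler_pdivlMr//; exact: le_trans hV t2.
have pu2 : 0 < p <= 1 - eps by rewrite p0.
have [u01 hu1 hu2] := slope_bound pu2 eps0 eta01 N1 hNv hV2 erefl.
set u := Num.min _ _ in u01 hu1 hu2.
have [r hr] := tail_exponent N1 v0 u01 hu2.
have vN : v <= n%:R * v by rewrite ler_peMl// ltW.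
have v16 : 16 * v <= 1.
  by apply: le_trans hNv; apply: ler_pM; rewrite ?(ltW v0)// ler_nat.
pose B : R := 128 / eps ^+ 2 * (p ^+ 2 * n%:R ^+ 2 * v) +
  18 / eps ^+ 2 * (n%:R ^+ 2 * rare R d / p ^+ 2) +
  2 ^+ n * (rare R d + expR (- (3 * n%:R))).
have hk (k : 'I_n) : chi2 (iid P d) (near q s (n := d)) p k <= B.
  have u01' : 0 <= u <= 1 by case/andP: u01 => /ltW -> ->.
  have eta1' : eta <= 1 by apply: le_trans eta1 _; rewrite exprn_ile1 ?ltW.
  have hc : c0 * l ^+ 2 <= d%:R.
    have := h3 l; rewrite !mul1r [expR l]lnK ?posrE// => hh.
    by rewrite -ler_pdivlMl//; exact: hh (le_trans g3 Ll).
  apply: le_trans (hchi d s p u k n r d1 l1 hc hs p01 eta1' (ltnW (ltn_ord k)) n0 u01' hu1) _.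
  apply: lerD.
    apply: (second_moment_term pu2 eps0 eta01 (ltW v0) v16 _ (ltW N0)).
    exact: expR_ge0.
  by rewrite ler_wpM2l ?exprn_ge0// lerD2l ler_expR.
have hra : 0 <= rare R d <= expR (- (4 * n%:R)).
  by rewrite expR_ge0 ler_expR lerN2 ler_pdivlMr// mulrAC.
apply: (@le_trans _ _ (n%:R * B)).
  rewrite -[n in n%:R * B]card_ord mulr_natl -sumr_const; apply: ler_sum => k _; exact: hk.
rewrite /B [leLHS]mulrDr [X in X + _ <= _]mulrDr.
have b1 : n%:R * (128 / eps ^+ 2 * (p ^+ 2 * n%:R ^+ 2 * v)) <= e / 3.
  rewrite (_ : _ * (_ * _) = p ^+ 2 * n%:R ^+ 3 * v * (128 / eps ^+ 2)); last by ring.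
  rewrite -ler_pdivlMr ?divr_gt0//; apply: le_trans hV (le_trans t1 _).
  by rewrite le_eqVlt; apply/orP; left; apply/eqP; field; rewrite gt_eqF.
have b2 : n%:R * (18 / eps ^+ 2 * (n%:R ^+ 2 * rare R d / p ^+ 2)) <= e / 3.
  rewrite mulrCA; have := rare_scale alpha0 N0 (expR_ge0 _ : 0 <= rare R d) pl.
  rewrite -(ler_pM2l (_ : 0 < 18 / eps ^+ 2)) ?divr_gt0// => /le_trans; apply.
  have [_ hra2] := andP hra.
  have h : n%:R ^+ 5 <= e / 3 / (18 / (alpha ^+ 2 * eps ^+ 2)) * expR (4 * n%:R).
    exact: h4 (le_trans g4 LN).
  rewrite (_ : _ * (_ * _ / _) = n%:R ^+ 5 * rare R d * (18 / (alpha ^+ 2 * eps ^+ 2))); last first.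
    by field; rewrite !gt_eqF.
  rewrite -ler_pdivlMr ?divr_gt0 ?mulr_gt0//.
  apply: le_trans (ler_pM (exprn_ge0 5 (ltW N0)) (expR_ge0 _) h hra2) _.
  by rewrite -[leLHS]mulrA -expRD subrr expR0 mulr1.
have b3 := exp_terms hra.
have b4 : expR (- n%:R) <= e / 6.
  rewrite expRN -[leLHS]mul1r ler_pdivrMr ?expR_gt0//.
  by have := h5 n%:R; rewrite expr0 mul1r; apply; exact: le_trans g5 LN.
apply: le_trans (lerD (lerD b1 b2) (le_trans b3 (ler_wpM2l (ler0n R 2) b4))) _.
by rewrite le_eqVlt; apply/orP; left; apply/eqP; field.
Qed.
End Asymptotics.

(** * Conclusion *)

Theorem theorem1p2 (R : realType) (q alpha eps : R)
    (p : nat -> R) (d : nat -> nat) :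
  1 <= q -> 0 < alpha -> 0 < eps ->
  (\forall n \near \oo, alpha / n%:R <= p n <= 1 - eps) ->
  (fun n : nat => Num.max (n%:R * ln n%:R)
                          (p n ^+ 2 * n%:R ^+ 3 * ln n%:R ^+ 6) : R)
    =o_\oo (fun n : nat => (d n)%:R : R) ->
  TV (@RGG R q n (d n) (p n)) (@Gnp R n (p n)) @[n --> \oo] --> (0 : R).
Proof.
move=> q1 alpha0 eps0 hp /eqoP hd; apply/cvgrPdist_le => e e0.
(* 1 / c is half of the target e, the other half being c times the entropy *)
pose c := 2 / e; have c0 : 0 < c by rewrite divr_gt0.
have [A A0 [M M0 hsum]] := sum_chi2_small q1 alpha0 eps0 (divr_gt0 (divr_gt0 e0 (ltr0n R 2)) c0).
have Mi : 0 < M^-1 by rewrite invr_gt0.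
have hlarge : \forall n \near \oo, expR (A + 1) <= n%:R :> R by exact: nbhs_infty_ger.
move: (hd _ Mi) => {}hd.
near=> n.
have nA : expR (A + 1) <= n%:R by near: n; exact: hlarge.
have hpn : alpha / n%:R <= p n <= 1 - eps by near: n; exact: hp.
have N0 : 0 < n%:R :> R by apply: lt_le_trans nA; exact: expR_gt0.
have n0 : (0 < n)%N by rewrite -(ltr0n R).
have lnA : A + 1 <= ln n%:R by rewrite -ler_expR lnK ?posrE.
have L1 : 1 <= ln n%:R :> R by apply: le_trans lnA; rewrite lerDr ltW.
have {}hdn : M * Num.max (n%:R * ln n%:R) (p n ^+ 2 * n%:R ^+ 3 * ln n%:R ^+ 6) <= (d n)%:R.
  rewrite -ler_pdivlMl// -[X in _ <= _ * X](ger0_norm (ler0n R _)).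
  by apply: le_trans (ler_norm _) _; near: n; exact: hd.
have hd1 : M * (n%:R * ln n%:R) <= (d n)%:R.
  by apply: le_trans hdn; rewrite ler_pM2l// le_max lexx.
have hd2 : M * (p n ^+ 2 * n%:R ^+ 3 * ln n%:R ^+ 6) <= (d n)%:R.
  by apply: le_trans hdn; rewrite ler_pM2l// le_max lexx orbT.
have pn01 : 0 < p n < 1.
  case/andP: hpn => h1 h2; rewrite (lt_le_trans _ h1) ?divr_gt0//.
  by apply: le_lt_trans h2 _; rewrite ltrBlDr ltrDl.
have : (0 < d n)%N.
  by rewrite -(ltr0n R); apply: lt_le_trans hd1; rewrite !mulr_gt0// (lt_le_trans _ L1).
case: (d n) hd1 hd2 => [//|m] hd1 hd2 _.
have hs := near_threshold q1 pn01.
rewrite sub0r normrN ger0_norm; last first.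
  by rewrite mulr_ge0 ?invr_ge0//; apply: sumr_ge0.
apply: le_trans (tv_le_chi2 q1 n m pn01 c0) _.
have hA : A <= ln n%:R by apply: le_trans lnA; rewrite lerDl.
have := hsum n m.+1 (p n) _ n0 hA hpn hd1 hd2 (hs m).
rewrite -(ler_pM2l c0) mulrCA divff ?gt_eqF// mulr1 => h.
by apply: le_trans (lerD h (lexx _)) _; rewrite /c invf_div -splitr.
Unshelve. all: by end_near.
Qed.
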